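(* For $\lambda,\mu,\nu\in X^\vee_+$, \[ C^\nu_{\lambda\mu}=\frac{W_\nu(q^{-1})}{W_\mu(q)}\,C_{\lambda t^\mu}(\nu), \] and furthermore \[ C^\nu_{\lambda\mu}=q_{w_\mu}^{-1}\sum_{\sigma\in\Gamma^d_{t^\mu,\lambda}(\nu)}q_{w_0\iota(\sigma)}\,C_\sigma\,F^{\varepsilon(\sigma)}_{\mu\nu}. \] In particular $C_{\lambda t^\mu}(\nu)$ does not depend on the choice of the minimal gallery used to define $t^\mu$.
   Context: Root datum and alcoves. $\Phi=(X,\phi,X^\vee,\phi^\vee)$ is a reduced root datum with finite Weyl group $W$, $V^*=X^\vee\otimes\mathbb R$. Fix simple roots $\alpha_1,\dots,\alpha_l$, positive roots $\phi^+$, length $l$, longest element $w_0$; $X^\vee_+$ dominant cone; $\mathcal C=\{x:\langle\alpha,x\rangle\ge0\ \forall\alpha\in\phi^+\}$ with walls $H_{\alpha_i,0}$, where $H_{\alpha,m}=\{\langle\alpha,x\rangle=m\}$. Alcoves: closures of components of $V^*\setminus\bigcup H_{\alpha,m}$; $A_f=\{0\le\langle\alpha,x\rangle\le 1\}$. $\tilde W^a=W\ltimes X^\vee$ ($\tau_\mu$ translations), $W^a=W\ltimes Q^\vee$ Coxeter with generators $S^a$ (reflections in walls of $A_f$), $\Omega$ stabilizer of $A_f$, $\tilde W^a=\Omega\ltimes W^a$, $l(wg)=l(w)$. Generalized alcoves $\tilde{\mathcal A}=\{(A,\mu):\mu\in A\cap X^\vee\}$ with free transitive componentwise $\tilde W^a$-action,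 $A_v=v\cdot(A_f,0)$, right action $A_vu=A_{vu}$, each uniquely $\mu+A_w$ ($w\in W$) with $wt=\mu$, $\delta=w$. For $s\in S^a$ the alcoves of $A,As$ share a face in some $H_{\alpha,m}$ ($\alpha\in\phi^+$), the separating hyperplane; $A\prec As$ if the alcove of $A$ lies in $\{\langle\alpha,x\rangle\le m\}$, otherwise $A\succ As$. Stabilizers: $W_\mu$, longest element $w_\mu$, minimal representatives $W^\mu$ of $W/W_\mu$, $n^\mu$ minimal element of $\tau_\mu W$. Galleries: type $t=(t_1,\dots,t_k)$, $t_i\in S^a\cup\Omega$; gallery $(A_0,\dots,A_k)$ with $A_{i+1}=A_it_{i+1}$ if $t_{i+1}\in\Omega$, $A_{i+1}\in\{A_i,A_it_{i+1}\}$ otherwise; $\iota(\sigma)=\delta(A_0)$, $wt(\sigma)=wt(A_k)$, $\varepsilon(\sigma)=\delta(A_k)$. Positive $s$-direction at $i$: $t_{i+1}=s$, $A_{i+1}=A_is$, $A_i\prec A_is$. $s$-fold at $i$: $t_{i+1}=s\in S^a$, $A_{i+1}=A_i$; folding hyperplane = separating hyperplane of $A_i$ and $A_is$; positive if $A_i\succ A_is$. Positively folded: all folds positive; minimal: shortest between its endpoints. $t^\mu$ = type of a minimal gallery from $A_f$ to $A_{n^\mu}$. $\Gamma^d_{t,\lambda}(\nu)$ = positively folded galleries of type $t$ with $wt(A_0)=\lambda$, weight $\nu$, all of whose alcoves lie in $\mathcal C$ (folding hyperplanes may be walls of $\mathcal C$). Parameters: $d:S^a\to\mathbb N$ invariant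 under $\tilde W^a$-conjugation, $\mathcal L=\mathbb Z[q^{\pm1/2}]$, $q_s=q^{d(s)}$, $q_v=\prod q_{t_j}$ for reduced $v=t_1\cdots t_kg$ ($g\in\Omega$); $H(q)=\sum_{w\in H}q_w$, $H(q^{-1})=\sum_{w\in H}q_w^{-1}$ for $H\subset W$; $q_\lambda=q_{\tau_\lambda}^{1/2}$ for dominant $\lambda$ and $q_{\lambda-\lambda'}=q_\lambda/q_{\lambda'}$. Statistics: for positively folded $\sigma$ and $s\in S^a$: $m_s$ = number of positive $s$-directions, $p_s$ = number of $s$-folds whose folding hyperplane is a wall of $\mathcal C$, $r_s$ = number of other $s$-folds; $C_\sigma=\prod_s q_s^{m_s+p_s}(q_s-1)^{r_s}$. $C_{\lambda t}(\nu)=\sum_{\sigma\in\Gamma^d_{t,\lambda}(\nu)}q_{w_0\iota(\sigma)}C_\sigma$. For $\mu,\nu\in X^\vee_+$, $w\in W$: $F^w_{\mu\nu}=q_w\sum_{v\in W^{w_0\mu}\cap W_\nu w}q_v^{-1}$. Hecke algebra: $\tilde{\mathcal H}$ with $\mathcal L$-basis $T_w$ ($w\in\tilde W^a$), $T_s^2=q_sT_{id}+(q_s-1)T_s$, $T_vT_w=T_{vw}$ if lengths add. Macdonald basis $M_\lambda=\frac1{W(q)}\sum_{w\in W\tau_\lambda W}T_w$, $\lambda\in X^\vee_+$, of the spherical Hecke algebra; $C^\nu_{\lambda\mu}$ is defined by $M_\lambda M_\mu=\sum_{\nu\in X^\vee_+}q_{\lambda-\nu}^2C^\nu_{\lambda\mu}M_\nu$.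 *)

(* Defs.v *)
From HB Require Import structures.
From mathcomp Require Import all_boot all_order all_algebra.
From mathcomp Require Import all_classical all_reals topology normedtype.
From mathcomp Require Import fraction.

Set Implicit Arguments.
Unset Strict Implicit.
Unset Printing Implicit Defensive.

Import Order.TTheory GRing.Theory Num.Theory.
Import numFieldNormedType.Exports.

Local Open Scope classical_set_scope.
Local Open Scope ring_scope.

(* X = Z^n (row vectors) and X^vee = Z^n (column vectors), in dual bases for
   the perfect pairing <x, y> = x *m y.  Matrices act on X^vee from the left. *)
Definition pairing n (x : 'rV[int]_n) (y : 'cV[int]_n) : int := (x *m y) 0 0.

(* A reduced root datum; phi^vee is the image of [roots] under [coroot], whose
   values outside [roots] are irrelevant. *)
Record rootDatum (n : nat) := RootDatum {
  roots : seq 'rV[int]_n;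
  coroot : 'rV[int]_n -> 'cV[int]_n;
  coroot_inj : {in roots &, injective coroot};
  pairing_coroot : {in roots, forall a, pairing a (coroot a) = 2};
  reflect_root :
    {in roots &, forall a b, b - pairing b (coroot a) *: a \in roots};
  reflect_coroot :
    {in roots &, forall a b,
       coroot b - pairing a (coroot b) *: coroot a \in map coroot roots};
  roots_reduced :
    {in roots &, forall a b, forall i j : int,
       i != 0 -> i *: a = j *: b -> b = a \/ b = - a}
}.

Record rootBase n (D : rootDatum n) := RootBase {
  base_size : nat;
  simple : 'I_base_size -> 'rV[int]_n;
  simple_root : forall i, simple i \in roots D;
  simple_free : forall c : 'I_base_size -> int,
    \sum_i c i *: simple i = 0 -> forall i, c i = 0;
  simple_span : {in roots D, forall b, exists c : 'I_base_size -> nat,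
    b = \sum_i simple i *+ c i \/ b = - \sum_i simple i *+ c i}
}.

Arguments simple {n D} r i.

(* The pair (mu, w) stands for tau_mu w, that is x |-> mu + w x. *)
Notation affine n := ('cV[int]_n * 'M[int]_n)%type.

Definition amul n (u v : affine n) : affine n :=
  (u.1 + u.2 *m v.1, u.2 *m v.2).
Definition aone n : affine n := (0, 1%:M).
Definition trans n (mu : 'cV[int]_n) : affine n := (mu, 1%:M).
Definition lin n (w : 'M[int]_n) : affine n := (0, w).

(* The coefficient field Frac(Z[q^{1/2}]), which contains L = Z[q^{+-1/2}]; it
   is needed for the denominators W(q) and W_mu(q). *)
Notation coef := {fraction {poly int}}.
Definition qhalf : coef := tofrac 'X.
Definition qpar : coef := qhalf ^+ 2.

(* A generalized alcove (A, mu), mu \in A. *)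
Notation galcove R n := (set 'cV[R]_n * 'cV[int]_n)%type.

Section Alcoves.
Variables (R : realType) (n : nat) (D : rootDatum n) (B : rootBase D).

Definition pos_root : set 'rV[int]_n :=
  [set a | a \in roots D /\
           exists c : 'I_(base_size B) -> nat, a = \sum_i simple B i *+ c i].

Definition dominant : set 'cV[int]_n :=
  [set mu | forall a, pos_root a -> 0 <= pairing a mu].

Definition refl (a : 'rV[int]_n) : 'M[int]_n := 1%:M - coroot D a *m a.

Definition weyl : set 'M[int]_n :=
  [set w | exists2 s : seq 'rV[int]_n, {subset s <= roots D} &
           w = \big[mulmx/1%:M]_(a <- s) refl a].

Definition ext_weyl : set (affine n) := [set v | weyl v.2].

(* V^* = X^vee (x) R = R^n *)
Definition embed (mu : 'cV[int]_n) : 'cV[R]_n := map_mx intr mu.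

Definition pairingR (a : 'rV[int]_n) (x : 'cV[R]_n) : R :=
  (map_mx intr a *m x) 0 0.

Definition hyperplane (a : 'rV[int]_n) (m : int) : set 'cV[R]_n :=
  [set x | pairingR a x = m%:~R].

Definition off_hyperplanes : set 'cV[R]_n :=
  [set x | forall a m, pos_root a -> ~ hyperplane a m x].

Definition alcove (A : set 'cV[R]_n) : Prop :=
  exists2 x, off_hyperplanes x &
             A = closure (connected_component off_hyperplanes x).

Definition fund_alcove : set 'cV[R]_n :=
  [set x | forall a, pos_root a -> 0 <= pairingR a x <= 1].

Definition chamber : set 'cV[R]_n :=
  [set x | forall a, pos_root a -> 0 <= pairingR a x].

Definition actV (v : affine n) (x : 'cV[R]_n) : 'cV[R]_n :=
  embed v.1 + map_mx intr v.2 *m x.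

(* P contains a codimension one face lying in H_{a,m}: it has a point which is
   on H_{a,m} and on no other hyperplane. *)
Definition has_face (P : set 'cV[R]_n) (a : 'rV[int]_n) (m : int) : Prop :=
  exists2 x, P x & hyperplane a m x /\
    forall b k, pos_root b -> hyperplane b k x -> b = a /\ k = m.

(* The affine reflection x |-> x - (<a, x> - m) a^vee. *)
Definition arefl (a : 'rV[int]_n) (m : int) : affine n :=
  (m *: coroot D a, refl a).

(* S^a, the reflections in the walls of A_f *)
Definition sgen : set (affine n) :=
  [set s | exists a m, [/\ pos_root a, has_face fund_alcove a m &
                           s = arefl a m]].

Definition Omega : set (affine n) :=
  [set g | ext_weyl g /\ actV g @` fund_alcove = fund_alcove].

Definition is_expr (v : affine n) (t : seq (affine n)) : Prop :=
  (forall s, s \in t -> sgen s) /\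
  exists2 g, Omega g & v = foldr (@amul n) g t.

Definition reduced (v : affine n) : set (seq (affine n)) :=
  [set t | is_expr v t /\ forall t', is_expr v t' -> (size t <= size t')%N].

Definition red_word (v : affine n) : seq (affine n) := xget [::] (reduced v).

Definition len (v : affine n) : nat := size (red_word v).

Definition longest (P : set 'M[int]_n) : 'M[int]_n :=
  xget 1%:M [set w | P w /\
                     forall w', P w' -> (len (lin w') <= len (lin w))%N].

Definition w0 : 'M[int]_n := longest weyl.

Definition stab (mu : 'cV[int]_n) : set 'M[int]_n :=
  [set w | weyl w /\ w *m mu = mu].

(* W^mu *)
Definition min_reps (mu : 'cV[int]_n) : set 'M[int]_n :=
  [set w | weyl w /\
           forall u, stab mu u -> (len (lin w) <= len (lin (w *m u)))%N].

(* n^mu *)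
Definition nmin (mu : 'cV[int]_n) : affine n :=
  xget (trans mu) [set v | exists w, [/\ weyl w, v = amul (trans mu) (lin w) &
    forall w', weyl w' -> (len v <= len (amul (trans mu) (lin w')))%N]].

Definition generalized_alcove : set (galcove R n) :=
  [set A | alcove A.1 /\ A.1 (embed A.2)].

(* A_v = v . (A_f, 0), for the componentwise action *)
Definition galc (v : affine n) : galcove R n :=
  (actV v @` fund_alcove, v.1 + v.2 *m 0).

Definition wt (A : galcove R n) : 'cV[int]_n := A.2.

(* The w in W such that A = mu + A_w with mu = wt A. *)
Definition delta (A : galcove R n) : 'M[int]_n :=
  xget 1%:M [set w | weyl w /\ A = galc (amul (trans (wt A)) (lin w))].

(* A_v u = A_{v u} *)
Definition ract (A : galcove R n) (u : affine n) : galcove R n :=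
  galc (amul (amul (trans (wt A)) (lin (delta A))) u).

(* H_{a,m} is the hyperplane separating A and A s. *)
Definition separating (A : galcove R n) (s : affine n)
    (a : 'rV[int]_n) (m : int) : Prop :=
  pos_root a /\ has_face (A.1 `&` (ract A s).1) a m.

Definition precedes (A : galcove R n) (s : affine n) : Prop :=
  exists a m, separating A s a m /\
              A.1 `<=` [set x | pairingR a x <= m%:~R].

(* The i-th entries, counted from 0: sigma = (A_0, ..., A_k), whereas t_{i+1}
   in the 1-based numbering of types is [typ t i]. *)
Definition alc (sigma : seq (galcove R n)) (i : nat) : galcove R n :=
  nth (galc (aone n)) sigma i.
Definition typ (t : seq (affine n)) (i : nat) : affine n := nth (aone n) t i.

Definition gallery (t : seq (affine n)) : set (seq (galcove R n)) :=
  [set sigma |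
    [/\ size sigma = (size t).+1,
        forall i, (i < size t)%N -> (sgen `|` Omega) (typ t i),
        forall i, (i <= size t)%N -> generalized_alcove (alc sigma i) &
        forall i, (i < size t)%N ->
          (Omega (typ t i) ->
             alc sigma i.+1 = ract (alc sigma i) (typ t i)) /\
          (sgen (typ t i) ->
             alc sigma i.+1 = alc sigma i \/
             alc sigma i.+1 = ract (alc sigma i) (typ t i))]].

Definition first_alc (sigma : seq (galcove R n)) := head (galc (aone n)) sigma.
Definition last_alc (sigma : seq (galcove R n)) := last (galc (aone n)) sigma.

(* iota, wt and epsilon of a gallery *)
Definition gal_initial sigma := delta (first_alc sigma).
Definition gal_wt sigma := wt (last_alc sigma).
Definition gal_ending sigma := delta (last_alc sigma).

Definition minimal_gallery t sigma : Prop :=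
  gallery t sigma /\
  forall t' sigma', gallery t' sigma' ->
    first_alc sigma' = first_alc sigma -> last_alc sigma' = last_alc sigma ->
    (size t <= size t')%N.

(* t is one of the possible choices for the type t^mu. *)
Definition is_tmu (mu : 'cV[int]_n) (t : seq (affine n)) : Prop :=
  exists sigma, [/\ minimal_gallery t sigma,
    first_alc sigma = galc (aone n) & last_alc sigma = galc (nmin mu)].

Section Statistics.
Variables (t : seq (affine n)) (sigma : seq (galcove R n)).

Definition pos_direction (s : affine n) (i : nat) : Prop :=
  [/\ typ t i = s, alc sigma i.+1 = ract (alc sigma i) s &
      precedes (alc sigma i) s].

Definition fold_at (s : affine n) (i : nat) : Prop :=
  [/\ typ t i = s, sgen s & alc sigma i.+1 = alc sigma i].

Definition pos_folded : Prop :=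
  forall s i, (i < size t)%N -> fold_at s i -> ~ precedes (alc sigma i) s.

Definition wall_fold (s : affine n) (i : nat) : Prop :=
  fold_at s i /\ exists j, separating (alc sigma i) s (simple B j) 0.

Definition other_fold (s : affine n) (i : nat) : Prop :=
  fold_at s i /\ ~ exists j, separating (alc sigma i) s (simple B j) 0.

Definition stat_m (s : affine n) : nat :=
  count (fun i => `[< pos_direction s i >]) (iota 0 (size t)).
Definition stat_p (s : affine n) : nat :=
  count (fun i => `[< wall_fold s i >]) (iota 0 (size t)).
Definition stat_r (s : affine n) : nat :=
  count (fun i => `[< other_fold s i >]) (iota 0 (size t)).
End Statistics.

(* Gamma^d_{t,la}(nu) *)
Definition Gamma (t : seq (affine n)) (la nu : 'cV[int]_n) :
    set (seq (galcove R n)) :=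
  [set sigma | [/\ gallery t sigma, pos_folded t sigma,
     wt (first_alc sigma) = la, gal_wt sigma = nu &
     forall A, A \in sigma -> A.1 `<=` chamber]].

Section HeckeParams.
Variable d : affine n -> nat.

Definition conj_invariant : Prop :=
  forall s s' u, sgen s -> sgen s' -> ext_weyl u ->
    amul u s = amul s' u -> d s = d s'.

Definition q_gen (s : affine n) : coef := qpar ^+ d s.
Definition q_of (v : affine n) : coef := \prod_(s <- red_word v) q_gen s.

(* q_la, the square root of q_of (trans la) *)
Definition q_wt (la : 'cV[int]_n) : coef :=
  \prod_(s <- red_word (trans la)) qhalf ^+ d s.

(* H(q) and H(q^{-1}) for H \subset W *)
Definition poincare (H : set 'M[int]_n) : coef :=
  \sum_(w \in H) q_of (lin w).
Definition poincareV (H : set 'M[int]_n) : coef :=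
  \sum_(w \in H) (q_of (lin w))^-1.

Definition C_gal (t : seq (affine n)) (sigma : seq (galcove R n)) : coef :=
  \big[*%R/1]_(s \in sgen)
    (q_gen s ^+ (stat_m t sigma s + stat_p t sigma s)
     * (q_gen s - 1) ^+ stat_r t sigma s).

(* C_{la t}(nu) *)
Definition C_sum (t : seq (affine n)) (la nu : 'cV[int]_n) : coef :=
  \sum_(sigma \in Gamma t la nu)
    q_of (lin (w0 *m gal_initial sigma)) * C_gal t sigma.

(* F^w_{mu nu} *)
Definition F_coef (w : 'M[int]_n) (mu nu : 'cV[int]_n) : coef :=
  q_of (lin w) *
  \sum_(v \in min_reps (w0 *m mu) `&` [set u *m w | u in stab nu])
     (q_of (lin v))^-1.

(* The Hecke algebra with scalars extended from L to its fraction field: the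
   L-span of the T_w is the integral form, and the elements of (1/W(q)) times
   it live in [hecke_alg].  The axioms determine (hecke_alg, hecke_T) up to
   unique isomorphism; hecke_T is only meaningful on [ext_weyl]. *)
Record heckeAlgebra := HeckeAlgebra {
  hecke_alg : algType coef;
  hecke_T : affine n -> hecke_alg;
  hecke_free : forall (r : seq (affine n)) (c : affine n -> coef),
    uniq r -> (forall w, w \in r -> ext_weyl w) ->
    \sum_(w <- r) c w *: hecke_T w = 0 -> forall w, w \in r -> c w = 0;
  hecke_span : forall h : hecke_alg,
    exists (r : seq (affine n)) (c : affine n -> coef),
      (forall w, w \in r -> ext_weyl w) /\ h = \sum_(w <- r) c w *: hecke_T w;
  hecke_quad : forall s, sgen s ->
    hecke_T s * hecke_T s =
      q_gen s *: hecke_T (aone n) + (q_gen s - 1) *: hecke_T s;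
  hecke_mul : forall v w, ext_weyl v -> ext_weyl w ->
    len (amul v w) = (len v + len w)%N ->
    hecke_T v * hecke_T w = hecke_T (amul v w)
}.

Section Macdonald.
Variable H : heckeAlgebra.

Definition double_coset (la : 'cV[int]_n) : set (affine n) :=
  [set v | exists w w', [/\ weyl w, weyl w' &
                            v = amul (amul (lin w) (trans la)) (lin w')]].

(* M_la *)
Definition macdonald (la : 'cV[int]_n) : hecke_alg H :=
  (poincare weyl)^-1 *: \sum_(v \in double_coset la) hecke_T H v.

(* c is the family of the C^nu_{la mu}, nu dominant. *)
Definition is_struct_const (la mu : 'cV[int]_n) (c : 'cV[int]_n -> coef) :
    Prop :=
  finite_set [set nu | dominant nu /\ c nu != 0] /\
  macdonald la * macdonald mu =
    \sum_(nu \in dominant)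
      ((q_wt la / q_wt nu) ^+ 2 * c nu) *: macdonald nu.

(* C^nu_{la mu} *)
Definition struct_const (la mu nu : 'cV[int]_n) : coef :=
  xget (fun=> 0) [set c | is_struct_const la mu c] nu.
End Macdonald.
End HeckeParams.
End Alcoves.

Arguments Gamma R {n D} B t la nu _.

(* Main.v *)
Require Import Defs.
From mathcomp Require Import all_boot all_order all_algebra.
From mathcomp Require Import all_classical all_reals topology normedtype.
From mathcomp Require Import fraction finmap.
From mathcomp Require Import zify ring lra.
Import Defs.

Set Implicit Arguments.
Unset Strict Implicit.
Unset Printing Implicit Defensive.

Import Order.TTheory GRing.Theory Num.Theory.
Import numFieldNormedType.Exports.

Local Open Scope classical_set_scope.
Local Open Scope ring_scope.

(* Let 1_0 be the sum of the T_w over W, and E_v = q_v^-1 1_0 T_v for an alcove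
   v in the dominant chamber C.  If the separating hyperplane of v and vs is a
   wall of C then E_v T_s = q_s E_v; otherwise vs lies in C and E_v T_s is
   q_s E_(vs) or E_(vs) + (q_s - 1) E_v, according to the sign of the crossing.
   Right multiplication by T_(n^mu) is thus a sum over the positively folded
   galleries of type t^mu in C: E_(la,w) T_(n^mu) is the sum of C_sigma E_end,
   where end is the last alcove of sigma.  Here t^mu is a reduced word of n^mu
   because the gallery is minimal.  As M_la is a combination of the E_(la,w)
   with w minimal in W_la w, expanding M_la T_(n^mu) 1_0 gives the first formula.
   For the second one, the factor 1_0 is replaced by the sum of the T_x over the
   maximal representatives x of the cosets W_k x, k = - w_0 mu, and the
   coefficient of M_nu is extracted by pairing T_((n^nu)^-1) with the product
   under the trace form tau, for which tau (T_u T_v) = q_v if uv = 1 and 0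
   otherwise. *)

(** * Root data and Weyl groups *)

(** The definitions treat alcoves as closures of connected components, whereas the computations use
    integers: the floors [kf v a] of the positive roots on the alcove of v determine its distance to
    other alcoves, its walls and whether it lies in C. Topology enters only where generalized
    alcoves are identified with elements of the extended group. The geometric input to the Coxeter
    theory is [face_separation]: it yields left descents, and with hyperplane counts these give the
    exchange condition and the independence of q_v from the reduced word.

    The factor q_v^-1 in E_v makes the first formula blind to the final direction of a gallery:
    E_(nu,w) 1_0 is the same multiple of M_nu for all minimal w. The sum over maximal
    representatives does not absorb W on its left, so in the second formula the direction survives,
    as F. There a single product of E_v with that sum need not be spherical, only the total is;
    hence a linear functional is used instead of a comparison of coefficients. The same functionals
    show that the structure constants, which are defined by choice, are determined. *)

Section Pairing.
Variable n : nat.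
Implicit Types (a b : 'rV[int]_n) (x y : 'cV[int]_n) (w : 'M[int]_n).

Lemma pairingDl a b y : pairing (a + b) y = pairing a y + pairing b y.
Proof. by rewrite /pairing mulmxDl mxE. Qed.

Lemma pairingNl a y : pairing (- a) y = - pairing a y.
Proof. by rewrite /pairing mulNmx mxE. Qed.

Lemma pairingBl a b y : pairing (a - b) y = pairing a y - pairing b y.
Proof. by rewrite pairingDl pairingNl. Qed.

Lemma pairingZl k a y : pairing (k *: a) y = k * pairing a y.
Proof. by rewrite /pairing -scalemxAl mxE. Qed.

Lemma pairing0l y : pairing 0 y = 0.
Proof. by rewrite /pairing mul0mx mxE. Qed.

Lemma pairingDr a x y : pairing a (x + y) = pairing a x + pairing a y.
Proof. by rewrite /pairing mulmxDr mxE. Qed.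

Lemma pairingNr a y : pairing a (- y) = - pairing a y.
Proof. by rewrite /pairing mulmxN mxE. Qed.

Lemma pairingBr a x y : pairing a (x - y) = pairing a x - pairing a y.
Proof. by rewrite pairingDr pairingNr. Qed.

Lemma pairingZr k a y : pairing a (k *: y) = k * pairing a y.
Proof. by rewrite /pairing -scalemxAr mxE. Qed.

Lemma pairing0r a : pairing a 0 = 0.
Proof. by rewrite /pairing mulmx0 mxE. Qed.

Lemma pairing_suml I (r : seq I) (P : pred I) (F : I -> 'rV[int]_n) y :
  pairing (\sum_(i <- r | P i) F i) y = \sum_(i <- r | P i) pairing (F i) y.
Proof.
by elim/big_rec2: _ => [|i u v _ <-]; rewrite ?pairing0l ?pairingDl.
Qed.

Lemma pairing_mulmx a w y : pairing (a *m w) y = pairing a (w *m y).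
Proof. by rewrite /pairing mulmxA. Qed.

Lemma pairing_muln a y k : pairing (a *+ k) y = pairing a y *+ k.
Proof. by elim: k => [|k IH]; rewrite ?mulr0n ?pairing0l // !mulrS pairingDl IH. Qed.

(** A nonzero entry of [c] would make the terms pairwise distinct, more than [s] can hold.
    Finiteness of the root system enters the comparison of coroots through this. *)
Lemma finite_progression (s : seq 'rV[int]_n) (x c : 'rV[int]_n) :
  (forall k : nat, x + c *+ k \in s) -> c = 0.
Proof.
move=> h; apply: contrapT => /eqP c0.
have inj : injective (fun k : nat => x + c *+ k).
  move=> i j /addrI /matrixP e.
  have [j0 cj] : exists j0, c 0 j0 != 0.
    apply: contrapT => hn; move/eqP: c0; apply; apply/matrixP => i0 j0.
    rewrite ord1 mxE; apply: contrapT => /eqP hc; apply: hn; by exists j0.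
  have := e 0 j0; rewrite !mulmxnE -mulr_natr -[RHS]mulr_natr => /(mulfI cj) /eqP.
  by rewrite eqr_nat => /eqP.
have := @uniq_leq_size _ [seq (x + c *+ k) | k <- iota 0 (size s).+1] s.
rewrite size_map size_iota ltnn map_inj_uniq // iota_uniq => hs.
by apply: notF; apply: hs => // _ /mapP[k _ ->].
Qed.

End Pairing.

Lemma subr_scale2 (V : lmodType int) (v : V) : v - 2 *: v = - v.
Proof. by rewrite scaler_nat mulr2n opprD addrA subrr add0r. Qed.

Lemma scale_mx_eq0 m n (k : int) (a : 'M[int]_(m, n)) :
  k *: a = 0 -> a <> 0 -> k = 0.
Proof.
move=> /matrixP ka a0; apply: contrapT => /eqP k0; apply: a0.
apply/matrixP => i j; have := ka i j; rewrite !mxE => /eqP.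
by rewrite mulf_eq0 (negPf k0) => /eqP.
Qed.

Section RootTheory.
Variables (n : nat) (D : rootDatum n).
Implicit Types (a b c : 'rV[int]_n) (x y : 'cV[int]_n) (w : 'M[int]_n).

Lemma mul_refl b a : b *m refl D a = b - pairing b (coroot D a) *: a.
Proof.
rewrite /refl mulmxBr mulmx1 mulmxA [b *m coroot D a]mx11_scalar mul_scalar_mx.
by rewrite /pairing.
Qed.

Lemma refl_mul a y : refl D a *m y = y - pairing a y *: coroot D a.
Proof.
rewrite /refl mulmxBl mul1mx -mulmxA [a *m y]mx11_scalar mul_mx_scalar.
by rewrite /pairing.
Qed.

Lemma root_opp a : a \in roots D -> - a \in roots D.
Proof.
move=> ha; have := reflect_root ha ha; by rewrite (pairing_coroot ha) subr_scale2.
Qed.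

Lemma root_refl a b : a \in roots D -> b \in roots D -> b *m refl D a \in roots D.
Proof. by move=> ha hb; rewrite mul_refl reflect_root. Qed.

Lemma root_neq0 a : a \in roots D -> a <> 0.
Proof. by move=> ha a0; have := pairing_coroot ha; rewrite a0 pairing0l. Qed.

Lemma reflK a : a \in roots D -> refl D a *m refl D a = 1%:M.
Proof.
move=> ha; rewrite {2}/refl mulmxBr mulmx1 mulmxA refl_mul (pairing_coroot ha).
by rewrite subr_scale2 /refl mulNmx opprK addrNK.
Qed.

Lemma mul_refl_self a : a \in roots D -> a *m refl D a = - a.
Proof.
by move=> ha; rewrite mul_refl (pairing_coroot ha) -[X in X - _]scale1r -scalerBl scaleN1r.
Qed.

(** Two reflections negating [c], one along y' and one along the coroot of [c], compose to the
    transvection by <a, y' - c^vee> c, which fixes [c]; its powers run through an arithmetic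
    progression. *)
Lemma refl_transvection a c y' :
  pairing c y' = 2 -> pairing c (coroot D c) = 2 -> forall k : nat,
  iter k (fun b => (b - pairing b y' *: c) *m refl D c) a =
  a + (pairing a (y' - coroot D c) *: c) *+ k.
Proof.
move=> h1 h2; elim=> [|k IH]; first by rewrite addr0.
rewrite iterS IH mul_refl !(pairingDl, pairingBl, pairingNl, pairingZl, pairing_muln).
rewrite h1 h2 pairingBr -scaler_nat !scalerA -!addrA; congr (_ + _).
rewrite -!scaleNr -!scalerDl -scaler_nat scalerA; congr (_ *: _).
ring.
Qed.

(* Both coroot (b s_a) and s_a (coroot b) define reflections of the finite set
   of roots that negate b s_a; the product of two such reflections is
   unipotent of finite order, hence trivial, on the roots. *)
Lemma coroot_refl a b : a \in roots D -> b \in roots D ->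
  coroot D (b *m refl D a) = refl D a *m coroot D b.
Proof.
move=> ha hb; set c := b *m refl D a; set y' := refl D a *m coroot D b.
have hc : c \in roots D by apply: root_refl.
have cy' : pairing c y' = 2.
  by rewrite /c /y' pairing_mulmx mulmxA reflK // mul1mx pairing_coroot.
have eqy e : e \in roots D -> pairing e y' = pairing e (coroot D c).
  move=> he; apply/eqP; rewrite -subr_eq0 -pairingBr; apply/eqP.
  have : pairing e (y' - coroot D c) *: c = 0.
    apply: (@finite_progression _ (roots D) e) => k.
    rewrite -(refl_transvection _ cy' (pairing_coroot hc)).
    elim: k => [//|k IH]; rewrite iterS; apply: root_refl => //.
    move: IH; set f := iter _ _ _ => hf.
    have -> : f - pairing f y' *: c = f *m refl D a *m refl D b *m refl D a.
      rewrite [f *m _ *m refl D b]mul_refl mulmxBl -mulmxA reflK // mulmx1.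
      by rewrite -scalemxAl /y' pairing_mulmx.
    by do 3 apply: root_refl => //.
  by move/scale_mx_eq0; apply; apply: root_neq0.
have [e he ey] : exists2 e, e \in roots D & y' = coroot D e.
  have := reflect_coroot ha hb; rewrite -refl_mul -/y' => /mapP[e he ->].
  by exists e.
(* [reflect_coroot] only says that y' is the coroot of some root e. Since c and e pair to 2 with
   each other's coroots, s_e followed by s_c translates c by 2(c - e), and finiteness forces e =
   c. *)
suff -> : c = e by rewrite ey.
apply/eqP; rewrite -subr_eq0.
have : 2 *: (c - e) = 0.
  apply: (@finite_progression _ (roots D) c) => k.
  suff -> : c + (2 *: (c - e)) *+ k =
            iter k (fun b => b *m refl D e *m refl D c) c.
    elim: k => [//|k IH]; rewrite iterS; do 2 apply: root_refl => //.
  elim: k => [|k IH]; first by rewrite mulr0n addr0.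
  rewrite iterS -IH !mul_refl.
  have ee := pairing_coroot he; have cc := pairing_coroot hc.
  have ec : pairing e (coroot D c) = 2 by rewrite -eqy // ey.
  have ce : pairing c (coroot D e) = 2 by rewrite -ey.
  rewrite !(pairingDl, pairingBl, pairingNl, pairingZl, pairing_muln).
  rewrite ee cc ec ce !subrr !mulr0 !mul0rn !addr0 mulrSr -!addrA; congr (_ + _).
  by congr (_ + _); rewrite scalerBr addrC; congr (_ + _); rewrite -scaleNr.
by move=> h2; apply/negP => /negP /eqP /(scale_mx_eq0 h2).
Qed.

End RootTheory.

Section WeylGroup.
Variables (n : nat) (D : rootDatum n).
Implicit Types (a b c : 'rV[int]_n) (x y : 'cV[int]_n) (w : 'M[int]_n).

Lemma weyl1 : weyl D 1%:M.
Proof. by exists [::] => //; rewrite big_nil. Qed.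

Lemma weylM w w' : weyl D w -> weyl D w' -> weyl D (w *m w').
Proof.
move=> [s hs ->] [s' hs' ->]; exists (s ++ s').
  by move=> a; rewrite mem_cat => /orP[/hs|/hs'].
by elim: s {hs} => [|a s IH]; rewrite ?big_nil ?mul1mx // cat_cons !big_cons -mulmxA IH.
Qed.

Lemma weyl_refl a : a \in roots D -> weyl D (refl D a).
Proof.
move=> ha; exists [:: a]; last by rewrite big_cons big_nil mulmx1.
by move=> b; rewrite inE => /eqP ->.
Qed.

Lemma weyl_ind (P : 'M[int]_n -> Prop) :
  P 1%:M ->
  (forall a w, a \in roots D -> weyl D w -> P w -> P (refl D a *m w)) ->
  forall w, weyl D w -> P w.
Proof.
move=> P1 PS w [s hs ->]; elim: s hs => [|a s IH] hs; first by rewrite big_nil.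
have hs' : {subset s <= roots D} by move=> b bs; apply: hs; rewrite inE bs orbT.
rewrite big_cons; apply: PS; [by apply: hs; rewrite inE eqxx| by exists s |exact: IH].
Qed.

Lemma weylV_subproof w : weyl D w ->
  exists w', [/\ weyl D w', w *m w' = 1%:M & w' *m w = 1%:M].
Proof.
move: w; apply: weyl_ind => [|a w ha hw [w' [hw' e1 e2]]].
  by exists 1%:M; rewrite mulmx1; split => //; exact: weyl1.
exists (w' *m refl D a); split; first by apply: weylM => //; exact: weyl_refl.
  by rewrite -mulmxA [w *m _]mulmxA e1 mul1mx reflK.
by rewrite -mulmxA [refl D a *m (_ *m _)]mulmxA reflK // mul1mx.
Qed.

Lemma weyl_unit w : weyl D w -> w \in unitmx.
Proof. by case/weylV_subproof => w' [_ /mulmx1_unit []]. Qed.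

Lemma weylV w : weyl D w -> weyl D (invmx w).
Proof.
move=> hw; case/weylV_subproof: (hw) => w' [hw' e _].
suff -> : invmx w = w' by [].
by rewrite -[invmx w]mulmx1 -e mulmxA mulVmx ?mul1mx // weyl_unit.
Qed.

Lemma weyl_mulVK w y : weyl D w -> invmx w *m (w *m y) = y.
Proof. by move/weyl_unit => hw; rewrite mulKmx. Qed.

(** Roots are row vectors, so [a *m w] is w^-1 a in the usual notation. *)
Lemma root_weyl a w : a \in roots D -> weyl D w -> a *m w \in roots D.
Proof.
move=> ha hw; elim/weyl_ind: w / hw a ha => [|b w hb _ IH] a ha.
  by rewrite mulmx1.
by rewrite mulmxA; apply: IH; apply: root_refl.
Qed.

Lemma coroot_weyl a w : a \in roots D -> weyl D w ->
  w *m coroot D (a *m w) = coroot D a.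
Proof.
move=> ha hw; elim/weyl_ind: w / hw a ha => [|b w hb _ IH] a ha.
  by rewrite mul1mx mulmx1.
rewrite -mulmxA [a *m _]mulmxA IH ?root_refl // coroot_refl //.
by rewrite mulmxA reflK // mul1mx.
Qed.

Lemma refl_conj a w : a \in roots D -> weyl D w ->
  w *m refl D (a *m w) = refl D a *m w.
Proof.
move=> ha hw; rewrite /refl mulmxBr mulmxBl mulmx1 mul1mx !mulmxA.
by rewrite coroot_weyl.
Qed.

Lemma coroot_opp a : a \in roots D -> coroot D (- a) = - coroot D a.
Proof.
move=> ha; rewrite -[- a](mul_refl_self ha) coroot_refl // refl_mul.
by rewrite (pairing_coroot ha) subr_scale2.
Qed.

Lemma refl_opp a : a \in roots D -> refl D (- a) = refl D a.
Proof. by move=> ha; rewrite /refl coroot_opp // mulmxN mulNmx opprK. Qed.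

End WeylGroup.

(** * Positive roots, 2 rho^vee and generation by simple reflections *)

Section Positivity.
Variables (n : nat) (D : rootDatum n) (B : rootBase D).
Implicit Types (a b c : 'rV[int]_n) (x y : 'cV[int]_n) (w : 'M[int]_n).
Local Notation alpha := (simple B).
Local Notation pos := (pos_root B).

Lemma pos_rootW a : pos a -> a \in roots D. Proof. by case. Qed.

Lemma simple_pos i : pos (alpha i).
Proof.
split; first exact: simple_root; exists (fun j => (j == i) : nat).
rewrite (bigD1 i) //= eqxx mulr1n big1 ?addr0 // => j /negPf ->.
by rewrite mulr0n.
Qed.

Lemma simple_coefI (c c' : 'I_(base_size B) -> int) :
  \sum_i c i *: alpha i = \sum_i c' i *: alpha i -> c =1 c'.
Proof.
move=> e i; apply/eqP; rewrite -subr_eq0; apply/eqP.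
apply: (@simple_free _ _ B (fun i => c i - c' i)).
under eq_bigr do rewrite scalerBl.
by rewrite sumrB e subrr.
Qed.

Lemma pos_or_neg a : a \in roots D -> pos a \/ pos (- a).
Proof.
move=> ha; have [c [e|e]] := simple_span B ha.
  by left; split => //; exists c.
by right; split; [exact: root_opp | exists c; rewrite e opprK].
Qed.

Lemma pos_root_coef a (c : 'I_(base_size B) -> int) i :
  a \in roots D -> a = \sum_j c j *: alpha j -> 0 < c i -> pos a.
Proof.
move=> ha e ci; have [//|[_ [c' e']]] := pos_or_neg ha.
have : c =1 (fun j => - (c' j)%:Z).
  apply: simple_coefI; rewrite -e -[a]opprK e' -sumrN.
  by apply: eq_bigr => j _; rewrite scaleNr -natz scaler_nat.
by move=> /(_ i) ec; move: ci; rewrite ec; lia.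
Qed.

Lemma pos_coefE a : pos a ->
  exists2 c : 'I_(base_size B) -> nat, a = \sum_j (c j)%:Z *: alpha j & 
    exists i, (0 < c i)%N.
Proof.
move=> [ha [c e]]; exists c.
  by rewrite {1}e; apply: eq_bigr => j _; rewrite -natz scaler_nat.
apply: contrapT => h; apply: (root_neq0 ha); rewrite e big1 // => i _.
by case: (posnP (c i)) => [-> //|ci]; case: h; exists i.
Qed.

Lemma pos_opp a : pos a -> ~ pos (- a).
Proof.
move=> pa /pos_coefE [c e [i ci]].
have [c' e' _] := pos_coefE pa.
have : (fun j => - (c' j)%:Z) =1 (fun j => (c j)%:Z).
  apply: simple_coefI; rewrite -e {1}e' -sumrN.
  by apply: eq_bigr => j _; rewrite scaleNr.
by move/(_ i); lia.
Qed.

(** Since the datum is reduced, [a] has a positive coefficient at some j other than i. The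
    reflection changes only coefficient i, and one positive coefficient makes a root positive. *)
Lemma pos_refl_simple a i : pos a -> a <> alpha i -> pos (a *m refl D (alpha i)).
Proof.
move=> pa ai; have [c e _] := pos_coefE pa.
have ha := pos_rootW pa; have hi := simple_root i.
have [j [ji cj]] : exists j, j != i /\ (0 < c j)%N.
  apply: contrapT => h; apply: ai.
  have ec : a = (c i)%:Z *: alpha i.
    rewrite e (bigD1 i) //= big1 ?addr0 // => j ji.
    by case: (posnP (c j)) => [->|cj]; [rewrite scale0r | case: h; exists j].
  have := @roots_reduced _ D _ _ ha hi 1 (c i)%:Z isT.
  rewrite {1}scale1r => /(_ ec) [->//|eN].
  by case: (pos_opp pa); rewrite -eN; exact: simple_pos.
apply: (@pos_root_coef _ (fun k => (c k)%:Z - (if k == i then pairing a (coroot D (alpha i)) else 0)) j).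
- exact: root_refl.
- rewrite mul_refl {1}e (bigD1 i) //= [in RHS](bigD1 i) //= eqxx scalerBl addrAC.
  by congr (_ + _); apply: eq_bigr => k /negPf ->; rewrite subr0.
- by rewrite (negPf ji) subr0; lia.
Qed.

(** This is 2 rho^vee. Its pairing with a root has the sign of the root ([posE]), which turns
    positivity into an integer inequality. *)
Definition rho2 : 'cV[int]_n :=
  \sum_(b <- undup (roots D) | `[< pos b >]) coroot D b.

(** The reflection s_i permutes the positive roots other than alpha_i, hence fixes the sum S of
    their coroots; so alpha_i is orthogonal to S and only <alpha_i, alpha_i^vee> remains. *)
Lemma pairing_simple_rho2 i : pairing (alpha i) rho2 = 2.
Proof.
have hi := simple_root i.
pose P := [pred b | `[< pos b >] && (b != alpha i)].
pose t := [seq b <- undup (roots D) | P b].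
have tu : uniq t by rewrite filter_uniq ?undup_uniq.
have mt b : b \in t = `[< pos b /\ b <> alpha i >].
  rewrite mem_filter mem_undup /=; apply/andP/asboolP.
    by move=> [/andP[/asboolP pb /eqP bi] _].
  by move=> [pb bi]; split; [apply/andP; split; [exact/asboolP|exact/eqP]|exact: pos_rootW].
pose S := \sum_(b <- t) coroot D b.
have eR : rho2 = coroot D (alpha i) + S.
  rewrite /rho2 -big_filter (perm_big (alpha i :: t)) ?big_cons //.
  apply: uniq_perm; first by rewrite filter_uniq ?undup_uniq.
    by rewrite /= tu andbT mt; apply/asboolP => -[].
  move=> b; rewrite inE mt mem_filter mem_undup; apply/andP/orP.
    case=> /asboolP pb _; have [->|bi] := eqVneq b (alpha i); [by left|right].
    by apply/asboolP; split => //; apply/eqP.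
  case=> [/eqP ->|/asboolP[pb _]]; split; rewrite ?(pos_rootW (simple_pos i)) ?pos_rootW //; apply/asboolP; try exact: pb;
    exact: simple_pos.
have eS : refl D (alpha i) *m S = S.
  rewrite /S mulmx_sumr.
  transitivity (\sum_(b <- [seq b *m refl D (alpha i) | b <- t]) coroot D b).
    rewrite big_map !big_seq; apply: eq_bigr => b; rewrite mt => /asboolP[pb _].
    by rewrite coroot_refl // pos_rootW.
  have injr : injective (fun b => b *m refl D (alpha i)).
    by apply: (can_inj (g := fun b => b *m refl D (alpha i))) => b; rewrite -mulmxA reflK // mulmx1.
  apply: perm_big; apply: uniq_perm => //; first by rewrite map_inj_uniq.
  have sub b : b \in t -> b *m refl D (alpha i) \in t.
    rewrite !mt => /asboolP[pb bi]; apply/asboolP; split; first exact: pos_refl_simple.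
    move=> e; case: (@pos_opp (alpha i)); first exact: simple_pos.
    have := congr1 (mulmx^~ (refl D (alpha i))) e.
    by rewrite /= -mulmxA reflK // mulmx1 mul_refl_self // => <-.
  move=> b; apply/mapP/idP => [[c ct ->]|bt]; first exact: sub.
  by exists (b *m refl D (alpha i)); rewrite ?sub // -mulmxA reflK // mulmx1.
have := congr1 (pairing (alpha i)) eS.
rewrite -pairing_mulmx mul_refl_self // pairingNl eR pairingDr pairing_coroot //.
by move=> e; have -> : pairing (alpha i) S = 0 by lia.
Qed.

Lemma pos_rho2 a : pos a -> 0 < pairing a rho2.
Proof.
move=> /pos_coefE [c -> [i ci]]; rewrite pairing_suml (bigD1 i) //=.
rewrite pairingZl pairing_simple_rho2.
apply: ltr_wpDr; last by lia.
by apply: sumr_ge0 => j _; rewrite pairingZl pairing_simple_rho2; lia.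
Qed.

Lemma posE a : a \in roots D -> pos a <-> 0 < pairing a rho2.
Proof.
move=> ha; split; first exact: pos_rho2.
by have [//|/pos_rho2] := pos_or_neg ha; rewrite pairingNl; lia.
Qed.

Lemma root_rho2_neq0 a : a \in roots D -> pairing a rho2 <> 0.
Proof. by move=> ha; have [/pos_rho2|/pos_rho2] := pos_or_neg ha; rewrite ?pairingNl; lia. Qed.

(** A W-invariant integral form, positive on roots: it stands in for the Euclidean structure that a
    root datum does not carry. *)
Definition coform a b : int :=
  \sum_(c <- undup (roots D)) pairing a (coroot D c) * pairing b (coroot D c).

Lemma perm_mul_refl a : a \in roots D ->
  perm_eq [seq c *m refl D a | c <- undup (roots D)] (undup (roots D)).
Proof.
move=> ha; apply: uniq_perm; rewrite ?undup_uniq //.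
  rewrite map_inj_uniq ?undup_uniq //.
  by apply: (can_inj (g := fun b => b *m refl D a)) => b; rewrite -mulmxA reflK // mulmx1.
move=> c; rewrite mem_undup; apply/mapP/idP.
  by move=> [b]; rewrite mem_undup => hb ->; exact: root_refl.
move=> hc; exists (c *m refl D a); rewrite ?mem_undup ?root_refl //.
by rewrite -mulmxA reflK // mulmx1.
Qed.

Lemma coform_refl r a b : r \in roots D ->
  coform (a *m refl D r) (b *m refl D r) = coform a b.
Proof.
move=> hr; rewrite /coform -(perm_big _ (perm_mul_refl hr)) big_map /=.
rewrite !big_seq; apply: eq_bigr => c; rewrite mem_undup => hc.
by rewrite coroot_refl // !pairing_mulmx !mulmxA reflK // mul1mx.
Qed.

Lemma coform_root a r : r \in roots D ->
  2 * coform a r = pairing a (coroot D r) * coform r r.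
Proof.
move=> hr; have := coform_refl a r hr; rewrite mul_refl_self // mul_refl.
have -> : coform (a - pairing a (coroot D r) *: r) (- r) =
    - coform a r + pairing a (coroot D r) * coform r r.
  rewrite /coform mulr_sumr -sumrN -big_split /=; apply: eq_bigr => c _.
  by rewrite pairingBl pairingZl pairingNl; ring.
by move=> e; lia.
Qed.

Lemma coform_gt0 a : a \in roots D -> 0 < coform a a.
Proof.
move=> ha; rewrite /coform (bigD1_seq a) ?undup_uniq ?mem_undup //=.
rewrite pairing_coroot //; apply: ltr_wpDr => //; apply: sumr_ge0 => c _.
exact: sqr_ge0.
Qed.

(** Otherwise (a, a) is a combination of the (a, alpha_j) with coefficients >= 0, and each of these
    has the sign of <a, alpha_j^vee> <= 0, against (a, a) > 0. *)
Lemma pos_descent a : pos a -> exists i, 0 < pairing a (coroot D (alpha i)).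
Proof.
move=> pa; apply: contrapT => h.
have := coform_gt0 (pos_rootW pa); have [c e _] := pos_coefE pa.
suff : 2 * coform a a <= 0 by lia.
have -> : coform a a = \sum_j (c j)%:Z * coform a (alpha j).
  rewrite /coform; under [RHS]eq_bigr do rewrite mulr_sumr.
  rewrite exchange_big /=; apply: eq_bigr => b _.
  rewrite [X in _ * X = _]/pairing {2}e -/(pairing _ _) pairing_suml mulr_sumr.
  by apply: eq_bigr => j _; rewrite pairingZl; ring.
rewrite mulr_sumr; apply: sumr_le0 => j _.
rewrite mulrCA coform_root; last exact: simple_root.
have := coform_gt0 (simple_root j).
have : pairing a (coroot D (alpha j)) <= 0.
  by rewrite leNgt; apply/negP => hj; apply: h; exists j.
nia.
Qed.

Definition word_refl (s : seq 'I_(base_size B)) : 'M[int]_n :=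
  \big[mulmx/1%:M]_(i <- s) refl D (alpha i).

Lemma word_refl_cat s s' : word_refl (s ++ s') = word_refl s *m word_refl s'.
Proof.
rewrite /word_refl; elim: s => [|i s IH]; first by rewrite big_nil mul1mx.
by rewrite cat_cons !big_cons -mulmxA IH.
Qed.

(** Induction on <a, 2 rho^vee>: the simple reflection s_i found by [pos_descent] lowers this
    number, and s_a is the conjugate by s_i of the reflection in [a *m refl D (alpha i)]. *)
Lemma refl_word a : a \in roots D -> exists s, refl D a = word_refl s.
Proof.
move=> ha; wlog pa : a ha / pos a.
  move=> h; have [pa|pa] := pos_or_neg ha; first exact: h.
  by have [s] := h _ (root_opp ha) pa; rewrite refl_opp // => ->; exists s.
have [N] := ubnP `|pairing a rho2|%N; elim: N a {ha} pa => // N IH a pa hN.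
have [i hi] := pos_descent pa; have ri := simple_root i.
have [->|/eqP ai] := eqVneq a (alpha i).
  by exists [:: i]; rewrite /word_refl big_cons big_nil mulmx1.
have pa' := pos_refl_simple pa ai.
have [|s es] := IH _ pa'.
  have := pos_rho2 pa; have := pos_rho2 pa'.
  rewrite mul_refl pairingBl pairingZl pairing_simple_rho2; lia.
exists (i :: rcons s i); rewrite -cats1 -[i :: _]cat1s !word_refl_cat -es.
have -> : word_refl [:: i] = refl D (alpha i).
  by rewrite /word_refl big_cons big_nil mulmx1.
by rewrite mulmxA (refl_conj (pos_rootW pa) (weyl_refl ri)) -mulmxA reflK // mulmx1.
Qed.

Lemma weyl_word w : weyl D w -> exists s, w = word_refl s.
Proof.
move: w; apply: weyl_ind => [|a w ha _ [s ->]].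
  by exists [::]; rewrite /word_refl big_nil.
by have [t ->] := refl_word ha; exists (t ++ s); rewrite word_refl_cat.
Qed.

Lemma word_refl_weyl s : weyl D (word_refl s).
Proof.
rewrite /word_refl; elim: s => [|i s IH]; first by rewrite big_nil; exact: weyl1.
by rewrite big_cons; apply: weylM => //; apply: weyl_refl; exact: simple_root.
Qed.

End Positivity.

(** * The extended affine Weyl group *)

Section AffineGroup.
Variables (n : nat) (D : rootDatum n) (B : rootBase D).
Implicit Types (a b c : 'rV[int]_n) (x y : 'cV[int]_n) (w : 'M[int]_n).
Implicit Types (u v : affine n).
Local Notation alpha := (simple B).
Local Notation pos := (pos_root B).
Local Notation ext := (ext_weyl D).

Lemma amulA : associative (@amul n).
Proof. by move=> u v w; rewrite /amul /= mulmxDr !mulmxA addrA. Qed.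

Lemma amul1v : left_id (aone n) (@amul n).
Proof. by case=> y w; rewrite /amul /= !mul1mx add0r. Qed.

Lemma amulv1 : right_id (aone n) (@amul n).
Proof. by case=> y w; rewrite /amul /= mulmx0 mulmx1 addr0. Qed.

Definition ainv u : affine n := (- (invmx u.2 *m u.1), invmx u.2).

Lemma amulVv u : ext u -> amul (ainv u) u = aone n.
Proof.
by move=> /weyl_unit hu; rewrite /amul /ainv /= addNr mulVmx.
Qed.

Lemma amulvV u : ext u -> amul u (ainv u) = aone n.
Proof.
by move=> /weyl_unit hu; rewrite /amul /ainv /= mulmxN mulKVmx // subrr mulmxV.
Qed.

Lemma ext1 : ext (aone n). Proof. exact: weyl1. Qed.

Lemma extM u v : ext u -> ext v -> ext (amul u v). Proof. exact: weylM. Qed.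

Lemma extV u : ext u -> ext (ainv u). Proof. exact: weylV. Qed.

Lemma amulKv u v : ext u -> amul (ainv u) (amul u v) = v.
Proof. by move=> hu; rewrite amulA amulVv // amul1v. Qed.

Lemma amulvK u v : ext u -> amul (amul v u) (ainv u) = v.
Proof. by move=> hu; rewrite -amulA amulvV // amulv1. Qed.

Lemma amulvKV u v : ext u -> amul (amul v (ainv u)) u = v.
Proof. by move=> hu; rewrite -amulA amulVv // amulv1. Qed.

Lemma amul_injl u v v' : ext u -> amul u v = amul u v' -> v = v'.
Proof. by move=> hu e; rewrite -[v](amulKv _ hu) e amulKv. Qed.

Lemma amul_injr u v v' : ext u -> amul v u = amul v' u -> v = v'.
Proof. by move=> hu e; rewrite -[v](amulvK _ hu) e amulvK. Qed.

Lemma ainvK u : ext u -> ainv (ainv u) = u.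
Proof.
move=> hu; apply: (amul_injr (extV hu)); rewrite amulVv; last exact: extV.
by rewrite amulvV.
Qed.

Lemma ainvM u v : ext u -> ext v -> ainv (amul u v) = amul (ainv v) (ainv u).
Proof.
move=> hu hv; apply: (amul_injr (extM hu hv)); rewrite amulVv; last exact: extM.
by rewrite -amulA amulKv // amulVv.
Qed.

Lemma lin_inj : injective (@lin n).
Proof. by move=> w w' []. Qed.

Lemma linM w w' : lin (w *m w') = amul (lin w) (lin w').
Proof. by rewrite /lin /amul /= mulmx0 addr0. Qed.

Lemma lin1 : lin 1%:M = aone n. Proof. by []. Qed.

Lemma ainv_lin w : ainv (lin w) = lin (invmx w).
Proof. by rewrite /ainv /lin /= mulmx0 oppr0. Qed.

Lemma amul_trans_lin x w : amul (trans x) (lin w) = (x, w).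
Proof. by rewrite /amul /trans /lin /= mul1mx addr0 mul1mx. Qed.

Lemma amul_lin_trans x w : amul (lin w) (trans x) = (w *m x, w).
Proof. by rewrite /amul /trans /lin /= add0r mulmx1. Qed.

Lemma ext_arefl a m : a \in roots D -> ext (arefl D a m).
Proof. exact: weyl_refl. Qed.

Lemma ext_lin w : weyl D w -> ext (lin w). Proof. by []. Qed.

Lemma areflK a m : a \in roots D -> amul (arefl D a m) (arefl D a m) = aone n.
Proof.
move=> ha; rewrite /amul /arefl /= reflK // refl_mul pairingZr pairing_coroot //.
rewrite -scalerBl -scalerDl (_ : _ + _ = 0) ?scale0r //; ring.
Qed.

Lemma ainv_arefl a m : a \in roots D -> ainv (arefl D a m) = arefl D a m.
Proof.
move=> ha; apply: (amul_injl (ext_arefl m ha)).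
by rewrite areflK // amulvV //; apply: ext_arefl.
Qed.

Lemma arefl_opp a m : a \in roots D -> arefl D (- a) (- m) = arefl D a m.
Proof. by move=> ha; rewrite /arefl refl_opp // coroot_opp // scaleNr scalerN opprK. Qed.

Lemma arefl_conj v a m : ext v -> a \in roots D ->
  amul v (arefl D (a *m v.2) (m - pairing a v.1)) = amul (arefl D a m) v.
Proof.
move=> hv ha; rewrite /amul /arefl /= refl_conj //; congr (_, _).
rewrite refl_mul -scalemxAr coroot_weyl // scalerBl addrCA addrC -!addrA.
by rewrite addrC.
Qed.

Definition negr a : bool := pairing a (rho2 B) < 0.

(* The integer part of the root [a] on the alcove of [v]. *)
Definition kf v a : int := pairing a v.1 - (negr (a *m v.2) : nat)%:Z.

Lemma negr_opp a : a \in roots D -> negr (- a) = ~~ negr a.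
Proof.
move=> ha; rewrite /negr pairingNl; have := @root_rho2_neq0 _ _ B a ha; lia.
Qed.

Lemma posN a : a \in roots D -> pos a <-> negr a = false.
Proof. by move=> ha; rewrite (posE _ ha) /negr; have := @root_rho2_neq0 _ _ B a ha; lia. Qed.

Lemma kf_amul u v a : kf (amul u v) a = pairing a u.1 + kf v (a *m u.2).
Proof. by rewrite /kf /amul /= pairingDr -pairing_mulmx mulmxA addrA. Qed.

Lemma kf_opp v a : ext v -> a \in roots D -> kf v (- a) = - 1 - kf v a.
Proof.
move=> hv ha; rewrite /kf pairingNl mulNmx negr_opp ?root_weyl //.
by case: negr => /=; lia.
Qed.

Lemma kf1 a : kf (aone n) a = - (negr a : nat)%:Z.
Proof. by rewrite /kf pairing0r mulmx1 add0r. Qed.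

Lemma kf_lin w a : kf (lin w) a = - (negr (a *m w) : nat)%:Z.
Proof. by rewrite /kf /= pairing0r add0r. Qed.

Definition pos_roots : seq 'rV[int]_n := [seq a <- undup (roots D) | ~~ negr a].

Lemma mem_pos_roots a : a \in pos_roots <-> pos a.
Proof.
rewrite mem_filter mem_undup; split.
  by move=> /andP[na ha]; apply/posN => //; apply: negbTE.
by move=> pa; have ha := pos_rootW pa; rewrite ha andbT; apply/negPf/posN.
Qed.

Lemma uniq_pos_roots : uniq pos_roots.
Proof. by rewrite filter_uniq ?undup_uniq. Qed.

Lemma pos_negr a : pos a -> negr a = false.
Proof. by move=> pa; apply/posN => //; exact: pos_rootW pa. Qed.

Lemma negr_pos a : a \in roots D -> negr a -> pos (- a).
Proof.
by move=> ha na; apply/posN; rewrite ?negr_opp ?na //; exact: root_opp.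
Qed.

(** The number of hyperplanes H_{a,m} separating the alcoves of u and v. *)
Definition adist u v : nat := \sum_(a <- pos_roots) `|kf u a - kf v a|%N.

(** Replacing a by -a turns k into -1 - k and keeps differences up to sign. The sum over all roots,
    unlike the one over the positive roots, is visibly permuted by W; this gives the invariance
    [adist_amul]. *)
Lemma adist_roots u v : ext u -> ext v ->
  (\sum_(a <- undup (roots D)) `|kf u a - kf v a|%N = (adist u v).*2)%N.
Proof.
move=> hu hv; rewrite (bigID negr) /= -[X in (_ + X)%N]big_filter -/(adist u v).
rewrite -addnn; congr (_ + _)%N; rewrite -big_filter.
rewrite /adist (perm_big [seq - a | a <- pos_roots]) /= ?big_map.
  rewrite !big_seq; apply: eq_bigr => a /mem_pos_roots /pos_rootW ha.
  by rewrite !kf_opp //; lia.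
apply: uniq_perm; first by rewrite filter_uniq ?undup_uniq.
  by rewrite map_inj_uniq ?uniq_pos_roots //; exact: oppr_inj.
move=> a; rewrite mem_filter mem_undup; apply/andP/mapP.
  move=> [na ha]; exists (- a); rewrite ?opprK //.
  by apply/mem_pos_roots; exact: negr_pos.
move=> [b /mem_pos_roots pb ->]; have hb := pos_rootW pb.
by rewrite negr_opp // pos_negr // root_opp.
Qed.

Lemma perm_mul_weyl w : weyl D w ->
  perm_eq [seq c *m w | c <- undup (roots D)] (undup (roots D)).
Proof.
move=> hw; have wu := weyl_unit hw; apply: uniq_perm; rewrite ?undup_uniq //.
  rewrite map_inj_uniq ?undup_uniq //.
  by apply: (can_inj (g := mulmx^~ (invmx w))) => b; rewrite mulmxK.
move=> c; rewrite mem_undup; apply/mapP/idP.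
  by move=> [b]; rewrite mem_undup => hb ->; exact: root_weyl.
move=> hc; exists (c *m invmx w); last by rewrite mulmxKV.
by rewrite mem_undup; apply: root_weyl => //; exact: weylV.
Qed.

Lemma adist_amul u v v' : ext u -> ext v -> ext v' ->
  adist (amul u v) (amul u v') = adist v v'.
Proof.
move=> hu hv hv'; apply: double_inj; rewrite -!adist_roots //; try exact: extM.
rewrite -[RHS](perm_big _ (perm_mul_weyl hu)) big_map /=.
by apply: eq_bigr => a _; rewrite !kf_amul; congr `|_|%N; lia.
Qed.

Lemma adistC u v : adist u v = adist v u.
Proof. by apply: eq_bigr => a _; lia. Qed.

(** The hyperplane count for the length; [len_alen] identifies it with the length of a reduced
    word. *)
Definition alen v : nat := \sum_(a <- pos_roots) `|kf v a|%N.

Lemma alenE v : alen v = adist (aone n) v.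
Proof.
rewrite /alen /adist !big_seq; apply: eq_bigr => a /mem_pos_roots pa.
by rewrite kf1 pos_negr //=; lia.
Qed.

Lemma alen_amul u v : ext u -> ext v -> alen (amul u v) = adist (ainv u) v.
Proof.
move=> hu hv; rewrite alenE -[RHS](adist_amul hu) ?amulvV //; exact: extV.
Qed.

Lemma alenV v : ext v -> alen (ainv v) = alen v.
Proof.
move=> hv; rewrite -[ainv v]amulv1 alen_amul ?ainvK //; [|exact: extV|exact: ext1].
by rewrite adistC -alenE.
Qed.

Lemma alen0P v : reflect (forall a, pos a -> kf v a = 0) (alen v == 0%N).
Proof.
apply: (iffP eqP) => [h a pa | h]; last first.
  by rewrite /alen big_seq big1 // => a /mem_pos_roots /h ->.
have := mem_pos_roots a => -[_ /(_ pa) ha].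
by move: h; rewrite /alen (bigD1_seq a) ?uniq_pos_roots //=; lia.
Qed.

Lemma alen1 : alen (aone n) = 0%N.
Proof. by apply/eqP/alen0P => a pa; rewrite kf1 pos_negr. Qed.

Lemma alen_lin w : alen (lin w) = \sum_(a <- pos_roots) (negr (a *m w) : nat).
Proof. by apply: eq_bigr => a _; rewrite kf_lin; case: negr. Qed.

Lemma word_refl_cons (i : 'I_(base_size B)) s : word_refl (i :: s) = refl D (alpha i) *m word_refl s.
Proof. by rewrite /word_refl big_cons. Qed.

Lemma negr_refl_simple a i : pos a -> negr (a *m refl D (alpha i)) -> a = alpha i.
Proof.
move=> pa na; apply: contrapT => /(pos_refl_simple pa) /pos_negr.
by rewrite na.
Qed.

(** Along the word, the image of [a] changes sign at some letter i; a positive root made negative by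
    s_i is alpha_i, so the reflection in [a] is conjugate to s_i by the prefix. *)
Lemma word_refl_exchange a s : pos a -> negr (a *m word_refl s) ->
  exists s1 i s2, s = s1 ++ i :: s2 /\
    refl D a *m word_refl s1 = word_refl s1 *m refl D (alpha i).
Proof.
elim: s a => [|i s IH] a pa.
  by rewrite /word_refl big_nil mulmx1 pos_negr.
rewrite word_refl_cons mulmxA => na.
have [n1|n1] := boolP (negr (a *m refl D (alpha i))).
  rewrite (negr_refl_simple pa n1); exists [::], i, s.
  by rewrite /word_refl big_nil mul1mx mulmx1.
have hi := simple_root i; have wi := weyl_refl hi.
have p1 : pos (a *m refl D (alpha i)).
  by apply/posN; [apply: root_refl => //; exact: pos_rootW pa|exact: negbTE].
have [s1 [j [s2 [es e]]]] := IH _ p1 na.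
exists (i :: s1), j, s2; split; first by rewrite es.
rewrite word_refl_cons mulmxA -(refl_conj (pos_rootW pa) wi) -!mulmxA.
by congr (_ *m _).
Qed.

(** In a nonempty word for such a w, the first simple root is made negative by the tail, so the
    exchange deletes two letters; induction on the length of the word. *)
Lemma weyl_pos_id w : weyl D w -> (forall a, pos a -> pos (a *m w)) -> w = 1%:M.
Proof.
move=> hw; have [s ->] := weyl_word B hw; clear w hw.
have [N] := ubnP (size s); elim: N s => // N IH [|i s] hN hp.
  by rewrite /word_refl big_nil.
have hi := simple_root i.
have : negr (alpha i *m word_refl s).
  have := pos_negr (hp _ (simple_pos i)); rewrite word_refl_cons mulmxA.
  rewrite mul_refl_self // mulNmx negr_opp; last first.
    by apply: root_weyl => //; exact: word_refl_weyl.
  by case: negr.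
move=> /(word_refl_exchange (simple_pos i)) [s1 [j [s2 [es e]]]].
have e' : word_refl (i :: s) = word_refl (s1 ++ s2).
  rewrite word_refl_cons es word_refl_cat word_refl_cons mulmxA e.
  rewrite -!mulmxA [refl D (alpha j) *m (_ *m _)]mulmxA reflK; last exact: simple_root.
  by rewrite mul1mx word_refl_cat.
rewrite e'; apply: IH; last by move=> a /hp; rewrite e'.
by move: hN; rewrite es /= !size_cat /=; lia.
Qed.

Lemma weyl_alen0 w : weyl D w -> alen (lin w) = 0%N -> w = 1%:M.
Proof.
move=> hw /eqP /alen0P h; apply: weyl_pos_id => // a pa; apply/posN.
  by apply: root_weyl => //; exact: pos_rootW pa.
by have := h a pa; rewrite kf_lin; case: negr.
Qed.

Lemma weyl_negr_inj w w' : weyl D w -> weyl D w' ->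
  (forall a, pos a -> negr (a *m w) = negr (a *m w')) -> w = w'.
Proof.
move=> hw hw' h.
have hall a : a \in roots D -> negr (a *m w) = negr (a *m w').
  move=> ha; have [pa|pa] := pos_or_neg B ha; first exact: h.
  have := h _ pa; rewrite !mulNmx !negr_opp ?root_weyl //.
  by case: negr; case: negr.
suff e : invmx w *m w' = 1%:M.
  by rewrite -[LHS]mulmx1 -e mulKVmx // (weyl_unit hw).
apply: weyl_pos_id; first by apply: weylM => //; exact: weylV.
move=> a pa; have ha := pos_rootW pa; apply/posN.
  by apply: root_weyl => //; apply: weylM => //; exact: weylV.
rewrite mulmxA -hall; last by apply: root_weyl => //; exact: weylV.
by rewrite mulmxKV ?pos_negr // (weyl_unit hw).
Qed.

(** The integers [kf] describe only the alcove, that is u up to Omega on the right; the marked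
    vertex [u.1] of the generalized alcove fixes the rest. *)
Lemma kf_inj u v : ext u -> ext v -> u.1 = v.1 ->
  (forall a, pos a -> kf u a = kf v a) -> u = v.
Proof.
case: u v => [x w] [x' w'] /= hu hv <- h; congr (_, _).
apply: weyl_negr_inj => // a pa; have := h a pa; rewrite /kf /=.
by case: negr; case: negr; lia.
Qed.

(** An element is recorded by its action on the positions in the list of roots. The record is
    faithful by [weyl_negr_inj], even when the roots do not span. *)
Lemma finite_weyl : finite_set (weyl D).
Proof.
pose m := size (roots D).
pose act w : {ffun 'I_m -> 'I_m.+1} :=
  [ffun i : 'I_m => inord (index ((roots D)`_i *m w) (roots D))].
pose g f : 'M[int]_n := xget 1%:M [set w | weyl D w /\ act w = f].
apply: (@sub_finite_set _ _ (range g)); last exact: finite_image.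
move=> w hw; exists (act w) => //.
have [h1 h2] : [set w' | weyl D w' /\ act w' = act w] (g (act w)).
  by apply: xgetPex; exists w.
apply: weyl_negr_inj => // a pa; congr (negr _).
have ha := pos_rootW pa; have ia : (index a (roots D) < m)%N by rewrite index_mem.
have := congr1 (fun f : {ffun 'I_m -> 'I_m.+1} => val (f (Ordinal ia))) h2.
rewrite !ffunE /= nth_index // !inordK ?ltnS ?index_size //.
move=> e; have := congr1 (nth 0 (roots D)) e.
by rewrite !nth_index ?root_weyl.
Qed.

End AffineGroup.

(** * Walls of alcoves and reduced words *)

Section GenericVectors.
Variables (R : realType) (n : nat).

(** The numbers r / (k + 1), k < size p, are too many distinct points of (0, r] to be all roots of
    p. *)
Lemma horner_neq0_small (p : {poly R}) (r : R) : p != 0 -> 0 < r ->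
  exists2 z, 0 < z <= r & p.[z] != 0.
Proof.
move=> p0 r0; apply: contrapT => h.
pose rs := [seq r / (k.+1)%:R | k <- iota 0 (size p)].
have : (size rs < size p)%N.
  apply: max_poly_roots => //.
    apply/allP => _ /mapP[k _ ->]; apply: contrapT => /negP pz; apply: h.
    exists (r / k.+1%:R); rewrite // divr_gt0 //= ler_pdivrMr //.
    by rewrite ler_peMr ?ler1n // ltW.
  rewrite map_inj_uniq ?iota_uniq // => i j /(mulfI (lt0r_neq0 r0)) /invr_inj.
  by move/eqP; rewrite eqr_nat => /eqP [].
by rewrite size_map size_iota ltnn.
Qed.

(* A point of the moment curve close to the origin avoids finitely many given
   affine hyperplanes. *)
Lemma generic_small (L : seq (R * 'rV[R]_n)) (S : seq 'rV[R]_n) (delta : R) :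
  {in L, forall cu, cu.2 != 0} -> 0 < delta ->
  exists e : 'cV[R]_n, {in L, forall cu, cu.1 + (cu.2 *m e) 0 0 != 0} /\
    {in S, forall a, `|(a *m e) 0 0| < delta}.
Proof.
move=> hL d0.
pose e (z : R) : 'cV[R]_n := \col_i z ^+ i.+1.
pose P (cu : R * 'rV[R]_n) : {poly R} := cu.1%:P + \sum_i cu.2 0 i *: 'X^(i.+1).
have hP cu z : (P cu).[z] = cu.1 + (cu.2 *m e z) 0 0.
  rewrite /P hornerD hornerC horner_sum mxE; congr (_ + _).
  by apply: eq_bigr => i _; rewrite hornerZ hornerXn mxE.
have P0 cu : cu.2 != 0 -> P cu != 0.
  apply: contraNN => /eqP h; apply/eqP/matrixP => i j; rewrite ord1 [RHS]mxE.
  have := congr1 (fun q : {poly R} => q`_j.+1) h.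
  rewrite /P coef0 coefD coefC /= add0r coef_sum (bigD1 j) //= coefZ coefXn eqxx.
  rewrite mulr1 big1 ?addr0 // => k kj; rewrite coefZ coefXn eqSS.
  by rewrite eq_sym -val_eqE in kj; rewrite (negPf kj) mulr0.
(* For 0 < z <= 1 the values at [e z] of the forms in S are at most z K in absolute value, and z <=
   delta / (2 K) makes this smaller than delta. The summand 1 keeps K positive when S is empty. *)
pose K := 1 + \sum_(a <- S) \sum_i `|a 0 i|.
have K0 : 0 < K by rewrite ltr_pwDl // sumr_ge0 // => a _; rewrite sumr_ge0.
have Q0 : \prod_(cu <- L) P cu != 0.
  by rewrite prodf_seq_neq0; apply/allP => cu hcu /=; rewrite P0 ?hL.
have r0 : 0 < Num.min 1 (delta / (2 * K)).
  by rewrite lt_min ltr01 /= divr_gt0 // mulr_gt0.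
have [z /andP[z0]] := horner_neq0_small Q0 r0.
rewrite le_min => /andP[z1 zd]; rewrite horner_prod prodf_seq_neq0 => /allP hz.
exists (e z); split=> [cu hcu|a ha]; first by rewrite -hP; have := hz _ hcu.
apply: (@le_lt_trans _ _ (z * K)); last first.
  rewrite (le_lt_trans (ler_wpM2r (ltW K0) zd)) // invfM mulrA divfK ?gt_eqF //.
  by rewrite ltr_pdivrMr // ltr_pMr // ltr1n.
rewrite mxE (le_trans (ler_norm_sum _ _ _)) //.
apply: (@le_trans _ _ (z * \sum_i `|a 0 i|)).
  rewrite mulr_sumr ler_sum // => i _; rewrite mxE normrM normrX (gtr0_norm z0).
  by rewrite mulrC exprS -mulrA ler_pM2l // ler_piMl // exprn_ile1 // ltW.
rewrite ler_pM2l // /K (big_rem a) //= addrCA lerDl addr_ge0 //.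
by rewrite sumr_ge0 // => b _; rewrite sumr_ge0.
Qed.

Lemma seq_argmin (T : eqType) (g : T -> R) (s : seq T) (i0 : T) : i0 \in s ->
  exists2 j, j \in s & {in s, forall i, g j <= g i}.
Proof.
elim: s i0 => // k s IH i0 _; case: s IH => [|i s] IH.
  by exists k; rewrite ?inE // => i; rewrite inE => /eqP ->.
have [j js jm] := IH i (mem_head _ _).
have [kj|jk] := leP (g k) (g j).
  exists k; first exact: mem_head.
  by move=> l; rewrite inE => /orP[/eqP -> //|/jm]; apply: le_trans.
exists j; first by rewrite inE js orbT.
by move=> l; rewrite inE => /orP[/eqP ->|/jm //]; exact: ltW.
Qed.

End GenericVectors.

(** * Real points of alcoves and the faces of the fundamental alcove *)

Section AlcoveGeometry.
Variables (R : realType) (n : nat) (D : rootDatum n) (B : rootBase D).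
Implicit Types (a b c : 'rV[int]_n) (x y : 'cV[R]_n) (w : 'M[int]_n).
Implicit Types (u v s : affine n).
Local Notation pos := (pos_root B).
Local Notation ext := (ext_weyl D).
Local Notation kf := (kf B).
Local Notation Af := (@fund_alcove R n D B).

Lemma pairingRDr a x y : pairingR a (x + y) = pairingR a x + pairingR a y.
Proof. by rewrite /pairingR mulmxDr mxE. Qed.

Lemma pairingRNr a x : pairingR a (- x) = - pairingR a x.
Proof. by rewrite /pairingR mulmxN mxE. Qed.

Lemma pairingRBr a x y : pairingR a (x - y) = pairingR a x - pairingR a y.
Proof. by rewrite pairingRDr pairingRNr. Qed.

Lemma pairingRZr a (k : R) x : pairingR a (k *: x) = k * pairingR a x.
Proof. by rewrite /pairingR -scalemxAr mxE. Qed.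

Lemma pairingRDl a b x : pairingR (a + b) x = pairingR a x + pairingR b x.
Proof. by rewrite /pairingR map_mxD mulmxDl mxE. Qed.

Lemma pairingRNl a x : pairingR (- a) x = - pairingR a x.
Proof. by rewrite /pairingR map_mxN mulNmx mxE. Qed.

Lemma pairingRZl k a x : pairingR (k *: a) x = k%:~R * pairingR a x.
Proof. by rewrite /pairingR map_mxZ -scalemxAl mxE. Qed.

Lemma pairingR_suml I (r : seq I) (F : I -> 'rV[int]_n) x :
  pairingR (\sum_(i <- r) F i) x = \sum_(i <- r) pairingR (F i) x.
Proof.
elim/big_rec2: _ => [|i u v _ <-]; rewrite ?pairingRDl //.
by rewrite /pairingR map_mx0 mul0mx mxE.
Qed.

Lemma pairingR_embed a (mu : 'cV[int]_n) : pairingR a (embed R mu) = (pairing a mu)%:~R.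
Proof. by rewrite /pairingR /embed -map_mxM mxE. Qed.

Lemma pairingR_actV a v x :
  pairingR a (actV v x) = (pairing a v.1)%:~R + pairingR (a *m v.2) x.
Proof.
by rewrite /actV pairingRDr pairingR_embed; congr (_ + _); rewrite /pairingR map_mxM mulmxA.
Qed.

Lemma actV_amul u v x : actV (amul u v) x = actV u (actV v x).
Proof.
rewrite /actV /amul /= /embed map_mxD !map_mxM mulmxDr !mulmxA addrA.
by [].
Qed.

Lemma actV1 x : actV (aone n) x = x.
Proof. by rewrite /actV /aone /= /embed map_mx0 add0r map_mx1 mul1mx. Qed.

Lemma actVKV v : ext v -> cancel (actV (R := R) (ainv v)) (actV v).
Proof. by move=> hv x; rewrite -actV_amul (amulvV hv) actV1. Qed.

(** Chosen so that 2 rho^vee / [rho_bound] lies inside A_f; the summand 2 leaves a margin of at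
    least 1 / [rho_bound] to every wall. *)
Definition rho_bound : int := 2 + \sum_(a <- undup (roots D)) `|pairing a (rho2 B)|.

Lemma rho_bound_gt a : a \in roots D -> `|pairing a (rho2 B)| + 1 < rho_bound.
Proof.
move=> ha; rewrite /rho_bound (big_rem a) ?mem_undup //=.
set S := \sum_(_ <- _) _; have : 0 <= S by apply: sumr_ge0.
lia.
Qed.

Lemma rho_bound_gt0 : (0 : R) < rho_bound%:~R.
Proof.
by rewrite ltr0z /rho_bound; set S := \sum_(_ <- _) _; have : 0 <= S; [apply: sumr_ge0 | lia].
Qed.

Definition base_point : 'cV[R]_n := rho_bound%:~R^-1 *: embed R (rho2 B).

Lemma base_pointE a : pairingR a base_point = (pairing a (rho2 B))%:~R / rho_bound%:~R.
Proof. by rewrite /base_point pairingRZr pairingR_embed mulrC. Qed.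

Lemma base_point_pos a : pos a ->
  rho_bound%:~R^-1 <= pairingR a base_point <= 1 - rho_bound%:~R^-1.
Proof.
move=> pa; have := rho_bound_gt (pos_rootW pa); have := pos_rho2 pa => p1 p2.
have M0 := rho_bound_gt0.
rewrite base_pointE; apply/andP; split.
  by rewrite ler_pdivlMr // mulVf ?gt_eqF // ler1z; lia.
by rewrite ler_pdivrMr // mulrBl mul1r mulVf ?gt_eqF // -[1]/(1%:~R) -intrB ler_int; lia.
Qed.

Lemma base_point_strict a : pos a -> 0 < pairingR a base_point < 1.
Proof.
move=> /base_point_pos /andP[h1 h2]; have := rho_bound_gt0.
rewrite -invr_gt0 => h; rewrite (lt_le_trans h h1) /= (le_lt_trans h2) //.
by rewrite ltrBlDr ltrDl.
Qed.

Lemma base_point_in : Af base_point.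
Proof. by move=> a /base_point_strict /andP[h1 h2]; rewrite !ltW. Qed.

Lemma Af_root a x : a \in roots D -> Af x ->
  (- (negr B a : nat)%:Z)%:~R <= pairingR a x <= (1 - (negr B a : nat)%:Z)%:~R.
Proof.
move=> ha hx; have [pa|pa] := pos_or_neg B ha.
  by rewrite (pos_negr pa) /= oppr0 subr0 hx.
have -> : negr B a = true by apply: contrapT => /negP/negPf/posN => /(_ ha) /pos_opp.
by have := hx _ pa; rewrite pairingRNl /= subrr; lra.
Qed.

Lemma base_point_root a : a \in roots D ->
  (- (negr B a : nat)%:Z)%:~R < pairingR a base_point < (1 - (negr B a : nat)%:Z)%:~R.
Proof.
move=> ha; have [pa|pa] := pos_or_neg B ha.
  by rewrite (pos_negr pa) /= oppr0 subr0 base_point_strict.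
have -> : negr B a = true by apply: contrapT => /negP/negPf/posN => /(_ ha) /pos_opp.
by have := base_point_strict pa; rewrite pairingRNl /= subrr; lra.
Qed.

Definition box v : set 'cV[R]_n :=
  [set x | forall a, pos a -> (kf v a)%:~R <= pairingR a x <= (kf v a + 1)%:~R].

Lemma actV_box v x : ext v -> Af x -> box v (actV v x).
Proof.
move=> hv hx a pa; have := Af_root (root_weyl (pos_rootW pa) hv) hx.
rewrite pairingR_actV /kf !(intrD, intrB, intrN).
by move=> /andP[h1 h2]; apply/andP; split; lra.
Qed.

Lemma actV_base_point v a : ext v -> a \in roots D ->
  (kf v a)%:~R < pairingR a (actV v base_point) < (kf v a + 1)%:~R.
Proof.
move=> hv ha; have := base_point_root (root_weyl ha hv).
rewrite pairingR_actV /kf !(intrD, intrB, intrN).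
by move=> /andP[h1 h2]; apply/andP; split; lra.
Qed.

Lemma box_root v x a : ext v -> box v x -> a \in roots D ->
  (kf v a)%:~R <= pairingR a x <= (kf v a + 1)%:~R.
Proof.
move=> hv hx ha; have [pa|pa] := pos_or_neg B ha; first exact: hx.
have := hx _ pa; rewrite pairingRNl (kf_opp B hv ha) !(intrD, intrB, intrN).
by move=> /andP[h1 h2]; apply/andP; split; lra.
Qed.

Lemma image_alcove v : ext v -> actV v @` Af = box v.
Proof.
move=> hv; apply/seteqP; split => [_ [x hx <-]|y hy]; first exact: actV_box.
exists (actV (ainv v) y); last by rewrite actVKV.
move=> a pa; have ha := root_weyl (pos_rootW pa) (extV hv).
have := box_root hv hy ha; rewrite pairingR_actV.
have -> : kf v (a *m (ainv v).2) = - pairing a (ainv v).1.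
  have := kf_amul B (ainv v) v a; rewrite (amulVv hv) kf1 (pos_negr pa) /=; lia.
by rewrite !(intrD, intrN) => /andP[h1 h2]; apply/andP; split; lra.
Qed.

Lemma box_inj u v : ext u -> ext v -> box u = box v -> forall a, pos a -> kf u a = kf v a.
Proof.
move=> hu hv e a pa.
have bu : box v (actV u base_point) by rewrite -e; apply: actV_box => //; exact: base_point_in.
have /andP[h1 h2] := bu a pa.
have /andP[h3 h4] := actV_base_point hu (pos_rootW pa).
have := lt_le_trans h3 h2; have := le_lt_trans h1 h4; rewrite !ltr_int; lia.
Qed.

Definition on_only a (m : int) x : Prop :=
  hyperplane a m x /\ forall b k, pos b -> hyperplane b k x -> b = a /\ k = m.

(** A real relation between two integral vectors implies the integral relation b_j a = a_j b for an
    entry b_j <> 0, to which reducedness of the datum applies. *)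
Lemma pos_not_proportional a b (k l : R) : pos a -> pos b -> a <> b ->
  k != 0 -> k *: map_mx intr a - l *: map_mx intr b != 0 :> 'rV[R]_n.
Proof.
move=> pa pb ab k0; apply/negP => /eqP /matrixP e.
have ha := pos_rootW pa; have hb := pos_rootW pb.
have [j bj] : exists j, b 0 j != 0.
  apply: contrapT => h; apply: (root_neq0 hb); apply/matrixP => i j.
  by rewrite ord1 mxE; apply: contrapT => /eqP hj; apply: h; exists j.
have ej i : k * (a 0 i)%:~R = l * (b 0 i)%:~R.
  by apply/eqP; rewrite -subr_eq0; apply/eqP; have := e 0 i; rewrite !mxE.
have : b 0 j *: a = a 0 j *: b.
  apply/matrixP => i0 i; rewrite ord1 !mxE; apply/eqP.
  rewrite -(eqr_int R) !intrM; apply/eqP; apply: (mulfI k0).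
  by rewrite mulrCA ej [RHS]mulrA ej; ring.
move=> /(roots_reduced ha hb bj) [/esym //|eb].
by apply: (pos_opp pa); rewrite -eb.
Qed.

(** Follow the segment from an interior point p of A_f to x and stop at the first wall that it
    meets. For generic p, the walls that x violates are met at different times, so the exit point y
    lies on a single hyperplane. *)
Lemma face_separation x : ~ Af x -> exists a m y,
  [/\ pos a, Af y, on_only a m y &
      (m = 0 /\ pairingR a x < 0) \/ (m = 1 /\ 1 < pairingR a x)].
Proof.
move=> hx.
(* A_f is the set where all f j are nonnegative; the boolean selects the wall m = 0 or m = 1 of the
   root, and V lists the walls violated at x. *)
pose f (j : 'rV[int]_n * bool) y : R :=
  if j.2 then 1 - pairingR j.1 y else pairingR j.1 y.
pose J := [seq (a, z) | a <- pos_roots B, z <- [:: false; true]].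
have memJ a (b : bool) : ((a, b) \in J) <-> pos a.
  rewrite -mem_pos_roots; split; first by move=> /allpairsP[[a' b'] [h _ []]] -> _.
  by move=> pa; apply/allpairsP; exists (a, b); split => //; case: b.
pose V := [seq j <- J | f j x < 0].
pose sg (b : bool) : R := if b then -1 else 1.
have fE j y e : f j (y + e) = f j y + sg j.2 * pairingR j.1 e.
  by rewrite /f pairingRDr /sg; case: j.2; ring.
have sg0 z : sg z != 0 by rewrite /sg; case: z; rewrite ?oppr_eq0 oner_neq0.
(* The affine function of e whose vanishing says that, on the segment from [base_point + e] to x,
   the functions f i and f j vanish at the same time. *)
pose lp (i j : 'rV[int]_n * bool) : R * 'rV[R]_n :=
  (f i base_point * f j x - f j base_point * f i x,
   (sg i.2 * f j x) *: map_mx intr i.1 - (sg j.2 * f i x) *: map_mx intr j.1).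
pose L := [seq lp i j | i <- V, j <- [seq j <- V | j.1 != i.1]].
pose S : seq 'rV[R]_n := [seq map_mx intr a | a <- pos_roots B].
have hL : {in L, forall cu, cu.2 != 0}.
  move=> _ /allpairsPdep[[a b] [[a' b'] [hi hj ->]]] /=.
  move: hi hj; rewrite !mem_filter => /andP[_ /memJ pa] /and3P[/= aa fj /memJ pa'].
  apply: pos_not_proportional => //; first by apply/eqP; rewrite eq_sym.
  by rewrite mulf_neq0 ?sg0 // lt_eqF.
have M0 := rho_bound_gt0; have Mi0 : 0 < (rho_bound%:~R : R)^-1 by rewrite invr_gt0.
have [e [he1 he2]] := generic_small S hL Mi0.
pose p := base_point + e.
have fp a (b : bool) : pos a -> 0 < f (a, b) p.
  move=> pa; have /andP[h1 h2] := base_point_pos pa.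
  have : `|pairingR a e| < rho_bound%:~R^-1.
    by apply: he2; apply/mapP; exists a => //; apply/mem_pos_roots.
  rewrite ltr_norml => /andP[h3 h4].
  by rewrite /f /p pairingRDr; case: b => /=; lra.
have hgen i j : i \in V -> j \in V -> i != j -> f i p * f j x - f j p * f i x != 0.
  move=> iV jV ij.
  (* L omits pairs with the same root: the walls m = 0 and m = 1 of one root cannot both be violated
     at x. *)
  have ij1 : j.1 != i.1.
    apply: contraNN ij => /eqP eij; move: iV jV; rewrite !mem_filter.
    case: i j eij => a b [a' b'] /= -> /andP[h1 _] /andP[h2 _]; apply/eqP.
    by congr (_, _); move: h1 h2; rewrite /f; case: b; case: b' => //=; lra.
  have hij : lp i j \in L.
    by apply/allpairsPdep; exists i, j; split => //; rewrite mem_filter ij1.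
  have eE (k l : R) a a' : ((k *: map_mx intr a - l *: map_mx intr a') *m e) 0 0 =
      k * pairingR a e - l * pairingR a' e.
    by rewrite /pairingR mulmxBl -!scalemxAl !mxE.
  have := he1 _ hij; rewrite /= eE /p !fE.
  by congr (_ != 0); ring.
have [j0 j0V] : exists j, j \in V.
  apply: contrapT => h; apply: hx => a pa; apply/andP; split.
    rewrite leNgt; apply/negP => ha; apply: h; exists (a, false).
    by rewrite mem_filter /f ha; apply/memJ.
  rewrite leNgt; apply/negP => ha; apply: h; exists (a, true).
  by rewrite mem_filter /f /= subr_lt0 ha; apply/memJ.
have [j jV jmin] := seq_argmin (fun j => f j p / (f j p - f j x)) j0V.
have Vx i : i \in V -> f i x < 0 by rewrite mem_filter => /andP[].
have Vp i : i \in J -> 0 < f i p by case: i => a b /memJ /fp.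
have VJ i : i \in V -> i \in J by rewrite mem_filter => /andP[].
have jx := Vx _ jV; have jp := Vp _ (VJ _ jV).
pose dj := f j p - f j x; have dj0 : 0 < dj by rewrite /dj; lra.
pose t := f j p / dj.
have t0 : 0 < t by rewrite divr_gt0.
have t1 : t < 1 by rewrite ltr_pdivrMr // mul1r /dj; lra.
pose y := p + t *: (x - p).
have fy i : f i y = f i p - t * (f i p - f i x).
  by rewrite /y fE pairingRZr pairingRBr /f /sg; case: i.2; ring.
have fjy : f j y = 0 by rewrite fy -/dj divfK ?gt_eqF // subrr.
have fiy i : i \in J -> i != j -> 0 < f i y.
  move=> iJ ij; have [iV|] := boolP (i \in V); last first.
    rewrite mem_filter iJ andbT -leNgt => fx; rewrite fy.
    have := Vp _ iJ; nra.
  have ix := Vx _ iV; have ip := Vp _ iJ.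
  have hi : t <= f i p / (f i p - f i x) by apply: jmin.
  have hd : 0 < f i p - f i x by lra.
  rewrite lt_neqAle; apply/andP; split; last first.
    by move: hi; rewrite fy ler_pdivlMr //; lra.
  rewrite eq_sym; apply: contraNneq (hgen _ _ iV jV ij) => fi0.
  have tdj : t * dj = f j p by rewrite /t divfK ?gt_eqF.
  have -> : f i p * f j x - f j p * f i x = - (f i y * dj).
    have -> : f i y * dj = f i p * dj - t * dj * (f i p - f i x) by rewrite fy; ring.
    by rewrite tdj /dj; ring.
  by rewrite fi0 mul0r oppr0.
have yA : Af y.
  have f0 i : i \in J -> 0 <= f i y.
    by move=> iJ; have [->|/(fiy _ iJ)/ltW] := eqVneq i j; rewrite ?fjy.
  move=> a pa; have := f0 (a, false); have := f0 (a, true).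
  rewrite /f /= => h1 h2; rewrite h2 ?memJ //= -subr_ge0 h1 //; exact/memJ.
have pj : pos j.1 by move: (VJ _ jV); case: (j) => a b /memJ.
exists j.1, (j.2 : nat)%:Z, y; split => //; last first.
  by move: jx; rewrite /f; case: j.2 => /= h; [right|left]; split => //; lra.
split; first by move: fjy; rewrite /f /hyperplane /=; case: j.2 => /= h; lra.
move=> b k pb hk; have /andP[h1 h2] := yA b pb.
move: h1 h2; rewrite [pairingR b y]hk ler0z -[1]/(1%:~R) ler_int => h1 h2.
have k01 : k = 0 \/ k = 1 by move: h1 h2; clear; lia.
pose i := (b, k == 1).
have : ~~ (0 < f i y).
  by rewrite /f /= [pairingR b y]hk -leNgt; case: k01 => -> /=; rewrite ?subrr.
have iJ : i \in J by apply/memJ.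
have [<- _|/(fiy _ iJ) -> //] := eqVneq i j.
by split => //=; case: k01 => ->.
Qed.

End AlcoveGeometry.

Section Walls.
Variables (R : realType) (n : nat) (D : rootDatum n) (B : rootBase D).
Implicit Types (a b c : 'rV[int]_n) (x y z : 'cV[R]_n) (w : 'M[int]_n).
Implicit Types (u v s g : affine n) (t : seq (affine n)).
Local Notation pos := (pos_root B).
Local Notation ext := (ext_weyl D).
Local Notation kf := (kf B).
Local Notation alen := (alen B).
Local Notation Af := (@fund_alcove R n D B).
Local Notation box := (@box R n D B).
Local Notation sgen := (sgen R B).
Local Notation Omega := (Omega R B).
Local Notation is_expr := (is_expr R B).

(** The data of the common face of the alcoves of v and vs. The third clause tells which of them
    lies below H_{a,m}: [kf] is m - 1 below and m above. The point z is interior to the face. *)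
Definition wall v s a (m : int) : Prop :=
  [/\ pos a, amul v s = amul (arefl D a m) v,
      kf v a = m /\ kf (amul v s) a = m - 1 \/
      kf v a = m - 1 /\ kf (amul v s) a = m,
      forall b, pos b -> b <> a -> kf (amul v s) b = kf v b &
      exists z, [/\ box v z, box (amul v s) z & on_only B a m z]].

Lemma boxE v a z : box v z -> pos a -> ~ hyperplane a (kf v a) z ->
  ~ hyperplane a (kf v a + 1) z -> (kf v a)%:~R < pairingR a z < (kf v a + 1)%:~R.
Proof.
move=> hz pa n1 n2; have /andP[h1 h2] := hz a pa.
rewrite !lt_neqAle h1 h2 !andbT; apply/andP; split; apply/eqP => e.
  by apply: n1; rewrite /hyperplane /= e.
by apply: n2; rewrite /hyperplane /= e.
Qed.

(** The point z lies strictly between two consecutive hyperplanes of b, and both alcoves must lie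
    between these. *)
Lemma box_kf_eq v v' b z a m : box v z -> box v' z -> on_only B a m z ->
  pos b -> b <> a -> kf v b = kf v' b.
Proof.
move=> hv hv' [_ hu] pb ba.
have nh k : ~ hyperplane b k z by move=> /(hu _ _ pb) [].
have /andP[h1 h2] := boxE hv pb (nh _) (nh _).
have /andP[h3 h4] := boxE hv' pb (nh _) (nh _).
by have := lt_trans h1 h4; have := lt_trans h3 h2; rewrite !ltr_int; lia.
Qed.

Lemma kf_arefl v a m : ext v -> a \in roots D ->
  kf (amul (arefl D a m) v) a = 2 * m - 1 - kf v a.
Proof.
move=> hv ha; rewrite kf_amul /= mul_refl_self // kf_opp // pairingZr.
by rewrite pairing_coroot //; lia.
Qed.

Lemma sgen_ext s : sgen s -> ext s.
Proof. by move=> [a [m [pa _ ->]]]; apply: ext_arefl; exact: pos_rootW pa. Qed.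

Lemma sgenK s : sgen s -> amul s s = aone n.
Proof. by move=> [a [m [pa _ ->]]]; apply: areflK; exact: pos_rootW pa. Qed.

Lemma sgenV s : sgen s -> ainv s = s.
Proof. by move=> [a [m [pa _ ->]]]; apply: ainv_arefl; exact: pos_rootW pa. Qed.

Lemma actV_arefl a m y : hyperplane a m y -> actV (arefl D a m) y = y.
Proof.
move=> hy; rewrite /actV /arefl /= /embed /refl map_mxZ map_mxB map_mx1 map_mxM mulmxBl mul1mx.
rewrite -mulmxA [map_mx intr a *m y]mx11_scalar -/(pairingR a y).
by rewrite [pairingR a y]hy mul_mx_scalar addrC addrNK.
Qed.

(** The wall of A_f fixed by s is carried by v to a hyperplane H_{b0,k0}; (b0, k0) or its negative
    has a positive root, and an interior point of the face is carried along. *)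
Lemma sgen_wall v s : ext v -> sgen s -> exists a m, wall v s a m.
Proof.
move=> hv hs; have sext := sgen_ext hs.
case: hs => a0 [m0 [pa0 [y hy [hy1 hy2]] es]].
have ha0 := pos_rootW pa0.
pose b0 := a0 *m invmx v.2; pose k0 := m0 + pairing b0 v.1.
have hb0 : b0 \in roots D by apply: root_weyl => //; exact: weylV.
have eb0 : b0 *m v.2 = a0 by rewrite /b0 mulmxKV // (weyl_unit hv).
have sy : actV s y = y by rewrite es actV_arefl.
pose z := actV v y.
have bz : box v z by apply: actV_box.
have bz' : box (amul v s) z.
  by rewrite /z -sy -actV_amul; apply: actV_box => //; exact: extM.
have [a [m [pa ea em]]] : exists a m, [/\ pos a, arefl D a m = arefl D b0 k0 &
    (a = b0 /\ m = k0) \/ (a = - b0 /\ m = - k0)].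
  have [p|p] := pos_or_neg B hb0; first by exists b0, k0; split => //; left.
  by exists (- b0), (- k0); rewrite arefl_opp //; split => //; right.
have ha := pos_rootW pa.
have evs : amul v s = amul (arefl D a m) v.
  by rewrite ea -arefl_conj // eb0 /k0 addrK es.
have on : on_only B a m z.
  have hz : hyperplane a m z.
    have hb : pairingR b0 z = k0%:~R.
      by rewrite pairingR_actV eb0 [pairingR a0 y]hy1 /k0 intrD addrC.
    rewrite /hyperplane /=; case: em => [[-> ->] //|[-> ->]].
    by rewrite pairingRNl hb intrN.
  split => // c k pc hc.
  have hc' : pairingR (c *m v.2) y = (k - pairing c v.1)%:~R.
    by have := hc; rewrite /hyperplane /= pairingR_actV intrB => <-; ring.
  have rc := root_weyl (pos_rootW pc) hv.
  have ca : c = a.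
    have [p|p] := pos_or_neg B rc.
      have [e _] := hy2 _ _ p hc'.
      have ec : c = b0 by rewrite /b0 -e mulmxK // (weyl_unit hv).
      case: em => [[-> _] //|[e' _]].
      by case: (pos_opp pc); rewrite ec -e'.
    have hN : hyperplane (- (c *m v.2)) (- (k - pairing c v.1)) y.
      by rewrite /hyperplane /= pairingRNl hc' intrN.
    have [e _] := hy2 _ _ p hN.
    have ec : c = - b0 by rewrite /b0 -e mulNmx mulmxK ?opprK // (weyl_unit hv).
    case: em => [[e' _]|[-> _] //].
    by case: (pos_opp pa); rewrite e' -ec.
  split => //; apply/eqP; rewrite -(eqr_int R) -[X in X == _]hc -[X in _ == X]hz ca.
  by [].
exists a, m; split => //; last by exists z.
  have e2 : kf (amul v s) a = 2 * m - 1 - kf v a by rewrite evs kf_arefl.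
  have := bz a pa; have /= -> := on.1; rewrite !ler_int => /andP[h1 h2].
  lia.
by move=> b pb ba; apply: (box_kf_eq bz' bz on).
Qed.

Lemma wall_ext v s a m : ext v -> wall v s a m -> ext (amul v s).
Proof.
move=> hv [pa -> _ _ _]; apply: extM => //; apply: ext_arefl; exact: pos_rootW pa.
Qed.

(** A common point of the two alcoves is squeezed onto H_{a,m}. *)
Lemma wall_uniq v s a m b k z : ext v -> wall v s a m ->
  box v z -> box (amul v s) z -> pos b -> on_only B b k z -> b = a /\ k = m.
Proof.
move=> hv [pa _ hk _ _] h1 h2 pb on.
suff : hyperplane a m z by move=> /on.2 [].
have /andP[] := h1 a pa; have /andP[] := h2 a pa.
rewrite /hyperplane /=; case: hk => -[-> ->]; rewrite !addrNK => *;
by apply/eqP; rewrite eq_le; apply/andP.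
Qed.

Lemma alen_wall v s a m : wall v s a m ->
  (alen (amul v s) + `|kf v a|%N = alen v + `|kf (amul v s) a|%N)%N.
Proof.
move=> [pa _ _ h _]; have ma : a \in pos_roots B by apply/mem_pos_roots.
rewrite /alen (bigD1_seq a) ?uniq_pos_roots //=.
rewrite [in RHS](bigD1_seq a) ?uniq_pos_roots //=.
set S := (\sum_(_ <- _ | _) _)%N; set S' := (\sum_(_ <- _ | _) _)%N.
suff -> : S = S' by lia.
rewrite /S /S' [LHS]big_seq_cond [RHS]big_seq_cond; apply: eq_bigr => b /andP[mb /eqP ba].
by rewrite h //; apply/mem_pos_roots.
Qed.

Lemma alen_step v s : ext v -> sgen s ->
  alen (amul v s) = (alen v).+1 \/ alen v = (alen (amul v s)).+1.
Proof.
move=> hv hs; have [a [m hw]] := sgen_wall hv hs.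
by have := alen_wall hw; case: hw => _ _ [] [-> ->] _ _; lia.
Qed.

(** The images of A_f are boxes, and a box determines its integers [kf]; so g fixes A_f exactly when
    all of them vanish. *)
Lemma OmegaE g : Omega g <-> ext g /\ alen g = 0%N.
Proof.
split=> [[hg eg]|[hg /eqP /alen0P hk]].
  split => //; apply/eqP/alen0P => a pa.
  have b1 : box (aone n) = box g.
    rewrite -!image_alcove //; last exact: ext1.
    rewrite eg; apply/seteqP; split => [_ [x hx <-]|x hx]; rewrite ?actV1 //.
    by exists x; rewrite ?actV1.
  by rewrite -(box_inj (ext1 D) hg b1 pa) kf1 pos_negr.
split => //; rewrite image_alcove //; apply/seteqP; split => x hx a pa.
  by have := hx a pa; rewrite hk.
by have := hx a pa; rewrite hk.
Qed.

Lemma Omega_ext g : Omega g -> ext g. Proof. by case. Qed.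

Lemma Omega1 : Omega (aone n).
Proof. by apply/OmegaE; split; [exact: ext1|exact: alen1]. Qed.

Lemma kf_Omega v g a : ext v -> Omega g -> a \in roots D -> kf (amul v g) a = kf v a.
Proof.
move=> hv hg ha; have [eg /eqP/alen0P hk] := (OmegaE g).1 hg.
suff e c : c \in roots D -> kf g c = - (negr B c : nat)%:Z.
  by rewrite kf_amul e ?root_weyl.
move=> hc; have [pc|pc] := pos_or_neg B hc; first by rewrite hk // pos_negr.
have := hk _ pc; rewrite kf_opp //.
have -> : negr B c = true by apply: contrapT => /negP/negPf/posN => /(_ hc) /pos_opp.
by move=> /=; lia.
Qed.

Lemma alen_Omega v g : ext v -> Omega g -> alen (amul v g) = alen v.
Proof.
move=> hv hg; rewrite /alen !big_seq; apply: eq_bigr => a /mem_pos_roots pa.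
by rewrite kf_Omega // (pos_rootW pa).
Qed.

Lemma OmegaM g g' : Omega g -> Omega g' -> Omega (amul g g').
Proof.
move=> hg hg'; apply/OmegaE; have [eg lg] := (OmegaE g).1 hg.
by split; [apply: extM => //; exact: Omega_ext|rewrite alen_Omega].
Qed.

Lemma OmegaV g : Omega g -> Omega (ainv g).
Proof.
by move=> /OmegaE [eg lg]; apply/OmegaE; split; [exact: extV|rewrite alenV].
Qed.

Lemma sgen_Omega s : sgen s -> ~ Omega s.
Proof.
move=> hs /OmegaE [es l0]; have := alen_step (ext1 D) hs.
by rewrite amul1v l0 alen1; lia.
Qed.

Lemma sgen_conj g s : Omega g -> sgen s ->
  sgen (amul (amul g s) (ainv g)).
Proof.
move=> hg hs; have eg := Omega_ext hg; have [a [m [pa e _ _ [z [hz _ on]]]]] := sgen_wall eg hs.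
rewrite e (amulvK _ eg); exists a, m; split => //; exists z => //.
by move: hz; rewrite -image_alcove // hg.2.
Qed.

Lemma sgen_wall1 s : sgen s -> exists a m, wall (aone n) s a m /\ s = arefl D a m.
Proof.
move=> hs; have [a [m hw]] := sgen_wall (ext1 D) hs; exists a, m; split => //.
by case: hw => _; rewrite amul1v amulv1.
Qed.

Definition above a m v : bool := m <= kf v a.

(** By invariance of the distance, the length of sv is the distance from s A_f to the alcove of v,
    and A_f and s A_f are separated by H_{a,m} alone. *)
Lemma wall1_len s a m v : ext v -> wall (aone n) s a m ->
  if above a m v == above a m (aone n) then alen (amul s v) = (alen v).+1
  else alen v = (alen (amul s v)).+1.
Proof.
move=> hv [pa]; rewrite amul1v amulv1 => es hk hk2 _.
have hs : ext s by rewrite es; apply: ext_arefl; exact: pos_rootW pa.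
have iss : ainv s = s by rewrite es ainv_arefl ?(pos_rootW pa).
rewrite alen_amul // iss alenE /adist.
have ma : a \in pos_roots B by apply/mem_pos_roots.
rewrite !(bigD1_seq a) ?uniq_pos_roots //=.
set S := (\sum_(_ <- _ | _) _)%N; set S' := (\sum_(_ <- _ | _) _)%N.
have -> : S = S'.
  rewrite /S /S' [LHS]big_seq_cond [RHS]big_seq_cond; apply: eq_bigr => b /andP[mb /eqP ba].
  by rewrite hk2 //; apply/mem_pos_roots.
have k1 : kf (aone n) a = 0 by rewrite kf1 pos_negr.
by rewrite /above; case: hk => -[]; rewrite k1 => h1 ->; case: ifP; lia.
Qed.

Lemma alen_stepl s v : ext v -> sgen s ->
  alen (amul s v) = (alen v).+1 \/ alen v = (alen (amul s v)).+1.
Proof.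
move=> hv hs; have [a [m [hw _]]] := sgen_wall1 hs.
by have := wall1_len hv hw; case: ifP; [left|right].
Qed.

(** An interior point of the alcove of v lies outside A_f, so [face_separation] gives a wall of A_f
    between the two alcoves; the reflection in it shortens v. *)
Lemma left_descent v : ext v -> alen v != 0%N ->
  exists2 s, sgen s & alen v = (alen (amul s v)).+1.
Proof.
move=> hv l0; pose x := actV v (base_point R B).
have hx : ~ Af x.
  move=> hx; move/alen0P: l0; apply => a pa.
  have /andP[h1 h2] := actV_base_point R B hv (pos_rootW pa).
  have /andP[h3 h4] := hx a pa.
  have := lt_le_trans h1 h4; have := le_lt_trans h3 h2.
  by rewrite -[1]/(1%:~R) -[0]/(0%:~R) !ltr_int; lia.
have [a [m [y [pa yA on hxm]]]] := face_separation hx.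
have hs : sgen (arefl D a m) by exists a, m; split => //; exists y.
exists (arefl D a m) => //.
have [a' [m' [hw _]]] := sgen_wall1 hs.
have ha := pos_rootW pa; have /andP[h1 h2] := actV_base_point R B hv ha.
have y1 : box (aone n) y by rewrite -image_alcove; [exists y; rewrite ?actV1|exact: ext1].
have ys : box (amul (aone n) (arefl D a m)) y.
  rewrite amul1v -(actV_arefl on.1); apply: actV_box => //; exact: ext_arefl.
have [ea em] := wall_uniq (ext1 D) hw y1 ys pa on; rewrite -ea -em in hw.
have := wall1_len hv hw; rewrite ifF //; apply/negP; rewrite /above kf1 (pos_negr pa) /=.
case: hxm => -[-> hx1] {hw}.
  by rewrite lexx eqb_id => k0; move: hx1; rewrite ltNge (le_trans _ (ltW h1)) // ler0z.
rewrite eqbF_neg -ltNge => k0.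
have := lt_trans hx1 h2; rewrite -[1]/(1%:~R) ltr_int; lia.
Qed.

Fixpoint wprod t : affine n := if t is s :: t' then amul s (wprod t') else aone n.

Lemma wprod_cat t t' : wprod (t ++ t') = amul (wprod t) (wprod t').
Proof. by elim: t => [|s t IH] /=; rewrite ?amul1v // IH amulA. Qed.

Lemma foldr_amul g t : foldr (@amul n) g t = amul (wprod t) g.
Proof. by elim: t => [|s t IH] /=; rewrite ?amul1v // IH amulA. Qed.

Definition sword t : Prop := forall s, s \in t -> sgen s.

Lemma sword_cons s t : sword (s :: t) <-> sgen s /\ sword t.
Proof.
split=> [h|[h1 h2] x]; last by rewrite inE => /orP[/eqP ->|/h2].
by split=> [|x xt]; apply: h; rewrite inE ?eqxx ?xt ?orbT.
Qed.

Lemma sword_cat t t' : sword (t ++ t') <-> sword t /\ sword t'.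
Proof.
split=> [h|[h1 h2] x]; last by rewrite mem_cat => /orP[/h1|/h2].
by split=> x xt; apply: h; rewrite mem_cat xt ?orbT.
Qed.

Lemma sword_ext t : sword t -> ext (wprod t).
Proof.
elim: t => [_|s t IH /sword_cons[/sgen_ext hs /IH]]; first exact: ext1.
exact: extM.
Qed.

Lemma is_exprE v t : is_expr v t <-> sword t /\ exists2 g, Omega g & v = amul (wprod t) g.
Proof. by split=> -[h1 [g hg e]]; split => //; exists g => //; rewrite ?e foldr_amul // -foldr_amul. Qed.

Lemma alen_expr v t : is_expr v t -> (alen v <= size t)%N.
Proof.
move/is_exprE => [ht [g hg ->]]; rewrite alen_Omega //; last exact: sword_ext.
elim: t ht => [|s t IH] /=; first by rewrite alen1.
move=> /sword_cons[hs ht]; have := IH ht.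
by have := alen_stepl (sword_ext ht) hs; lia.
Qed.

Lemma expr_alen v : ext v -> exists2 t, is_expr v t & size t = alen v.
Proof.
move: {2}(alen v) (erefl (alen v)) => N; elim: N v => [|N IH] v eN hv.
  exists [::]; rewrite ?eN //; apply/is_exprE; split => //.
  by exists v; rewrite ?amul1v //; apply/OmegaE.
have [|s hs es] := left_descent hv; first by rewrite eN.
have [] := IH (amul s v); [lia | exact: extM (sgen_ext hs) hv |].
move=> t /is_exprE [ht [g hg e]] st; exists (s :: t); last by rewrite /= st; lia.
apply/is_exprE; split; first exact/sword_cons.
by exists g => //=; rewrite -amulA -e amulA sgenK // amul1v.
Qed.

Lemma reducedE v t : ext v -> reduced R B v t <-> is_expr v t /\ size t = alen v.
Proof.
move=> hv; split=> [[h1 h2]|[h1 h2]]; split => //.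
  have [t' h3 h4] := expr_alen hv.
  by have := h2 _ h3; have := alen_expr h1; lia.
by move=> t' /alen_expr; rewrite h2.
Qed.

Lemma red_wordP v : ext v -> is_expr v (red_word R B v) /\ size (red_word R B v) = alen v.
Proof.
move=> hv; apply/(reducedE _ hv); apply: xgetPex.
by have [t h1 h2] := expr_alen hv; exists t; apply/reducedE.
Qed.

Lemma len_alen v : ext v -> len R B v = alen v.
Proof. by move=> /red_wordP []. Qed.

(** The unfolded gallery of type t from u changes sides of H_{a,m} at some letter s', and the
    reflection in the hyperplane crossed there is s. The letter g does not move the alcove. *)
Lemma crossing u t g s a m : ext u -> sword t -> Omega g ->
  wall (aone n) s a m -> above a m u != above a m (amul u (amul (wprod t) g)) ->
  exists t1 s' t2, t = t1 ++ s' :: t2 /\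
    amul s (amul u (wprod t1)) = amul (amul u (wprod t1)) s'.
Proof.
move=> hu ht hg hw; have [pa] := hw; rewrite amul1v amulv1 => es _ _ [z [_ _ on]].
elim: t u hu ht => [|s1 t IH] u hu /=.
  by rewrite amul1v /above kf_Omega ?(pos_rootW pa) // eqxx.
move=> /sword_cons [hs1 ht].
have [e|ne] := eqVneq (above a m u) (above a m (amul u s1)).
  rewrite e -amulA amulA => /(IH (amul u s1)) [||t1 [s' [t2 [et e']]]] //.
    exact: extM hu (sgen_ext hs1).
  by exists (s1 :: t1), s', t2; rewrite et /= [amul u (amul s1 _)]amulA.
move=> _; exists [::], s1, t; split => //=; rewrite amulv1.
have [a1 [m1 [pa1 e1 k1 k2 _]]] := sgen_wall hu hs1.
have ea : a = a1.
  by apply: contrapT => aa; move: ne; rewrite /above k2 // eqxx.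
move: ne; rewrite /above ea => ne.
by rewrite e1 es ea; congr (amul (arefl D _ _) _); case: k1 ne => -[-> ->]; lia.
Qed.

(** A descent means that the hyperplane of s separates A_f from the alcove of v; the gallery of the
    word t crosses it, and the letter at the crossing is deleted. *)
Lemma exchange s v t : ext v -> sgen s -> is_expr v t ->
  alen v = (alen (amul s v)).+1 ->
  exists t1 s' t2, [/\ t = t1 ++ s' :: t2,
    amul s (wprod t1) = amul (wprod t1) s' & is_expr (amul s v) (t1 ++ t2)].
Proof.
move=> hv hs /is_exprE [ht [g hg ev]] hl.
have [a [m [hw _]]] := sgen_wall1 hs.
have hab : above a m (aone n) != above a m (amul (aone n) (amul (wprod t) g)).
  rewrite amul1v -ev eq_sym; have := wall1_len hv hw; case: ifP => //; lia.
have [t1 [s' [t2 [et]]]] := crossing (ext1 D) ht hg hw hab.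
rewrite !amul1v => e; exists t1, s', t2; split => //; apply/is_exprE.
move: ht; rewrite et => /sword_cat [h1 /sword_cons[hs' h2]].
split; first exact/sword_cat; exists g => //.
rewrite ev et !wprod_cat /= !amulA e -!amulA; congr (amul _ _).
by rewrite amulA sgenK // amul1v.
Qed.

Lemma sword_reduce t : sword t ->
  exists t', [/\ sword t', wprod t' = wprod t, size t' = alen (wprod t) &
                (size t' <= size t)%N].
Proof.
elim: t => [|s t IH] /=; first by exists [::]; rewrite alen1.
move=> /sword_cons[hs /[dup] /sword_ext ht /IH [t' [ht' e l lt]]].
have [up|down] := alen_stepl ht hs.
  by exists (s :: t'); split => //=; [exact/sword_cons|rewrite e|rewrite up l].
have ex : is_expr (wprod t) t'.
  by apply/is_exprE; split => //; exists (aone n); [exact: Omega1|rewrite e amulv1].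
have [t1 [s' [t2 [et e' _]]]] := exchange ht hs ex down.
move: ht'; rewrite et => /sword_cat [h1 /sword_cons[hs' h2]].
have sz : size (t1 ++ t2) = (alen (amul s (wprod t))).
  by have := congr1 size et; rewrite !size_cat /= l; lia.
exists (t1 ++ t2); split => //; first exact/sword_cat.
  rewrite -e et !wprod_cat /= amulA [amul s _ ]e' -!amulA; congr (amul _ _).
  by rewrite amulA sgenK // amul1v.
by have := congr1 size et; rewrite !size_cat /=; lia.
Qed.

(** * Weights of reduced words *)

Section Weights.
Variable d : affine n -> nat.
Hypothesis d_inv : conj_invariant R B d.

(** Exchange makes the first letter s of one word conjugate to a letter s' of the other, so both
    have the same weight; removing them leaves two reduced words of sv. The braid relations are thus
    avoided. *)
Lemma reduced_weight v t t' : ext v -> reduced R B v t -> reduced R B v t' ->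
  (\sum_(s <- t) d s = \sum_(s <- t') d s)%N.
Proof.
elim: t t' v => [|s t IH] t' v hv.
  by move=> /(reducedE _ hv)[_ /= l0] /(reducedE _ hv)[_]; rewrite -l0 => /size0nil ->.
move=> /(reducedE _ hv) [/is_exprE [/sword_cons [hs ht] [g hg ev]] sz].
move=> /(reducedE _ hv) [ex' sz'].
have sv : amul s v = amul (wprod t) g by rewrite ev /= !amulA sgenK // amul1v.
have hsv : ext (amul s v) by apply: extM => //; exact: sgen_ext.
have ext' : is_expr (amul s v) t by apply/is_exprE; split => //; exists g.
have down : alen v = (alen (amul s v)).+1.
  have := alen_expr ext'; have /= := sz.
  by case: (alen_stepl hv hs); lia.
have [t1 [s' [t2 [et e ex2]]]] := exchange hv hs ex' down.
rewrite et big_cat /= !big_cons.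
have [h1 _] := (is_exprE _ _).1 ex2; have [ht1 _] := (sword_cat _ _).1 h1.
have hs' : sgen s'.
  by have [/sword_cat [_ /sword_cons[]]] := (is_exprE v (t1 ++ s' :: t2)).1 (eq_ind _ (is_expr v) ex' _ et).
have -> : d s = d s' by symmetry; apply: (d_inv hs' hs (sword_ext ht1)); rewrite e.
rewrite (IH (t1 ++ t2) (amul s v)) ?big_cat //=; first by rewrite addnCA.
  by apply/reducedE => //; split => //; move: sz => /=; lia.
apply/reducedE => //; split => //.
by move: sz'; rewrite et !size_cat /=; lia.
Qed.

(** The exponent of q in q_v. *)
Definition dlen v : nat := (\sum_(s <- red_word R B v) d s)%N.

Lemma dlen_reduced v t : ext v -> reduced R B v t -> dlen v = (\sum_(s <- t) d s)%N.
Proof.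
move=> hv ht; apply: reduced_weight ht => //.
by apply/reducedE => //; exact: red_wordP.
Qed.

(** The Omega part g of u is moved through the word of v: conjugation by g preserves S^a and the
    weights, so the two words concatenate to a reduced word of uv. *)
Lemma dlenM u v : ext u -> ext v -> alen (amul u v) = (alen u + alen v)%N ->
  dlen (amul u v) = (dlen u + dlen v)%N.
Proof.
move=> hu hv hl.
have [/is_exprE [htu [g hg eu]] su] := red_wordP hu.
have [/is_exprE [htv [g' hg' ev]] sv] := red_wordP hv.
pose c s := amul (amul g s) (ainv g); have eg := Omega_ext hg.
have hc t : sword t -> sword (map c t) /\ amul g (wprod t) = amul (wprod (map c t)) g.
  elim: t => [_|s t IH /sword_cons[hs /IH [h1 h2]]] /=.
    by rewrite amul1v amulv1.
  split; first by apply/sword_cons; split => //; exact: sgen_conj.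
  by rewrite -amulA -h2 /c [RHS]amulA (amulvKV _ eg) -amulA.
have [h1 h2] := hc _ htv.
rewrite (@dlen_reduced _ (red_word R B u ++ map c (red_word R B v))); first last.
- apply/reducedE; first exact: extM.
  split; last by rewrite size_cat size_map su sv.
  apply/is_exprE; split; first exact/sword_cat.
  exists (amul g g'); first exact: OmegaM.
  by rewrite {1}eu {1}ev wprod_cat -!amulA [amul g (amul _ g')]amulA h2 -!amulA.
- exact: extM.
rewrite big_cat big_map /=; congr (_ + _)%N; rewrite /dlen !big_seq.
apply: eq_bigr => s /htv hs; symmetry; apply: (d_inv hs (sgen_conj hg hs) eg).
by rewrite /c (amulvKV _ eg).
Qed.

Lemma alen_sgen s : sgen s -> alen s = 1%N.
Proof. by move=> hs; have := alen_step (ext1 D) hs; rewrite amul1v alen1; case. Qed.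

Lemma dlen_sgen s : sgen s -> dlen s = d s.
Proof.
move=> hs; rewrite (@dlen_reduced _ [:: s]) ?big_seq1 //; first exact: sgen_ext.
apply/reducedE; [exact: sgen_ext|split; last by rewrite alen_sgen].
apply/is_exprE; split; first by apply/sword_cons.
by exists (aone n); [exact: Omega1|rewrite /= !amulv1].
Qed.

Lemma dlen_Omega g : Omega g -> dlen g = 0%N.
Proof.
move=> hg; have eg := Omega_ext hg; rewrite /dlen.
have [_] := red_wordP eg; have [_ ->] := (OmegaE g).1 hg.
by move=> /size0nil ->; rewrite big_nil.
Qed.

Lemma dlenV v : ext v -> dlen (ainv v) = dlen v.
Proof.
move: {2}(alen v) (erefl (alen v)) => N; elim: N v => [|N IH] v eN hv.
  by rewrite !dlen_Omega //; [|apply: OmegaV]; apply/OmegaE.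
have [|s hs es] := left_descent hv; first by rewrite eN.
have hsv : ext (amul s v) by apply: extM => //; exact: sgen_ext.
have ev : v = amul s (amul s v) by rewrite amulA sgenK // amul1v.
have l1 := alen_sgen hs.
rewrite [in RHS]ev dlenM //; [|exact: sgen_ext|by rewrite -ev; lia].
have eva : ainv v = amul (ainv (amul s v)) s.
  by rewrite {1}ev (ainvM (sgen_ext hs) hsv) (sgenV hs).
rewrite eva dlenM; [|exact: extV|exact: sgen_ext|].
  by rewrite addnC; congr (_ + _)%N; apply: IH => //; lia.
by rewrite -eva !alenV //; lia.
Qed.

End Weights.
End Walls.

Lemma exists_argmin (T : Type) (P : T -> Prop) (f : T -> nat) :
  (exists x, P x) -> exists x, P x /\ forall y, P y -> (f x <= f y)%N.
Proof.
move=> [x0 Px0]; move: {2}(f x0) (leqnn (f x0)) => N.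
elim: N x0 Px0 => [|N IH] x0 Px0 hN.
  by exists x0; split=> // y _; move: hN; rewrite leqn0 => /eqP ->.
have [[y [Py hy]]|h] := pselect (exists y, P y /\ (f y < f x0)%N).
  by apply: (IH y) => //; rewrite -ltnS; apply: leq_trans hN.
by exists x0; split=> // y Py; rewrite leqNgt; apply/negP => hy; apply: h; exists y.
Qed.

Lemma exists_argmax (T : Type) (P : T -> Prop) (f : T -> nat) b :
  (exists x, P x) -> (forall x, P x -> (f x <= b)%N) ->
  exists x, P x /\ forall y, P y -> (f y <= f x)%N.
Proof.
move=> hP hb; have [x [Px hx]] := @exists_argmin _ P (fun x => (b - f x)%N) hP.
by exists x; split=> // y Py; have := hx y Py; have := hb x Px; have := hb y Py; lia.
Qed.

(** * Stabilizers and minimal representatives *)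

Section WeylCombinatorics.
Variables (R : realType) (n : nat) (D : rootDatum n) (B : rootBase D).
Implicit Types (a b c : 'rV[int]_n) (x y w : 'M[int]_n) (kap mu nu : 'cV[int]_n).
Implicit Types (u v s g : affine n).
Local Notation alpha := (simple B).
Local Notation pos := (pos_root B).
Local Notation ext := (ext_weyl D).
Local Notation kf := (kf B).
Local Notation alen := (alen B).
Local Notation negr := (negr B).
Local Notation Af := (@fund_alcove R n D B).
Local Notation sgen := (sgen R B).
Local Notation box := (@box R n D B).
Local Notation weyl := (weyl D).
Local Notation stab := (stab D).
Local Notation longest := (longest R B).
Local Notation w0 := (w0 R B).
Local Notation dom := (dominant B).

Lemma face_wall1 a m (z : 'cV[R]_n) : pos a -> Af z -> on_only B a m z ->
  wall R B (aone n) (arefl D a m) a m.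
Proof.
move=> pa zA on; have hs : sgen (arefl D a m) by exists a, m; split => //; exists z.
have [a' [m' [hw _]]] := sgen_wall1 hs; have ha := pos_rootW pa.
have z1 : box (aone n) z by rewrite -image_alcove; [exists z; rewrite ?actV1|exact: ext1].
have zs : box (amul (aone n) (arefl D a m)) z.
  rewrite amul1v -(actV_arefl D on.1); apply: actV_box => //; exact: ext_arefl.
by have [ea em] := wall_uniq (ext1 D) hw z1 zs pa on; rewrite -ea -em in hw.
Qed.

(** The witness is the average r of 2 rho^vee and its image under s_i. It is orthogonal to alpha_i
    and positive on the other positive roots, and division by [rho_bound] brings it into A_f. *)
Lemma simple_wall i : wall R B (aone n) (lin (refl D (alpha i))) (alpha i) 0.
Proof.
have -> : lin (refl D (alpha i)) = arefl D (alpha i) 0 by rewrite /arefl scale0r.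
have hi := simple_root i; have pi := simple_pos i; have M0 := rho_bound_gt0 R B.
pose r := rho2 B - coroot D (alpha i).
have rE b : 2 * pairing b r = pairing b (rho2 B) + pairing (b *m refl D (alpha i)) (rho2 B).
  by rewrite /r pairingBr mul_refl pairingBl pairingZl pairing_simple_rho2; ring.
have r0 b : pos b -> b <> alpha i -> 0 < pairing b r < rho_bound B.
  move=> pb bi; have pb' := pos_refl_simple pb bi.
  have := pos_rho2 pb; have := pos_rho2 pb'; have := rE b.
  have := rho_bound_gt B (pos_rootW pb); have := rho_bound_gt B (pos_rootW pb'); lia.
have ri : pairing (alpha i) r = 0.
  by have := rE (alpha i); rewrite mul_refl_self // pairingNl; lia.
pose z : 'cV[R]_n := (rho_bound B)%:~R^-1 *: embed R r.
have zE b : pairingR b z = (pairing b r)%:~R / (rho_bound B)%:~R.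
  by rewrite /z pairingRZr pairingR_embed mulrC.
have zi : hyperplane (alpha i) 0 z by rewrite /hyperplane /= zE ri mul0r.
have zb b : pos b -> b <> alpha i -> 0 < pairingR b z < 1.
  move=> pb bi; have /andP[h1 h2] := r0 b pb bi; have hM : 0 < rho_bound B by lia.
  rewrite zE divr_gt0 ?ltr0z //=; by rewrite ltr_pdivrMr // mul1r ltr_int.
apply: (@face_wall1 _ _ z) => //.
  move=> b pb; have [->|/eqP bi] := eqVneq b (alpha i); first by rewrite [pairingR _ z]zi lexx ler01.
  by have /andP[h1 h2] := zb b pb bi; rewrite !ltW.
split=> // b k pb hb; have [eb|/eqP bi] := eqVneq b (alpha i).
  by split=> //; apply/eqP; rewrite -(eqr_int R); move: hb; rewrite eb /hyperplane /= zi => ->.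
have := zb b pb bi; rewrite [pairingR b z]hb -[0]/(0%:~R) -[1]/(1%:~R) !ltr_int; lia.
Qed.

Lemma simple_sgen i : sgen (lin (refl D (alpha i))).
Proof.
have [pa e _ _ [z [h _ on]]] := simple_wall i; move: e; rewrite amul1v amulv1 => ->.
exists (alpha i), 0; split => //; exists z => //.
by move: h; rewrite -image_alcove; [case=> z' h' <-; rewrite actV1|exact: ext1].
Qed.

Lemma alen_refl_lin i w : weyl w ->
  if negr (alpha i *m w) then alen (lin w) = (alen (lin (refl D (alpha i) *m w))).+1
  else alen (lin (refl D (alpha i) *m w)) = (alen (lin w)).+1.
Proof.
move=> hw; have := wall1_len (ext_lin hw) (simple_wall i).
rewrite -linM /above kf1 kf_lin (pos_negr (simple_pos i)).
by case: negr.
Qed.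

Lemma dominant_sum kap a (c : 'I_(base_size B) -> nat) w : dom kap ->
  a = \sum_j (c j)%:Z *: alpha j -> pairing a kap = 0 -> forall j, (0 < c j)%N ->
  pairing (alpha j) kap = 0.
Proof.
move=> hk e h0 j cj; have : \sum_j (c j)%:Z * pairing (alpha j) kap == 0.
  move: h0; rewrite e pairing_suml => h0; rewrite -[X in _ == X]h0; apply/eqP.
  by apply: eq_bigr => i _; rewrite pairingZl.
rewrite psumr_eq0 => [|i _]; last by rewrite mulr_ge0 // hk //; exact: simple_pos.
move/allP/(_ j); rewrite mem_index_enum => /(_ isT) /=.
by rewrite mulf_eq0 => /orP[|/eqP //]; rewrite eqz_nat; lia.
Qed.

(** A positive root orthogonal to the dominant [kap] is a combination of simple roots orthogonal to
    [kap], so their common sign after w is also the sign of [a *m w]. *)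
Lemma orth_negr kap w a (e : bool) : dom kap -> weyl w ->
  (forall i, pairing (alpha i) kap = 0 -> negr (alpha i *m w) = e) ->
  pos a -> pairing a kap = 0 -> negr (a *m w) = e.
Proof.
move=> hk hw h pa a0; have [c ea _] := pos_coefE pa.
have haw := root_weyl (pos_rootW pa) hw.
have n0 := @root_rho2_neq0 _ _ B _ haw.
have hs j : (0 < c j)%N -> negr (alpha j *m w) = e.
  by move=> cj; apply: h; apply: (dominant_sum w hk ea).
have eS : pairing (a *m w) (rho2 B) = \sum_j (c j)%:Z * pairing (alpha j *m w) (rho2 B).
  rewrite {1}ea mulmx_suml pairing_suml; apply: eq_bigr => j _.
  by rewrite -scalemxAl pairingZl.
move: hs n0; rewrite /negr eS; case: e {h} => hs n0.
  rewrite lt_neqAle; apply/andP; split; first exact/eqP.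
  apply: sumr_le0 => j _; case: (posnP (c j)) => [->|cj]; first by rewrite mul0r.
  by have := hs j cj; nia.
apply/negbTE; rewrite -leNgt; apply: sumr_ge0 => j _.
case: (posnP (c j)) => [->|cj]; first by rewrite mul0r.
by have := hs j cj; nia.
Qed.

Lemma stab_weyl kap w : stab kap w -> weyl w. Proof. by case. Qed.

Lemma stab1 kap : stab kap 1%:M.
Proof. by split; [exact: weyl1|rewrite mul1mx]. Qed.

Lemma stabM kap x y : stab kap x -> stab kap y -> stab kap (x *m y).
Proof. by move=> [hx ex] [hy ey]; split; [exact: weylM|rewrite -mulmxA ey]. Qed.

Lemma stabV kap x : stab kap x -> stab kap (invmx x).
Proof. by move=> [hx ex]; split; [exact: weylV|rewrite -{1}ex (weyl_mulVK _ hx)]. Qed.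

Lemma stab0 : stab 0 = weyl.
Proof. by apply/seteqP; split=> w; [case|move=> hw; split=> //; rewrite mulmx0]. Qed.

Lemma stabN kap : stab (- kap) = stab kap.
Proof.
apply/seteqP; split=> w [hw e]; split=> //; last by rewrite mulmxN e.
by apply: oppr_inj; rewrite -mulmxN.
Qed.

Lemma dominant0 : dom 0. Proof. by move=> a _; rewrite pairing0r. Qed.

Lemma simple_stab kap i : pairing (alpha i) kap = 0 -> stab kap (refl D (alpha i)).
Proof.
move=> e; split; first by apply: weyl_refl; exact: simple_root.
by rewrite refl_mul e scale0r subr0.
Qed.

Lemma stab_pairing kap x a : stab kap x -> pairing (a *m x) kap = pairing a kap.
Proof. by move=> [_ e]; rewrite pairing_mulmx e. Qed.

Lemma dominant_pos kap a : dom kap -> a \in roots D -> 0 < pairing a kap -> negr a = false.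
Proof.
move=> hk ha h; apply/posN => //; have [//|p] := pos_or_neg B ha.
by have := hk _ p; rewrite pairingNl; lia.
Qed.

Lemma stab_negr kap x a : dom kap -> stab kap x -> pos a -> pairing a kap <> 0 ->
  negr (a *m x) = false.
Proof.
move=> hk hx pa a0; apply: (@dominant_pos kap) => //.
  by apply: root_weyl; [exact: pos_rootW pa|exact: stab_weyl hx].
by rewrite stab_pairing //; have := hk a pa; lia.
Qed.

Lemma alen_lin_le w : (alen (lin w) <= size (pos_roots B))%N.
Proof.
rewrite alen_lin -sum1_size; apply: leq_sum => a _; by case: negr.
Qed.

(** If a simple root orthogonal to [kap] stayed positive, multiplication by its reflection would
    give a longer element of the stabilizer. The sign pattern characterizes the element; [kap = 0]
    covers w_0. *)
Lemma longestP kap : dom kap -> stab kap (longest (stab kap)) /\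
  forall a, pos a -> negr (a *m longest (stab kap)) = (pairing a kap == 0).
Proof.
move=> hk; set wk := longest _.
have [hs hmax] : stab kap wk /\ forall w', stab kap w' -> (len R B (lin w') <= len R B (lin wk))%N.
  apply: (@xgetPex _ _ [set w | stab kap w /\ forall w', stab kap w' ->
    (len R B (lin w') <= len R B (lin w))%N]); apply: (@exists_argmax _ (stab kap) (fun w => len R B (lin w)) (size (pos_roots B))).
    by exists 1%:M; exact: stab1.
  by move=> w [hw _]; rewrite len_alen // alen_lin_le.
split=> // a pa; case: eqP => [e|e]; last exact: stab_negr hs pa e.
have hw := stab_weyl hs.
apply: (orth_negr hk hw _ pa e) => i hi.
have := alen_refl_lin i hw; case: ifP => // _ hl.
have := hmax _ (stabM (simple_stab hi) hs); rewrite !len_alen //; last first.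
  by apply: ext_lin; apply: weylM => //; apply: weyl_refl; exact: simple_root.
by rewrite hl ltnn.
Qed.

Lemma longest_weyl kap : dom kap -> weyl (longest (stab kap)).
Proof. by move=> /longestP [[]]. Qed.

Lemma longest_invol kap : dom kap -> longest (stab kap) *m longest (stab kap) = 1%:M.
Proof.
move=> hk; have [hs h] := longestP hk; have hw := longest_weyl hk.
apply: (@weyl_pos_id _ _ B _ (weylM hw hw)).
move=> a pa; have ha := root_weyl (pos_rootW pa) hw.
rewrite mulmxA; apply/posN; first exact: root_weyl.
have := h a pa; have e := stab_pairing a hs.
case: (pairing a kap == 0) / eqP => [a0|a0] na.
  have := h _ (negr_pos ha na); rewrite pairingNl e a0 oppr0 eqxx mulNmx negr_opp.
    by case: negr.
  exact: root_weyl.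
have pb : pos (a *m longest (stab kap)) by apply/posN.
by rewrite h // e; apply/eqP.
Qed.

Lemma invmx_longest kap : dom kap -> invmx (longest (stab kap)) = longest (stab kap).
Proof.
move=> hk; have wu := weyl_unit (longest_weyl hk).
by rewrite -[LHS]mulmx1 -(longest_invol hk) mulKmx.
Qed.

Lemma w0E : w0 = longest (stab 0). Proof. by rewrite /Defs.w0 stab0. Qed.

Lemma weyl_w0 : weyl w0. Proof. by rewrite w0E; apply: longest_weyl; exact: dominant0. Qed.

Lemma w0_invol : w0 *m w0 = 1%:M.
Proof. by rewrite w0E; apply: longest_invol; exact: dominant0. Qed.

Lemma invmx_w0 : invmx w0 = w0.
Proof. by rewrite w0E; apply: invmx_longest; exact: dominant0. Qed.

Lemma negr_w0 a : a \in roots D -> negr (a *m w0) = ~~ negr a.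
Proof.
have h b : pos b -> negr (b *m w0).
  by move=> pb; rewrite w0E (longestP dominant0).2 // pairing0r.
move=> ha; have [pa|pa] := pos_or_neg B ha; first by rewrite h // pos_negr.
have := h _ pa; have := pos_negr pa; rewrite mulNmx !negr_opp ?(root_weyl ha weyl_w0) //.
by do 2 case: negr.
Qed.

Lemma alen_linM x y : weyl x -> weyl y ->
  alen (lin (x *m y)) = \sum_(a <- pos_roots B) (negr (a *m invmx x) != negr (a *m y) : nat).
Proof.
move=> hx hy; rewrite linM alen_amul // ainv_lin; apply: eq_bigr => a _.
by rewrite !kf_lin; do 2 case: negr.
Qed.

Lemma weyl_invM x y : weyl x -> weyl y -> invmx (x *m y) = invmx y *m invmx x.
Proof.
by move=> hx hy; have := ainvM (ext_lin hx) (ext_lin hy); rewrite -linM !ainv_lin -linM => /lin_inj.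
Qed.

Lemma alen_linV x : weyl x -> alen (lin (invmx x)) = alen (lin x).
Proof. by move=> hx; rewrite -ainv_lin alenV. Qed.

Lemma alen_longest kap x : dom kap -> stab kap x ->
  (alen (lin (longest (stab kap) *m x)) + alen (lin x) = alen (lin (longest (stab kap))))%N.
Proof.
move=> hk hx; have [hs h] := longestP hk; have hw := longest_weyl hk.
rewrite (alen_linM hw (stab_weyl hx)) !alen_lin -big_split /= !big_seq.
apply: eq_bigr => a /mem_pos_roots pa; rewrite invmx_longest // h //.
case: (eqVneq (pairing a kap) 0) => [e|/eqP e]; first by case: negr.
by rewrite (stab_negr hk hx pa e).
Qed.

Lemma alen_w0 x : weyl x -> (alen (lin (w0 *m x)) + alen (lin x) = alen (lin w0))%N.
Proof. by move=> hx; rewrite w0E alen_longest ?stab0 //; exact: dominant0. Qed.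

Lemma alen_w0r x : weyl x -> (alen (lin (x *m w0)) + alen (lin x) = alen (lin w0))%N.
Proof.
move=> hx; rewrite -(alen_w0 (weylV hx)) (alen_linV hx) -[in RHS]alen_linV; last first.
  by apply: weylM; [exact: weyl_w0|exact: weylV].
by rewrite (weyl_invM weyl_w0 (weylV hx)) invmxK invmx_w0.
Qed.

(** For dominant [kap]: w is the minimal element of the coset W_kap w. These are the inverses of the
    elements of W^kap ([min_repsE]). *)
Definition kmin kap w : Prop :=
  weyl w /\ forall a, pos a -> pairing a kap = 0 -> negr (a *m w) = false.

Lemma kmin_weyl kap w : kmin kap w -> weyl w. Proof. by case. Qed.

Lemma kminM_alen kap x y : dom kap -> stab kap x -> kmin kap y ->
  alen (lin (x *m y)) = (alen (lin x) + alen (lin y))%N.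
Proof.
move=> hk hx [hy h]; have hxw := stab_weyl hx.
rewrite alen_linM // -[in RHS](alen_linV hxw) !alen_lin -big_split /= !big_seq.
apply: eq_bigr => a /mem_pos_roots pa.
case: (eqVneq (pairing a kap) 0) => [e|/eqP e]; first by rewrite h //; case: negr.
by rewrite (stab_negr hk (stabV hx) pa e); case: negr.
Qed.

Lemma kmin_decomp kap w : dom kap -> weyl w ->
  exists x y, [/\ stab kap x, kmin kap y & w = x *m y].
Proof.
move=> hk hw.
have [x [hx hmin]] := @exists_argmin _ (stab kap) (fun x => alen (lin (x *m w)))
   (ex_intro _ 1%:M (stab1 kap)).
have hxw := stab_weyl hx; have hxx := weylM hxw hw.
exists (invmx x), (x *m w); split; [exact: stabV| |by rewrite mulKmx // (weyl_unit hxw)].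
split=> // a pa a0; apply: (orth_negr hk hxx _ pa a0) => i hi.
have := alen_refl_lin i hxx; case: ifP => // _ hl.
by have := hmin _ (stabM (simple_stab hi) hx); rewrite -mulmxA hl ltnn.
Qed.

(** With z = x'^-1 x one has y' = z y and y = z^-1 y', both length additive, so z has length 0. *)
Lemma kmin_uniq kap x y x' y' : dom kap -> stab kap x -> kmin kap y ->
  stab kap x' -> kmin kap y' -> x *m y = x' *m y' -> x = x' /\ y = y'.
Proof.
move=> hk hx hy hx' hy' e.
have ux := weyl_unit (stab_weyl hx); have ux' := weyl_unit (stab_weyl hx').
pose z := invmx x' *m x; have hz : stab kap z by apply: stabM => //; exact: stabV.
have ezy : z *m y = y' by rewrite /z -mulmxA e mulKmx.
have ezy' : invmx z *m y' = y by rewrite -ezy mulKmx // (weyl_unit (stab_weyl hz)).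
have h1 := kminM_alen hk hz hy; have h2 := kminM_alen hk (stabV hz) hy'.
rewrite ezy in h1; rewrite ezy' in h2.
have z1 : z = 1%:M by apply: (@weyl_alen0 _ _ B _ (stab_weyl hz)); move: h1 h2; lia.
split; last by rewrite -ezy z1 mul1mx.
by rewrite -[x](mulKVmx ux') -/z z1 mulmx1.
Qed.

Lemma min_repsE kap w : dom kap -> min_reps R B kap w <-> weyl w /\ kmin kap (invmx w).
Proof.
move=> hk; split.
  move=> [hw hmin]; split=> //.
  have [x [y [hx hy e]]] := kmin_decomp hk (weylV hw).
  have hxw := stab_weyl hx; have hyw := kmin_weyl hy.
  have ew : w *m x = invmx y.
    apply: (can_inj (mulKmx (weyl_unit (weylV hw)))); rewrite mulKmx ?(weyl_unit hw) //.
    by rewrite e -mulmxA mulmxV ?mulmx1 // (weyl_unit hyw).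
  have := hmin _ hx; rewrite !len_alen //; last by apply: ext_lin; exact: weylM.
  rewrite ew alen_linV // -(alen_linV hw) e (kminM_alen hk hx hy) => hl.
  have -> : x = 1%:M by apply: (@weyl_alen0 _ _ B _ hxw); move: hl; lia.
  by rewrite mul1mx.
move=> [hw hk'] ; split=> // u hu; have huw := stab_weyl hu.
rewrite !len_alen //; last by apply: ext_lin; exact: weylM.
rewrite -(alen_linV hw) -(alen_linV (weylM hw huw)).
by rewrite (weyl_invM hw huw) (kminM_alen hk (stabV hu) hk') leq_addl.
Qed.

Lemma dominant_w0 mu : dom mu -> dom (- (w0 *m mu)).
Proof.
move=> hm a pa; rewrite pairingNr -pairing_mulmx -pairingNl; apply: hm.
apply: negr_pos; first by apply: root_weyl; [exact: pos_rootW pa|exact: weyl_w0].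
by rewrite negr_w0 ?(pos_rootW pa) // pos_negr.
Qed.

Lemma dominant_kf v : ext v -> (forall a, pos a -> 0 <= kf v a) -> dom v.1.
Proof.
by move=> hv h a pa; have := h a pa; rewrite /kf; case: negr => /=; lia.
Qed.

(** The alcoves of C with marked vertex nu are the nu + A_w with w minimal in W_nu w: only a root
    orthogonal to nu can give a negative [kf]. *)
Lemma trans_kmin nu w : dom nu -> weyl w ->
  (forall a, pos a -> 0 <= kf (nu, w) a) <-> kmin nu w.
Proof.
move=> hn hw; split=> [h|[_ h] a pa].
  by split=> // a pa a0; have := h a pa; rewrite /kf /= a0; case: negr.
rewrite /kf /=; case: (eqVneq (pairing a nu) 0) => [e|/eqP e]; first by rewrite h ?e.
by have := hn a pa; case: negr => /=; lia.
Qed.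

Lemma alen_trans_kmin nu w : dom nu -> kmin nu w ->
  (alen (nu, w) + alen (lin w) = alen (trans nu))%N.
Proof.
move=> hn [hw h]; rewrite /alen -big_split /= !big_seq.
apply: eq_bigr => a /mem_pos_roots pa; rewrite kf_lin /kf /= mulmx1 (pos_negr pa).
have := hn a pa; have := h a pa.
case: (negr _) => /= e h0; last by lia.
suff : pairing a nu <> 0 by lia.
by move/e.
Qed.

(** On every positive root the alcove of x^-1 has [kf] equal to 0 or -1, and that of v has it >= 0;
    the distances from A_f therefore add up. *)
Lemma alen_lin_amul x v : weyl x -> ext v -> (forall a, pos a -> 0 <= kf v a) ->
  alen (amul (lin x) v) = (alen (lin x) + alen v)%N.
Proof.
move=> hx hv h; rewrite alen_amul // ainv_lin -(alen_linV hx) /alen /adist -big_split /= !big_seq.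
by apply: eq_bigr => a /mem_pos_roots pa; rewrite kf_lin; have := h a pa; lia.
Qed.

Lemma alen_amul_lin x v : weyl x -> ext v -> (forall a, pos a -> 0 <= kf (ainv v) a) ->
  alen (amul v (lin x)) = (alen v + alen (lin x))%N.
Proof.
move=> hx hv h; rewrite alen_amul // -(alenV B hv) /alen /adist -big_split /= !big_seq.
by apply: eq_bigr => a /mem_pos_roots pa; rewrite kf_lin; have := h a pa; case: negr => /=; lia.
Qed.

Lemma negr_longest_w0 mu a : dom mu -> pos a ->
  negr (a *m (longest (stab mu) *m w0)) = (pairing a mu != 0).
Proof.
move=> hm pa; have [hs h] := longestP hm.
rewrite mulmxA negr_w0 ?h // ; apply: root_weyl; [exact: pos_rootW pa|exact: longest_weyl].
Qed.

(** The element w_mu w_0 makes a negative exactly when <a, mu> > 0, and so minimizes every term of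
    the length at once. A minimizer chosen by [nmin] must agree with it term by term, which leaves
    only one. *)
Lemma nminE mu : dom mu -> nmin R B mu = (mu, longest (stab mu) *m w0).
Proof.
move=> hm; have hlw := longest_weyl hm; have h0 := weyl_w0.
pose w1 := longest (stab mu) *m w0; have hw1 : weyl w1 by exact: weylM.
have mins w a : weyl w -> pos a -> (`|kf (mu, w1) a| <= `|kf (mu, w) a|)%N.
  move=> hw pa; rewrite /kf /= negr_longest_w0 //; have := hm a pa.
  by case: eqP => [->|]; case: negr => /=; lia.
have [w [hw e hmin]] : exists w, [/\ weyl w, nmin R B mu = (mu, w) &
    forall w', weyl w' -> (alen (mu, w) <= alen (mu, w'))%N].
  have [w [hw hmin]] := @exists_argmin _ weyl (fun w => alen (mu, w)) (ex_intro _ _ hw1).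
  have [w' [hw' e h]] : [set v | exists w, [/\ weyl w, v = amul (trans mu) (lin w) &
      forall w', weyl w' -> (len R B v <= len R B (amul (trans mu) (lin w')))%N]] (nmin R B mu).
    apply: xgetPex; exists (mu, w); exists w; split; rewrite ?amul_trans_lin // => w' hw'.
    by rewrite amul_trans_lin !len_alen //; exact: hmin.
  exists w'; rewrite e amul_trans_lin; split=> // w'' hw''.
  by have := h w'' hw''; rewrite e !amul_trans_lin !len_alen.
rewrite e; apply: (kf_inj (B := B)) => //= a pa.
have le w' : weyl w' -> alen (mu, w') = (alen (mu, w1) + 
   \sum_(a <- pos_roots B) (`|kf (mu, w') a| - `|kf (mu, w1) a|))%N.
  move=> hw'; rewrite /alen -big_split /= !big_seq; apply: eq_bigr => b /mem_pos_roots pb.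
  by rewrite subnKC //; exact: mins.
have := hmin w1 hw1; rewrite (le w hw) -[leqRHS]addn0 leq_add2l leqn0 => /eqP.
have ma : a \in pos_roots B by apply/mem_pos_roots.
rewrite (bigD1_seq a) ?uniq_pos_roots //= => /eqP; rewrite addn_eq0 => /andP[h _].
move: h; have := mins w a hw pa.
rewrite /kf /= negr_longest_w0 //; have := hm a pa.
by case: eqP => [->|]; case: negr => /=; lia.
Qed.

Lemma ext_nmin mu : dom mu -> ext (nmin R B mu).
Proof. by move=> hm; rewrite nminE //; apply: weylM; [exact: longest_weyl|exact: weyl_w0]. Qed.

Lemma kf_nmin mu a : dom mu -> pos a -> 0 <= kf (nmin R B mu) a.
Proof.
move=> hm pa; rewrite nminE // /kf /= negr_longest_w0 //.
by have := hm a pa; case: eqP => [->|] /=; lia.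
Qed.

Lemma kmin_nmin mu : dom mu -> kmin mu (longest (stab mu) *m w0).
Proof.
move=> hm; apply/trans_kmin => //; first by apply: weylM; [exact: longest_weyl|exact: weyl_w0].
by move=> a pa; rewrite -nminE // kf_nmin.
Qed.

Lemma longest_w0 mu : dom mu ->
  longest (stab (- (w0 *m mu))) = w0 *m longest (stab mu) *m w0.
Proof.
move=> hm; have hk := dominant_w0 hm; have h0 := weyl_w0; have hl := longest_weyl hm.
apply: (@weyl_negr_inj _ _ B); first exact: longest_weyl.
  by apply: weylM => //; exact: weylM.
move=> a pa; have ha := pos_rootW pa; rewrite (longestP hk).2 //.
have ha0 := root_weyl ha h0.
have pb : pos (- (a *m w0)) by apply: negr_pos => //; rewrite negr_w0 // pos_negr.
rewrite !mulmxA negr_w0 ?root_weyl //.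
have := (longestP hm).2 _ pb; rewrite mulNmx negr_opp ?root_weyl // => ->.
by rewrite pairingNl pairingNr pairing_mulmx.
Qed.

Lemma stab_w0 mu x : stab (- (w0 *m mu)) x -> stab mu (w0 *m x *m w0).
Proof.
rewrite stabN => -[hx e]; split; first exact: (weylM (weylM weyl_w0 hx) weyl_w0).
by rewrite -!mulmxA e mulmxA w0_invol mul1mx.
Qed.

Lemma stab_w0V mu x : stab mu x -> stab (- (w0 *m mu)) (w0 *m x *m w0).
Proof.
move=> [hxw e]; rewrite stabN.
split; first exact: (weylM (weylM weyl_w0 hxw) weyl_w0).
by rewrite -!mulmxA [w0 *m (w0 *m mu)]mulmxA w0_invol mul1mx e.
Qed.

Lemma ainv_nmin mu : dom mu ->
  ainv (nmin R B mu) = (- (w0 *m mu), w0 *m longest (stab mu)).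
Proof.
move=> hm; have [hs _] := longestP hm; have hl := longest_weyl hm.
rewrite nminE // /ainv /= (weyl_invM hl weyl_w0) invmx_w0 invmx_longest //.
by rewrite -mulmxA hs.2.
Qed.

(** The inverse of n^mu lies in C like n^mu itself; lengths therefore add in x n^mu and in n^mu x
    for x in W. *)
Lemma kf_ainv_nmin mu a : dom mu -> pos a -> 0 <= kf (ainv (nmin R B mu)) a.
Proof.
move=> hm pa; have hk := dominant_w0 hm; have ha := pos_rootW pa.
rewrite ainv_nmin // /kf /= mulmxA.
case: (eqVneq (pairing a (- (w0 *m mu))) 0) => [e|/eqP e]; last first.
  by have := hk a pa; case: negr => /=; lia.
have ha0 := root_weyl ha weyl_w0.
have pb : pos (- (a *m w0)) by apply: negr_pos => //; rewrite negr_w0 // pos_negr.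
have := (longestP hm).2 _ pb; rewrite mulNmx negr_opp ?(root_weyl _ (longest_weyl hm)) //.
rewrite pairingNl pairing_mulmx -pairingNr e eqxx => /negPf ->.
by rewrite subr0.
Qed.

(** Right multiplication by w_mu w_0 carries the positive roots orthogonal to mu onto those
    orthogonal to - w_0 mu. *)
Lemma kmin_shift mu y : dom mu ->
  kmin mu (longest (stab mu) *m w0 *m y) <-> kmin (- (w0 *m mu)) y.
Proof.
move=> hm; have hk := dominant_w0 hm; have h0 := weyl_w0; have hl := longest_weyl hm.
have hlw : weyl (longest (stab mu) *m w0) by exact: weylM.
split=> -[hy h].
  have hyw : weyl y by rewrite -[y](mulKmx (weyl_unit hlw)); apply: weylM => //; exact: weylV.
  split=> // b pb b0; have hb := pos_rootW pb.
  pose a := b *m w0 *m longest (stab mu).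
  have ha : a \in roots D by rewrite !root_weyl.
  have ea : a *m (longest (stab mu) *m w0) = b.
    by rewrite /a -[_ *m w0 *m _]mulmxA mulmxA -!mulmxA [longest _ *m (longest _ *m _)]mulmxA
       longest_invol // mul1mx w0_invol mulmx1.
  have a0 : pairing a mu = 0.
    rewrite /a (stab_pairing _ (longestP hm).1) pairing_mulmx.
    by apply/eqP; rewrite -oppr_eq0 -pairingNr b0.
  have pa : pos a.
    have [//|pa] := pos_or_neg B ha.
    have := negr_longest_w0 hm pa; rewrite mulNmx ea pairingNl a0 oppr0 eqxx.
    by rewrite negr_opp // pos_negr.
  by have := h a pa a0; rewrite mulmxA ea.
split; first exact: weylM.
move=> a pa a0; have ha := pos_rootW pa; have hs := (longestP hm).1.
pose b := a *m (longest (stab mu) *m w0).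
have hb : b \in roots D by exact: root_weyl.
have pb : pos b by apply/posN; rewrite // negr_longest_w0 // a0 eqxx.
rewrite [a *m _]mulmxA -/b; apply: h => //.
rewrite /b mulmxA pairingNr pairing_mulmx [w0 *m (w0 *m mu)]mulmxA w0_invol mul1mx.
by rewrite (stab_pairing _ hs) a0 oppr0.
Qed.

End WeylCombinatorics.

(** * The spherical Hecke algebra *)

Lemma mulf_cancel3 (F : fieldType) (a b c : F) :
  a != 0 -> b != 0 -> c != 0 -> 1 = a * b * (c^-1 / b) * c / a.
Proof. by move=> a0 b0 c0; field; rewrite a0 b0 c0. Qed.

Lemma mulf_cancel_phi (F : fieldType) (n v w z u : F) :
  v != 0 -> w != 0 -> u != 0 -> z != 0 ->
  v^-1 * (n * z) = n * (z * u) / (v * w) * (w * u^-1).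
Proof. by move=> v0 w0 u0 z0; field; rewrite v0 w0 u0. Qed.

Lemma mulf_cancel_struct (F : fieldType) (w0 wm la z nu v p : F) :
  w0 != 0 -> wm != 0 -> nu != 0 -> z != 0 ->
  w0^-1 / w0 * (w0 / wm) * (la / z) * p * (z / nu * v) =
  la / nu * (v / wm * p) * w0^-1.
Proof. by move=> h1 h2 h3 h4; field; rewrite h1 h2 h3 h4. Qed.

Lemma mulf_cancel_F (F : fieldType) (w0 lm la z nu m c S : F) :
  w0 != 0 -> lm != 0 -> la != 0 -> nu != 0 -> z != 0 -> m != 0 ->
  w0^-1 * (w0^-1 * (w0 / lm * (la / z * (m * z / nu * S)))) = la / nu * c * (w0^-1 * m) ->
  c = lm^-1 * S.
Proof.
move=> h1 h2 h3 h4 h5 h6 e.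
have n : la / nu * (w0^-1 * m) != 0.
  by rewrite !mulf_neq0 ?invr_eq0.
apply: (mulfI n); transitivity (la / nu * c * (w0^-1 * m)); first by ring.
by rewrite -e; field; rewrite h1 h2 h4 h5.
Qed.

Section HeckeAlgebra.
Variables (R : realType) (n : nat) (D : rootDatum n) (B : rootBase D).
Variables (d : affine n -> nat) (d_inv : conj_invariant R B d).
Variable H : heckeAlgebra R B d.
Implicit Types (a b c : 'rV[int]_n) (x y z w : 'M[int]_n) (kap la mu nu : 'cV[int]_n).
Implicit Types (u v s g : affine n).
Local Notation alpha := (simple B).
Local Notation pos := (pos_root B).
Local Notation ext := (ext_weyl D).
Local Notation kf := (kf B).
Local Notation alen := (alen B).
Local Notation negr := (negr B).
Local Notation sgen := (sgen R B).
Local Notation Omega := (Omega R B).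
Local Notation weyl := (weyl D).
Local Notation stab := (stab D).
Local Notation longest := (longest R B).
Local Notation w0 := (w0 R B).
Local Notation dom := (dominant B).
Local Notation dlen := (dlen R B d).
Local Notation nmin := (nmin R B).
Local Notation kmin := (kmin B).
Local Notation T := (hecke_T H).

Definition qv v : coef := qpar ^+ dlen v.
Local Notation qw w := (qv (lin w)).

Lemma qhalf_neq0 : qhalf != 0.
Proof. by rewrite /qhalf tofrac_eq0 polyX_eq0. Qed.

Lemma qpar_neq0 : qpar != 0.
Proof. by rewrite /qpar expf_neq0 // qhalf_neq0. Qed.

Lemma qv_neq0 v : qv v != 0.
Proof. by rewrite /qv expf_neq0 // qpar_neq0. Qed.

Lemma q_ofE v : q_of R B d v = qv v.
Proof. by rewrite /q_of /qv /dlen expr_sum. Qed.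

Lemma q_wtE la : q_wt R B d la ^+ 2 = qv (trans la).
Proof.
rewrite /q_wt /qv /dlen expr_sum -prodrXl; apply: eq_bigr => s _.
by rewrite /qpar -!exprM mulnC.
Qed.

Lemma q_genE s : sgen s -> q_gen d s = qv s.
Proof. by move=> hs; rewrite /qv (dlen_sgen d_inv). Qed.

Lemma qvM u v : ext u -> ext v -> alen (amul u v) = (alen u + alen v)%N ->
  qv (amul u v) = qv u * qv v.
Proof. by move=> hu hv hl; rewrite /qv (dlenM d_inv) // exprD. Qed.

Lemma qvV v : ext v -> qv (ainv v) = qv v.
Proof. by move=> hv; rewrite /qv (dlenV d_inv). Qed.

Lemma qv_Omega g : Omega g -> qv g = 1.
Proof. by move=> hg; rewrite /qv (dlen_Omega d hg). Qed.

Lemma qv1 : qv (aone n) = 1. Proof. by apply: qv_Omega; exact: Omega1. Qed.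

Lemma TM u v : ext u -> ext v -> alen (amul u v) = (alen u + alen v)%N ->
  T u * T v = T (amul u v).
Proof.
move=> hu hv hl; apply: hecke_mul => //; rewrite !len_alen //; exact: extM.
Qed.

(** The Hecke axioms do not name the unit: T_id is a left unit on the spanning set, hence on the
    whole algebra, and is then applied to 1. *)
Lemma T1 : T (aone n) = 1.
Proof.
have e1 := ext1 D.
have h (X : hecke_alg H) : T (aone n) * X = X.
  have [r [c [hr ->]]] := hecke_span X; rewrite mulr_sumr !big_seq.
  apply: eq_bigr => w /hr hw; rewrite -scalerAr TM ?amul1v //.
  by rewrite alen1.
by rewrite -[LHS]mulr1 h.
Qed.

Lemma T_Omega v g : ext v -> Omega g -> T v * T g = T (amul v g).
Proof.
move=> hv hg; have [eg lg] := (OmegaE R B g).1 hg.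
by rewrite TM // (alen_Omega hv hg) lg addn0.
Qed.

Lemma T_up v s : ext v -> sgen s -> alen (amul v s) = (alen v).+1 ->
  T v * T s = T (amul v s).
Proof.
by move=> hv hs hl; rewrite (TM hv (sgen_ext hs)) // hl (alen_sgen hs) addn1.
Qed.

Lemma T_down v s : ext v -> sgen s -> alen v = (alen (amul v s)).+1 ->
  T v * T s = qv s *: T (amul v s) + (qv s - 1) *: T v.
Proof.
move=> hv hs hl; have es := sgen_ext hs; have evs := extM hv es.
have e : amul (amul v s) s = v by rewrite -amulA (sgenK hs) amulv1.
have ev : T v = T (amul v s) * T s by rewrite T_up ?e.
rewrite {1}ev -mulrA hecke_quad // T1 mulrDr -scalerAr mulr1 -scalerAr -ev.
by rewrite (q_genE hs).
Qed.

Lemma T_upl v s : ext v -> sgen s -> alen (amul s v) = (alen v).+1 ->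
  T s * T v = T (amul s v).
Proof.
by move=> hv hs hl; rewrite (TM (sgen_ext hs) hv) // hl (alen_sgen hs) add1n.
Qed.

Lemma T_downl v s : ext v -> sgen s -> alen v = (alen (amul s v)).+1 ->
  T s * T v = qv s *: T (amul s v) + (qv s - 1) *: T v.
Proof.
move=> hv hs hl; have es := sgen_ext hs; have evs := extM es hv.
have e : amul s (amul s v) = v by rewrite amulA (sgenK hs) amul1v.
have ev : T v = T s * T (amul s v) by rewrite T_upl ?e.
rewrite {1}ev mulrA hecke_quad // T1 mulrDl -!scalerAl mul1r -ev.
by rewrite (q_genE hs).
Qed.

Lemma qv_up v s : ext v -> sgen s -> alen (amul v s) = (alen v).+1 ->
  qv (amul v s) = qv v * qv s.
Proof.
by move=> hv hs hl; apply: qvM => //; [exact: (sgen_ext hs)|rewrite hl (alen_sgen hs) addn1].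
Qed.

Definition Wseq : seq 'M[int]_n := enum_fset (fset_set weyl).

Lemma mem_Wseq w : (w \in Wseq) <-> weyl w.
Proof. have -> : (w \in Wseq) = (w \in fset_set weyl) by [].
by rewrite (in_fset_set (finite_weyl B)); split=> [/set_mem|/mem_set]. Qed.

Lemma uniq_Wseq : uniq Wseq. Proof. exact: fset_uniq. Qed.

Lemma fsum_weyl (V : nmodType) (A : set 'M[int]_n) (F : 'M[int]_n -> V) :
  A `<=` weyl -> \sum_(w \in A) F w = \sum_(w <- Wseq | `[< A w >]) F w.
Proof.
move=> hA; have fA : finite_set A := sub_finite_set hA (finite_weyl B).
rewrite fsbig_finite // -[RHS]big_filter; apply: perm_big.
apply: uniq_perm; rewrite ?filter_uniq ?uniq_Wseq ?fset_uniq // => w.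
rewrite (_ : (w \in enum_fset _) = (w \in fset_set A)) // in_fset_set // mem_filter.
apply/idP/andP.
  by move=> /set_mem hw; split; [exact/asboolP|apply/mem_Wseq; exact: hA].
by move=> [/asboolP hw _]; exact/mem_set.
Qed.

Lemma reindex_Wseq (V : nmodType) (P : 'M[int]_n -> Prop) (P' : 'M[int]_n -> Prop)
   (f g : 'M[int]_n -> 'M[int]_n) (F : 'M[int]_n -> V) :
  (forall w, weyl w -> P w -> [/\ weyl (f w), P' (f w) & g (f w) = w]) ->
  (forall w, weyl w -> P' w -> [/\ weyl (g w), P (g w) & f (g w) = w]) ->
  \sum_(w <- Wseq | `[< P' w >]) F w = \sum_(w <- Wseq | `[< P w >]) F (f w).
Proof.
move=> hf hg; rewrite -big_filter -[RHS]big_filter -[RHS](big_map f xpredT).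
apply: perm_big; apply: uniq_perm.
- by rewrite filter_uniq ?uniq_Wseq.
- rewrite map_inj_in_uniq ?filter_uniq ?uniq_Wseq // => w w'.
  rewrite !mem_filter => /andP[/asboolP pw /mem_Wseq hw] /andP[/asboolP pw' /mem_Wseq hw'] e.
  by have [_ _ <-] := hf w hw pw; have [_ _ <-] := hf w' hw' pw'; rewrite e.
move=> w; rewrite mem_filter; apply/andP/mapP.
  move=> [/asboolP pw /mem_Wseq hw]; have [h1 h2 h3] := hg w hw pw.
  by exists (g w) => //; rewrite mem_filter; apply/andP; split; [exact/asboolP|exact/mem_Wseq].
move=> [w']; rewrite mem_filter => /andP[/asboolP pw' /mem_Wseq hw'] ->.
by have [h1 h2 h3] := hf w' hw' pw'; split; [exact/asboolP|exact/mem_Wseq].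
Qed.

Definition one0 : hecke_alg H := \sum_(w <- Wseq) T (lin w).

Lemma weyl_simple_descent w : weyl w -> w != 1%:M ->
  exists i, [/\ weyl (refl D (alpha i) *m w), 
    alen (lin w) = (alen (lin (refl D (alpha i) *m w))).+1 &
    w = refl D (alpha i) *m (refl D (alpha i) *m w)].
Proof.
move=> hw w1; have [i hi] : exists i, negr (alpha i *m w).
  apply: contrapT => h; move/eqP: w1; apply; apply: (@weyl_pos_id _ _ B) => // a pa.
  apply/posN; first by apply: root_weyl => //; exact: pos_rootW pa.
  apply: (orth_negr (@dominant0 _ _ B) hw _ pa (pairing0r a)) => i _.
  by apply/negP => hi; apply: h; exists i.
exists i; have hr := weyl_refl (simple_root i).
split; first exact: weylM.
  by have := alen_refl_lin R i hw; rewrite hi.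
by rewrite mulmxA reflK ?mul1mx //; exact: simple_root.
Qed.

(** The involution f stands for left or right multiplication by a simple reflection. It exchanges
    the elements that it lengthens (sum S1) with those that it shortens (sum S2), and S2 + q S1 + (q
    - 1) S2 = q (S1 + S2). *)
Lemma sum_simple_T (f : 'M[int]_n -> 'M[int]_n) (F : 'M[int]_n -> hecke_alg H) (q : coef) :
  (forall w, weyl w -> weyl (f w)) -> involutive f ->
  (forall w, weyl w ->
     alen (lin (f w)) = (alen (lin w)).+1 /\ F w = T (lin (f w)) \/
     alen (lin w) = (alen (lin (f w))).+1 /\
       F w = q *: T (lin (f w)) + (q - 1) *: T (lin w)) ->
  \sum_(w <- Wseq) F w = q *: one0.
Proof.
move=> wf fK hF; pose up w := alen (lin (f w)) = (alen (lin w)).+1.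
pose S1 := \sum_(w <- Wseq | `[< up w >]) T (lin w).
pose S2 := \sum_(w <- Wseq | `[< ~ up w >]) T (lin w).
have dn w : weyl w -> ~ up w -> alen (lin w) = (alen (lin (f w))).+1.
  by move=> /hF [] [].
have e1 : \sum_(w <- Wseq | `[< up w >]) T (lin (f w)) = S2.
  rewrite /S2 (@reindex_Wseq _ up (fun w => ~ up w) f f) //= => w hw hu.
    by rewrite fK; split=> //; [exact: wf|move: hu; rewrite /up fK; lia].
  by rewrite fK; split=> //; [exact: wf|have := dn w hw hu; rewrite /up fK].
have e2 : \sum_(w <- Wseq | `[< ~ up w >]) T (lin (f w)) = S1.
  rewrite /S1 (@reindex_Wseq _ (fun w => ~ up w) up f f) //= => w hw hu.
    by rewrite fK; split=> //; [exact: wf|have := dn w hw hu; rewrite /up fK].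
  by rewrite fK; split=> //; [exact: wf|move: hu; rewrite /up fK; lia].
have bigU (G : 'M[int]_n -> hecke_alg H) : \sum_(w <- Wseq) G w =
    \sum_(w <- Wseq | `[< up w >]) G w + \sum_(w <- Wseq | `[< ~ up w >]) G w.
  rewrite (bigID (fun w => `[< up w >])) /=; congr (_ + _).
  by apply: eq_bigl => w; rewrite asbool_neg.
rewrite bigU.
have -> : \sum_(w <- Wseq | `[< up w >]) F w = S2.
  rewrite -e1 big_seq_cond [RHS]big_seq_cond.
  apply: eq_bigr => w /andP[/mem_Wseq hw /asboolP hu].
  by case: (hF w hw) => -[] //; move: hu; rewrite /up; lia.
have -> : \sum_(w <- Wseq | `[< ~ up w >]) F w = q *: S1 + (q - 1) *: S2.
  rewrite -e2 !scaler_sumr -big_split /= big_seq_cond [RHS]big_seq_cond.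
  by apply: eq_bigr => w /andP[/mem_Wseq hw /asboolP hu]; case: (hF w hw) => -[].
by rewrite /one0 bigU -/S1 -/S2 scalerDr scalerBl scale1r addrCA [S2 + _]addrC subrK.
Qed.

Lemma one0_simple i : one0 * T (lin (refl D (alpha i))) = qw (refl D (alpha i)) *: one0.
Proof.
have hs := simple_sgen R i; have hr := weyl_refl (simple_root i).
rewrite {1}/one0 mulr_suml; apply: (sum_simple_T (f := mulmx^~ _)) => [w hw|w|w hw].
- exact: weylM hw hr.
- by rewrite -mulmxA reflK ?mulmx1 //; exact: simple_root.
rewrite linM; case: (alen_step (ext_lin hw) hs) => e; [left|right]; split=> //.
  exact: T_up.
exact: T_down.
Qed.

Lemma simple_one0 i : T (lin (refl D (alpha i))) * one0 = qw (refl D (alpha i)) *: one0.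
Proof.
have hs := simple_sgen R i; have hr := weyl_refl (simple_root i).
rewrite {1}/one0 mulr_sumr; apply: (sum_simple_T (f := mulmx _)) => [w hw|w|w hw].
- exact: weylM hr hw.
- by rewrite mulmxA reflK ?mul1mx //; exact: simple_root.
rewrite linM; case: (alen_stepl (ext_lin hw) hs) => e; [left|right]; split=> //.
  exact: T_upl.
exact: T_downl.
Qed.

Lemma one0_T x : weyl x -> one0 * T (lin x) = qw x *: one0.
Proof.
move: {2}(alen (lin x)) (erefl (alen (lin x))) => N; elim: N x => [|N IH] x eN hx.
  by rewrite (@weyl_alen0 _ _ B _ hx eN) lin1 T1 qv1 mulr1 scale1r.
have [|i [hx' hl ex]] := weyl_simple_descent hx.
  by apply/eqP => x1; move: eN; rewrite x1 lin1 alen1.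
have hs := simple_sgen R i; have es := sgen_ext hs.
have hup : alen (amul (lin (refl D (alpha i))) (lin (refl D (alpha i) *m x))) =
    (alen (lin (refl D (alpha i) *m x))).+1 by rewrite -linM -ex.
rewrite ex linM -T_upl // mulrA one0_simple -scalerAl IH //; last by lia.
rewrite scalerA qvM // hup (alen_sgen hs) add1n //.
Qed.

Lemma one0_sqr : one0 * one0 = (\sum_(w <- Wseq) qw w) *: one0.
Proof.
rewrite {2}/one0 mulr_sumr scaler_suml !big_seq.
by apply: eq_bigr => w /mem_Wseq hw; exact: one0_T.
Qed.

Lemma T_one0 x : weyl x -> T (lin x) * one0 = qw x *: one0.
Proof.
move: {2}(alen (lin x)) (erefl (alen (lin x))) => N; elim: N x => [|N IH] x eN hx.
  by rewrite (@weyl_alen0 _ _ B _ hx eN) lin1 T1 qv1 mul1r scale1r.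
have [|i [hx' hl ex]] := weyl_simple_descent hx.
  by apply/eqP => x1; move: eN; rewrite x1 lin1 alen1.
have hs := simple_sgen R i; have es := sgen_ext hs.
have hup : alen (amul (lin (refl D (alpha i))) (lin (refl D (alpha i) *m x))) =
    (alen (lin (refl D (alpha i) *m x))).+1 by rewrite -linM -ex.
rewrite ex linM -T_upl // -mulrA IH //; last by lia.
by rewrite -scalerAr simple_one0 scalerA mulrC qvM // hup (alen_sgen hs) add1n.
Qed.

(** The alcove of v lies in the dominant chamber, see [galc_chamber]. *)
Definition Cv v : Prop := forall a, pos a -> 0 <= kf v a.

Lemma one0_TE v : ext v -> Cv v -> one0 * T v = \sum_(w <- Wseq) T (amul (lin w) v).
Proof.
move=> hv hc; rewrite /one0 mulr_suml !big_seq; apply: eq_bigr => w /mem_Wseq hw.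
by rewrite TM //; apply: alen_lin_amul.
Qed.

(** At a point of C, <a, z> is a sum of nonnegative terms c_i <alpha_i, z>; if it vanishes, so does
    some alpha_i with c_i > 0, and a is the only positive root vanishing at z. *)
Lemma chamber_face_simple a (z : 'cV[R]_n) : pos a -> chamber B z ->
  on_only B a 0 z -> exists i, a = alpha i.
Proof.
move=> pa hz [h0 hu]; have [c e [i ci]] := pos_coefE pa.
exists i; suff : hyperplane (alpha i) 0 z by move=> /(hu _ _ (simple_pos i)) [].
rewrite /hyperplane /=; have : pairingR a z = 0 by exact: h0.
rewrite e pairingR_suml (bigD1 i) //= pairingRZl.
have t0 j : 0 <= pairingR ((c j)%:Z *: alpha j) z.
  by rewrite pairingRZl mulr_ge0 ?ler0z // hz //; exact: simple_pos.
move/eqP; rewrite paddr_eq0; [|by have := t0 i; rewrite pairingRZl|by apply: sumr_ge0].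
move=> /andP[/eqP h _]; move: h => /eqP; rewrite mulf_eq0 => /orP[|/eqP //].
by rewrite intr_eq0; lia.
Qed.

Lemma box_chamber v (z : 'cV[R]_n) : Cv v -> box B v z -> chamber B z.
Proof.
move=> hc hz a pa; have /andP[h _] := hz a pa.
by apply: le_trans h; rewrite ler0z; exact: hc.
Qed.

Lemma Cv_wall v s a m : Cv v -> wall R B v s a m -> 0 < m -> Cv (amul v s).
Proof.
move=> hc [pa _ hk h _] m0 b pb; have [->|/eqP ba] := eqVneq b a.
  by case: hk => -[_ ->]; lia.
by rewrite h //; exact: hc.
Qed.

Lemma Cv_wall_ge0 v s a m : Cv v -> wall R B v s a m -> 0 <= m.
Proof. by move=> hc [pa _ hk _ _]; have := hc a pa; case: hk => -[-> _]; lia. Qed.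

Lemma alen_wall_gt0 v s a m : Cv v -> wall R B v s a m -> 0 < m ->
  if kf v a == m then alen v = (alen (amul v s)).+1
  else alen (amul v s) = (alen v).+1.
Proof.
move=> hc hw m0; have := alen_wall hw; have [pa _ hk _ _] := hw.
by case: eqP; case: hk => -[-> ->]; lia.
Qed.

(* At a wall of the chamber, v s = r v for a simple reflection r, which
   is absorbed by [one0]. *)
Lemma one0_wall0 v s a : ext v -> Cv v -> sgen s -> wall R B v s a 0 ->
  [/\ kf v a = 0, exists i, a = alpha i & one0 * T v * T s = qv s *: (one0 * T v)].
Proof.
move=> hv hc hs hw; have [pa e hk _ [z [hz _ on]]] := hw.
have k0 : kf v a = 0 /\ kf (amul v s) a = -1.
  by have := hc a pa; case: hk => -[-> ->]; split; lia.
have [i ei] := chamber_face_simple pa (box_chamber hc hz) on.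
have hup : alen (amul v s) = (alen v).+1.
  by have := alen_wall hw; rewrite k0.1 k0.2; lia.
have er : arefl D a 0 = lin (refl D (alpha i)) by rewrite /arefl scale0r ei.
have hr := simple_sgen R i; have wr := weyl_refl (simple_root i).
split; [exact: k0.1|by exists i|].
have hupl : alen (amul (lin (refl D (alpha i))) v) = (alen v).+1 by rewrite -er -e.
rewrite -mulrA T_up // e er -T_upl // mulrA one0_simple -scalerAl.
congr (_ *: _); apply: (mulfI (qv_neq0 v)).
rewrite -[RHS](qv_up hv hs hup) e er qvM //; first by rewrite mulrC.
by rewrite hupl (alen_sgen hr) add1n.
Qed.

Definition Ev v : hecke_alg H := (qv v)^-1 *: (one0 * T v).

Lemma Ev_up v s a m : ext v -> Cv v -> sgen s -> wall R B v s a m -> kf v a = m - 1 ->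
  Ev v * T s = qv s *: Ev (amul v s).
Proof.
move=> hv hc hs hw hk; have m0 : 0 < m.
  by have := hc a (let: And5 p _ _ _ _ := hw in p); lia.
have hup : alen (amul v s) = (alen v).+1.
  by have := alen_wall_gt0 hc hw m0; case: eqP => //; lia.
rewrite /Ev -scalerAl -mulrA T_up // scalerA qv_up // invfM mulrCA divff ?mulr1 //.
exact: qv_neq0.
Qed.

Lemma Ev_down v s a m : ext v -> Cv v -> sgen s -> wall R B v s a m -> 0 < m ->
  kf v a = m -> Ev v * T s = Ev (amul v s) + (qv s - 1) *: Ev v.
Proof.
move=> hv hc hs hw m0 hk; have es := sgen_ext hs.
have hdn : alen v = (alen (amul v s)).+1.
  by have := alen_wall_gt0 hc hw m0; case: eqP => //; lia.
have e : amul (amul v s) s = v by rewrite -amulA (sgenK hs) amulv1.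
have eq : qv v = qv (amul v s) * qv s.
  by rewrite -qv_up ?e //; exact: extM.
rewrite /Ev -scalerAl -mulrA T_down // mulrDr -!scalerAr scalerDr !scalerA.
congr (_ + _ *: _); last by rewrite mulrC.
by rewrite eq invfM -mulrA mulVf ?mulr1 ?qv_neq0.
Qed.

Lemma Ev_wall v s a : ext v -> Cv v -> sgen s -> wall R B v s a 0 ->
  Ev v * T s = qv s *: Ev v.
Proof.
move=> hv hc hs hw; have [_ _ e] := one0_wall0 hv hc hs hw.
by rewrite /Ev -scalerAl e !scalerA mulrC.
Qed.

Lemma Ev_Omega v g : ext v -> Omega g -> Ev v * T g = Ev (amul v g).
Proof.
move=> hv hg; have [eg lg] := (OmegaE R B g).1 hg.
rewrite /Ev -scalerAl -mulrA (T_Omega hv hg) qvM ?(qv_Omega hg) ?mulr1 //.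
by rewrite (alen_Omega hv hg) lg addn0.
Qed.

Lemma Cv_Omega v g : ext v -> Cv v -> Omega g -> Cv (amul v g).
Proof. by move=> hv hc hg a pa; rewrite (kf_Omega hv hg (pos_rootW pa)); exact: hc. Qed.

(** * The trace form *)

Definition tcomb (l : seq (coef * affine n)) : hecke_alg H :=
  \sum_(p <- l) p.1 *: T p.2.

(** A presentation may list the same group element several times, hence the sum; addition of
    elements is then mere concatenation. *)
Definition tcoef (l : seq (coef * affine n)) v : coef :=
  \sum_(p <- l | p.2 == v) p.1.

Definition ext_comb (l : seq (coef * affine n)) : Prop := forall p, p \in l -> ext p.2.

Lemma tcomb0_coef l v : ext_comb l -> tcomb l = 0 -> ext v -> tcoef l v = 0.
Proof.
move=> hl l0 hv; pose r := undup (v :: [seq p.2 | p <- l]).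
have hr u : u \in r -> ext u.
  by rewrite mem_undup inE => /orP[/eqP ->|/mapP[p /hl hp ->]].
apply: (@hecke_free _ _ _ _ _ H r (tcoef l)) => //; first exact: undup_uniq.
  rewrite -[RHS]l0 /tcomb /tcoef; under eq_bigr do rewrite scaler_suml.
  rewrite (exchange_big_dep xpredT) //= !big_seq; apply: eq_bigr => p pl.
  rewrite -big_filter; have -> : [seq u <- r | p.2 == u] = [:: p.2].
    rewrite (eq_filter (a2 := pred1 p.2)) => [|u]; last by rewrite /= eq_sym.
    rewrite filter_pred1_uniq ?undup_uniq // mem_undup inE orbC.
    by rewrite (map_f snd pl).
  by rewrite big_seq1.
by rewrite mem_undup mem_head.
Qed.

Lemma tcombP X : exists l, ext_comb l /\ X = tcomb l.
Proof.
have [r [c [hr ->]]] := hecke_span X; exists [seq (c u, u) | u <- r]; split.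
  by move=> p /mapP[u /hr hu ->].
by rewrite /tcomb big_map.
Qed.

(** The coefficient of T_id, read off a chosen presentation; [tauE] shows that the choice is
    immaterial. *)
Definition tau (X : hecke_alg H) : coef := tcoef (sval (cid (tcombP X))) (aone n).

Lemma tauE X l : ext_comb l -> X = tcomb l -> tau X = tcoef l (aone n).
Proof.
move=> hl el; rewrite /tau; case: cid => l' /= [hl' el'].
pose m := l' ++ [seq (- p.1, p.2) | p <- l].
have hm : ext_comb m.
  by move=> p; rewrite mem_cat => /orP[/hl'//|/mapP[p' /hl hp' ->]].
have m0 : tcomb m = 0.
  rewrite /tcomb big_cat big_map /=; under [X in _ + X]eq_bigr do rewrite scaleNr.
  by rewrite sumrN -/(tcomb l') -/(tcomb l) -el -el' subrr.
have := tcomb0_coef hm m0 (ext1 D); rewrite /tcoef big_cat big_map /= sumrN => /eqP.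
by rewrite subr_eq0 => /eqP.
Qed.

Lemma tauD X Y : tau (X + Y) = tau X + tau Y.
Proof.
have [l [hl el]] := tcombP X; have [m [hm em]] := tcombP Y.
rewrite (tauE hl el) (tauE hm em) (@tauE _ (l ++ m)).
- by rewrite /tcoef big_cat.
- by move=> p; rewrite mem_cat => /orP[/hl|/hm].
- by rewrite el em /tcomb big_cat.
Qed.

Lemma tauZ k X : tau (k *: X) = k * tau X.
Proof.
have [l [hl el]] := tcombP X.
rewrite (tauE hl el) (@tauE _ [seq (k * p.1, p.2) | p <- l]).
- by rewrite /tcoef big_map mulr_sumr.
- by move=> p /mapP[p' /hl hp ->].
- by rewrite el /tcomb big_map scaler_sumr; apply: eq_bigr => p _; rewrite scalerA.
Qed.

Lemma tau_sum I (r : seq I) (P : pred I) (F : I -> hecke_alg H) :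
  tau (\sum_(i <- r | P i) F i) = \sum_(i <- r | P i) tau (F i).
Proof.
elim/big_rec2: _ => [|i u v _ <-]; last by rewrite tauD.
by rewrite -[X in tau X](scale0r 0) tauZ mul0r.
Qed.

Lemma tau_T v : ext v -> tau (T v) = (v == aone n)%:R.
Proof.
move=> hv; rewrite (@tauE _ [:: (1, v)]).
- by rewrite /tcoef big_cons big_nil; case: eqP => _; rewrite ?addr0.
- by move=> p; rewrite inE => /eqP ->.
- by rewrite /tcomb big_cons big_nil addr0 scale1r.
Qed.

(** Induction on the length of v, moving its first letter s to u, v = s v'. If us is longer than u,
    then uv = 1 is impossible. If it is shorter, the extra term (q_s - 1) T_u T_v' has trace 0: uv'
    = 1 would make us as long as v, hence longer than u. *)
Lemma tau_TT u v : ext u -> ext v -> tau (T u * T v) = (amul u v == aone n)%:R * qv v.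
Proof.
move: {2}(alen v) (erefl (alen v)) => N; elim: N u v => [|N IH] u v eN hu hv.
  have hg : Omega v by apply/OmegaE.
  by rewrite T_Omega // tau_T ?qv_Omega ?mulr1 //; exact: extM.
have [|s hs hl] := @left_descent R _ _ B _ hv; first by rewrite eN.
have es := sgen_ext hs; pose v' := amul s v; have hv' : ext v' by exact: extM.
have ev : v = amul s v' by rewrite /v' amulA (sgenK hs) amul1v.
have lv' : alen v' = N by move: hl; rewrite -/v' eN => -[].
have hup : alen (amul s v') = (alen v').+1 by rewrite -ev lv'.
have TE : T v = T s * T v' by rewrite T_upl // -ev.
have qE : qv v = qv s * qv v'.
  by rewrite {1}ev qvM // hup (alen_sgen hs) add1n.
have hus := extM hu es.
rewrite TE mulrA qE; have [up|down] := alen_step hu hs.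
  rewrite T_up // IH // -amulA -ev.
  case: eqP => [e|_]; last by rewrite !mul0r.
  have eu : u = ainv v by apply: (amul_injr hv); rewrite e (amulVv hv).
  have : alen (amul u s) = alen v'.
    have -> : amul u s = ainv v'.
      by rewrite eu ev (ainvM es hv') (sgenV hs) -amulA (sgenK hs) amulv1.
    exact: alenV.
  by rewrite up eu alenV // eN lv'; lia.
rewrite T_down // mulrDl -!scalerAl tauD !tauZ !IH // -[amul (amul u s) v']amulA -ev.
have -> : (amul u v' == aone n) = false.
  apply/eqP => e; have eu : u = ainv v' by apply: (amul_injr hv'); rewrite e (amulVv hv').
  have : alen (amul u s) = alen v.
    have -> : amul u s = ainv v by rewrite eu ev (ainvM es hv') (sgenV hs).
    exact: alenV.
  by have := down; rewrite eu alenV // eN lv'; lia.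
by rewrite mul0r mulr0 addr0 mulrCA.
Qed.

Lemma qwM_len x y z : weyl x -> weyl y -> weyl z -> x *m y = z ->
  alen (lin z) = (alen (lin x) + alen (lin y))%N -> qw z = qw x * qw y.
Proof. by move=> hx hy hz <- hl; rewrite linM qvM // -linM. Qed.

Lemma qwV x : weyl x -> qw (invmx x) = qw x.
Proof. by move=> hx; rewrite -ainv_lin qvV. Qed.

Lemma qw_w0 x : weyl x -> qw (w0 *m x) * qw x = qw w0.
Proof.
move=> hx; have h0 := weyl_w0 R B; have hwx := weylM h0 hx.
rewrite -(qwV hx) -(@qwM_len (w0 *m x) (invmx x) w0) //; first exact: weylV.
  by rewrite mulmxK // (weyl_unit hx).
by rewrite (alen_linV B hx) alen_w0.
Qed.

Lemma qw_w0r x : weyl x -> qw (x *m w0) * qw x = qw w0.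
Proof.
move=> hx; have h0 := weyl_w0 R B; have hwx := weylM hx h0.
rewrite mulrC -(qwV hx) -(@qwM_len (invmx x) (x *m w0) w0) //; first exact: weylV.
  by rewrite mulKmx // (weyl_unit hx).
by rewrite (alen_linV B hx) addnC alen_w0r.
Qed.

Lemma qw_longest kap x : dom kap -> stab kap x ->
  qw (longest (stab kap) *m x) * qw x = qw (longest (stab kap)).
Proof.
move=> hk hx; have h0 := longest_weyl R hk; have hw := stab_weyl hx; have hwx := weylM h0 hw.
rewrite -(qwV hw) -(@qwM_len (longest (stab kap) *m x) (invmx x) (longest (stab kap))) //.
  exact: weylV.
  by rewrite mulmxK // (weyl_unit hw).
by rewrite (alen_linV B hw) alen_longest.
Qed.

Lemma qw_conj_w0 x : weyl x -> qw (w0 *m x *m w0) = qw x.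
Proof.
move=> hx; have hwx := weylM (weyl_w0 R B) hx.
apply: (mulIf (qv_neq0 (lin (w0 *m x)))).
by rewrite qw_w0r // mulrC qw_w0.
Qed.

Lemma qv_kmin nu w : dom nu -> kmin nu w -> qv (nu, w) * qw w = qv (trans nu).
Proof.
move=> hn hw; have hww := kmin_weyl hw.
have e : amul (nu, w) (lin (invmx w)) = trans nu.
  by rewrite /amul /= mulmx0 addr0 mulmxV // (weyl_unit hww).
have hv : weyl (invmx w) by exact: weylV.
rewrite -(qwV hww) -qvM // ?e // (alen_linV B hww).
by rewrite (alen_trans_kmin hn hw).
Qed.

Lemma qv_nmin mu : dom mu -> qv (nmin mu) * qw w0 = qv (trans mu) * qw (longest (stab mu)).
Proof.
move=> hm; rewrite nminE // -(qv_kmin hm (kmin_nmin R hm)).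
by rewrite -mulrA qw_w0r //; exact: longest_weyl.
Qed.

(** * Poincare polynomials of stabilizers *)

Definition Wsum kap : coef := \sum_(w <- Wseq | `[< stab kap w >]) qw w.
Definition WsumV kap : coef := \sum_(w <- Wseq | `[< stab kap w >]) (qw w)^-1.

(** Multiplication by the longest element permutes the stabilizer and turns q_x into q_(w_kap) /
    q_x. *)
Lemma Wsum_longest kap : dom kap -> Wsum kap = qw (longest (stab kap)) * WsumV kap.
Proof.
move=> hk; have [hs _] := longestP R hk; have ii := longest_invol R hk.
rewrite /Wsum (@reindex_Wseq _ (stab kap) (stab kap)
   (mulmx (longest (stab kap))) (mulmx (longest (stab kap)))); first last.
- by move=> w hw hw'; split; [exact: stab_weyl (stabM hs hw')|exact: stabM|rewrite mulmxA ii mul1mx].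
- by move=> w hw hw'; split; [exact: stab_weyl (stabM hs hw')|exact: stabM|rewrite mulmxA ii mul1mx].
rewrite mulr_sumr big_seq_cond [RHS]big_seq_cond; apply: eq_bigr => w /andP[_ /asboolP hw].
by rewrite -(qw_longest hk hw) mulfK // qv_neq0.
Qed.

Lemma Wsum_w0 mu : Wsum (- (w0 *m mu)) = Wsum mu.
Proof.
have i0 := w0_invol R B.
have cc x : w0 *m (w0 *m x *m w0) *m w0 = x.
  by rewrite !mulmxA i0 mul1mx -mulmxA i0 mulmx1.
have cw x : weyl x -> weyl (w0 *m x *m w0).
  by move=> hx; exact: (weylM (weylM (weyl_w0 R B) hx) (weyl_w0 R B)).
rewrite /Wsum (@reindex_Wseq _ (stab mu) (stab (- (w0 *m mu)))
   (fun x => w0 *m x *m w0) (fun x => w0 *m x *m w0)); first last.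
- by move=> w hw hw'; split=> //; [exact: cw|exact: stab_w0].
- by move=> w hw hw'; split=> //; [exact: cw|exact: stab_w0V].
rewrite big_seq_cond [RHS]big_seq_cond; apply: eq_bigr => w /andP[/mem_Wseq hw _].
exact: qw_conj_w0.
Qed.

(** The sum comes from a polynomial in q^(1/2) whose value at 1 is the number of its terms. *)
Lemma sum_qpar_neq0 (I : Type) (r : seq I) (P : pred I) (f : I -> nat) :
  has P r -> \sum_(i <- r | P i) qpar ^+ f i != 0.
Proof.
move=> hP; have -> : \sum_(i <- r | P i) qpar ^+ f i =
    tofrac (\sum_(i <- r | P i) 'X^(2 * f i)).
  by rewrite rmorph_sum /=; apply: eq_bigr => i _; rewrite /qpar /qhalf -exprM rmorphXn.
rewrite tofrac_eq0; apply/eqP => /(congr1 (fun p : {poly int} => p.[1])).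
rewrite horner_sum horner0; under eq_bigr do rewrite hornerXn expr1n.
rewrite big_const_seq iter_addr addr0 => /eqP; rewrite pnatr_eq0 => /eqP.
by move: hP; rewrite has_count; lia.
Qed.

Lemma has_stab kap : has (fun w => `[< stab kap w >]) Wseq.
Proof.
apply/hasP; exists 1%:M; first by apply/mem_Wseq; exact: weyl1.
by apply/asboolP; exact: stab1.
Qed.

Lemma Wsum_neq0 kap : Wsum kap != 0.
Proof. by apply: sum_qpar_neq0; exact: has_stab. Qed.

Lemma WsumV_neq0 kap : dom kap -> WsumV kap != 0.
Proof. move=> hk; apply/negP => /eqP e; move/negP: (Wsum_neq0 kap); apply.
by rewrite (Wsum_longest hk) e mulr0 eqxx. Qed.

Lemma poincareE kap : poincare R B d (stab kap) = Wsum kap.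
Proof.
rewrite /poincare fsum_weyl; last by move=> w [].
by apply: eq_bigr => w _; rewrite q_ofE.
Qed.

Lemma poincareVE kap : poincareV R B d (stab kap) = WsumV kap.
Proof.
rewrite /poincareV fsum_weyl; last by move=> w [].
by apply: eq_bigr => w _; rewrite q_ofE.
Qed.

Lemma Wsum0 : Wsum 0 = \sum_(w <- Wseq) qw w.
Proof.
rewrite /Wsum stab0 big_seq_cond [RHS]big_seq_cond.
by apply: eq_bigl => w; rewrite andbT; apply/andP/idP => [[]//|h]; split=> //; apply/asboolP/mem_Wseq.
Qed.

Lemma sum_Wseq_decomp (V : nmodType) kap (F : 'M[int]_n -> V) : dom kap ->
  \sum_(w <- Wseq) F w =
  \sum_(x <- Wseq | `[< stab kap x >]) \sum_(y <- Wseq | `[< kmin kap y >]) F (x *m y).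
Proof.
move=> hk; rewrite -[RHS]big_filter; under [RHS]eq_bigr do rewrite -big_filter.
transitivity (\sum_(w <- [seq x *m y | x <- [seq x <- Wseq | `[< stab kap x >]],
    y <- [seq y <- Wseq | `[< kmin kap y >]]]) F w); last by rewrite big_allpairs_dep.
apply: perm_big; apply: uniq_perm; first exact: uniq_Wseq.
  apply: allpairs_uniq; rewrite ?filter_uniq ?uniq_Wseq //.
  move=> [x y] [x' y'] /allpairsP[[x1 y1] /= [hx hy [-> ->]]].
  move=> /allpairsP[[x2 y2] /= [hx' hy' [-> ->]]] e.
  move: hx hy hx' hy'; rewrite !mem_filter.
  move=> /andP[/asboolP hx _] /andP[/asboolP hy _] /andP[/asboolP hx' _] /andP[/asboolP hy' _].
  by have [-> ->] := kmin_uniq hk hx hy hx' hy' e.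
move=> w; apply/idP/allpairsP.
  move=> /mem_Wseq hw; have [x [y [hx hy e]]] := kmin_decomp R hk hw.
  exists (x, y); rewrite !mem_filter /=; split=> //; apply/andP; split; try exact/asboolP; apply/mem_Wseq.
    exact: stab_weyl hx.
  exact: kmin_weyl hy.
move=> [[x y] /= [hx hy ->]]; move: hx hy; rewrite !mem_filter.
move=> /andP[_ /mem_Wseq hx] /andP[_ /mem_Wseq hy]; apply/mem_Wseq; exact: weylM.
Qed.

Lemma one0_decomp kap : dom kap ->
  one0 = (\sum_(x <- Wseq | `[< stab kap x >]) T (lin x)) *
         \sum_(y <- Wseq | `[< kmin kap y >]) T (lin y).
Proof.
move=> hk; rewrite /one0 (sum_Wseq_decomp _ hk) mulr_suml.
apply: eq_bigr => x /asboolP hx; rewrite mulr_sumr.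
apply: eq_bigr => y /asboolP hy; have hxw := stab_weyl hx; have hyw := kmin_weyl hy.
by rewrite TM -?linM //; exact: (kminM_alen hk).
Qed.

(* W tau_nu W is the disjoint union of the W tau_nu w, w minimal in W_nu w. *)
Definition Pm nu : hecke_alg H :=
  \sum_(w <- Wseq | `[< kmin nu w >]) one0 * T (nu, w).

Lemma Cv_kmin nu w : dom nu -> kmin nu w -> Cv (nu, w).
Proof. by move=> hn hw a pa; apply: (trans_kmin hn (kmin_weyl hw)).2. Qed.

Lemma double_coset_kmin nu v : dom nu -> double_coset D nu v ->
  exists x w, [/\ weyl x, kmin nu w & v = amul (lin x) (nu, w)].
Proof.
move=> hn [w1 [w2 [h1 h2 ->]]]; have [z [w [hz hw e]]] := kmin_decomp R hn h2.
exists (w1 *m z), w; split=> //; first exact: weylM (stab_weyl hz).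
rewrite amul_lin_trans /amul /lin /= !mulmx0 addr0 add0r -mulmxA hz.2 e mulmxA.
by [].
Qed.

Lemma double_coset_amul nu x w : weyl x -> weyl w -> double_coset D nu (amul (lin x) (nu, w)).
Proof.
by move=> hx hw; exists x, w; split=> //; rewrite -amul_trans_lin amulA.
Qed.

Lemma PmE nu : dom nu -> \sum_(v \in double_coset D nu) T v = Pm nu.
Proof.
move=> hn; pose K := [seq w <- Wseq | `[< kmin nu w >]].
pose l := [seq amul (lin x) (nu, w) | w <- K, x <- Wseq].
have memK w : (w \in K) <-> kmin nu w.
  rewrite mem_filter; split=> [/andP[/asboolP //]|hw].
  by apply/andP; split; [exact/asboolP|apply/mem_Wseq; exact: kmin_weyl hw].
have ml v : (v \in l) <-> double_coset D nu v.
  split=> [/allpairsP[[w x] /= [/memK hw /mem_Wseq hx ->]]|].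
    by apply: double_coset_amul => //; exact: kmin_weyl hw.
  move=> /(double_coset_kmin hn) [x [w [hx hw ->]]].
  by apply/allpairsP; exists (w, x); split=> //=; [exact/memK|exact/mem_Wseq].
have ul : uniq l.
  apply: allpairs_uniq; rewrite ?filter_uniq ?uniq_Wseq //.
  move=> [w x] [w' x'] /allpairsP[[w1 x1] /= [/memK hw /mem_Wseq hx [-> ->]]].
  move=> /allpairsP[[w2 x2] /= [/memK hw' /mem_Wseq hx' [-> ->]]].
  rewrite /amul /lin /= !add0r => -[e1 e2].
  have ux' := weyl_unit hx'.
  have hz : stab nu (invmx x2 *m x1).
    by split; [apply: weylM => //; exact: weylV|rewrite -mulmxA e1 mulKmx].
  have ez : (invmx x2 *m x1) *m w1 = 1%:M *m w2 by rewrite -mulmxA e2 mulKmx // mul1mx.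
  have [z1 ->] := kmin_uniq hn hz hw (stab1 D nu) hw' ez.
  by congr (_, _); rewrite -[x1](mulKVmx ux') z1 mulmx1.
have fin : finite_set (double_coset D nu).
  apply: (@sub_finite_set _ _ [set` l]); last exact: finite_seq.
  by move=> v /ml.
rewrite fsbig_finite //=.
rewrite (perm_big l); last first.
  apply: uniq_perm; rewrite ?fset_uniq // => v.
  rewrite (_ : (v \in enum_fset _) = (v \in fset_set (double_coset D nu))) // in_fset_set //.
  by apply/idP/idP => [/set_mem/ml|/ml/mem_set].
rewrite /l big_allpairs_dep /Pm -[RHS]big_filter -/K !big_seq; apply: eq_bigr => w /memK hw.
by rewrite one0_TE //; [exact: kmin_weyl hw|exact: Cv_kmin].
Qed.

Lemma T_nmin_kmin mu y : dom mu -> weyl y ->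
  T (nmin mu) * T (lin y) = T (mu, longest (stab mu) *m w0 *m y).
Proof.
move=> hm hy; rewrite TM //; [|exact: ext_nmin|].
  by rewrite nminE // /amul /= mulmx0 addr0.
apply: alen_amul_lin => //; first exact: ext_nmin.
by move=> a pa; exact: kf_ainv_nmin.
Qed.

(** By [kmin_shift] the elements (mu, w) with w minimal are the n^mu y with y minimal for - w_0 mu,
    and lengths add in n^mu y. *)
Lemma Pm_nmin mu : dom mu ->
  Pm mu = one0 * T (nmin mu) * \sum_(y <- Wseq | `[< kmin (- (w0 *m mu)) y >]) T (lin y).
Proof.
move=> hm; have hl := longest_weyl R hm; have h0 := weyl_w0 R B.
have hlw : weyl (longest (stab mu) *m w0) by exact: weylM.
have uw := weyl_unit hlw.
rewrite /Pm (@reindex_Wseq _ (kmin (- (w0 *m mu))) (kmin mu)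
  (mulmx (longest (stab mu) *m w0)) (mulmx (invmx (longest (stab mu) *m w0)))); first last.
- move=> w hw hw'; have hw2 : weyl (invmx (longest (stab mu) *m w0) *m w).
    by apply: weylM => //; exact: weylV.
  by split=> //; [apply/(kmin_shift R) => //; rewrite mulKVmx|rewrite mulKVmx].
- by move=> w hw hw'; split; [exact: weylM|exact/(kmin_shift R)|rewrite mulKmx].
rewrite mulr_sumr; rewrite big_seq_cond [RHS]big_seq_cond.
apply: eq_bigr => y /andP[/mem_Wseq hy _].
by rewrite -mulrA T_nmin_kmin.
Qed.

(** Conjugation by n^mu carries x to an element x' of W_mu, which [one0] absorbs. As n^mu x and x'
    n^mu are the same element, both factorizations being length additive, x and x' have the same
    weight. *)
Lemma one0_nmin_stab mu x : dom mu -> stab (- (w0 *m mu)) x ->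
  one0 * T (nmin mu) * T (lin x) = qw x *: (one0 * T (nmin mu)).
Proof.
move=> hm hx; have hk := dominant_w0 R hm; have hxw := stab_weyl hx.
have [hl _] := longestP R hm; have en := ext_nmin R hm; have en' := hxw.
pose x' := longest (stab mu) *m (w0 *m x *m w0) *m longest (stab mu).
have hx' : stab mu x' by apply: stabM => //; apply: stabM => //; exact: stab_w0.
have hxw' := stab_weyl hx'.
have e : amul (nmin mu) (lin x) = amul (lin x') (nmin mu).
  rewrite nminE // /amul /= mulmx0 addr0 add0r hx'.2; congr (_, _).
  rewrite /x' -!mulmxA [longest _ *m (longest _ *m _)]mulmxA longest_invol // mul1mx.
  by rewrite w0_invol mulmx1.
have l1 : alen (amul (nmin mu) (lin x)) = (alen (nmin mu) + alen (lin x))%N.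
  by apply: alen_amul_lin => // a pa; exact: kf_ainv_nmin.
have l2 : alen (amul (lin x') (nmin mu)) = (alen (lin x') + alen (nmin mu))%N.
  by apply: alen_lin_amul => // a pa; exact: kf_nmin.
have qq : qw x' = qw x.
  apply: (mulIf (qv_neq0 (nmin mu))).
  by rewrite -qvM // -e qvM // mulrC.
by rewrite -mulrA TM // e -TM // mulrA one0_T // -scalerAl qq.
Qed.

(** Split the right factor along the cosets of the stabilizer of - w_0 mu: the stabilizer passes
    through n^mu and gives the scalar W_mu(q), the representatives give [Pm_nmin]. *)
Lemma one0_nmin_one0 mu : dom mu -> one0 * T (nmin mu) * one0 = Wsum mu *: Pm mu.
Proof.
move=> hm; have hk := dominant_w0 R hm.
rewrite {2}(one0_decomp hk) mulrA.
have -> : one0 * T (nmin mu) * (\sum_(x <- Wseq | `[< stab (- (w0 *m mu)) x >]) T (lin x)) =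
    Wsum mu *: (one0 * T (nmin mu)).
  rewrite mulr_sumr -Wsum_w0 /Wsum scaler_suml; apply: eq_bigr => x /asboolP hx.
  exact: one0_nmin_stab.
by rewrite -scalerAl Pm_nmin.
Qed.

(** For k = - w_0 mu the map y -> w_k y w_0 permutes the minimal representatives, so the u w_0 are
    the maximal representatives w_k y. The factor T_(w_k) is absorbed and contributes only q_(w_mu),
    where the full stabilizer gives W_mu(q). *)
Lemma one0_nmin_long mu : dom mu ->
  one0 * T (nmin mu) * \sum_(u <- Wseq | `[< kmin (- (w0 *m mu)) u >]) T (lin (u *m w0)) =
  qw (longest (stab mu)) *: Pm mu.
Proof.
move=> hm; have hk := dominant_w0 R hm; pose kap := - (w0 *m mu).
pose wk := longest (stab kap); have [hs hwk] := longestP R hk.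
have hw : weyl wk := longest_weyl R hk; have h0 := weyl_w0 R B.
have i1 : wk *m wk = 1%:M by exact: longest_invol.
have i0 := w0_invol R B.
have ff y : wk *m (wk *m y *m w0) *m w0 = y by rewrite !mulmxA i1 mul1mx -mulmxA i0 mulmx1.
have kk y : weyl y -> kmin kap y -> kmin kap (wk *m y *m w0).
  move=> hu [_ h]; split; first exact: weylM (weylM hw hu) h0.
  move=> a pa a0; have ha := pos_rootW pa; have haw := root_weyl ha hw.
  have na : negr (a *m wk) by rewrite hwk // a0 eqxx.
  have := h _ (negr_pos haw na); rewrite pairingNl (stab_pairing a hs) a0 oppr0 => /(_ erefl).
  rewrite mulNmx negr_opp; last exact: root_weyl.
  by rewrite !mulmxA negr_w0 // !root_weyl.
have -> : \sum_(u <- Wseq | `[< kmin kap u >]) T (lin (u *m w0)) =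
    \sum_(y <- Wseq | `[< kmin kap y >]) T (lin wk) * T (lin y).
  rewrite (@reindex_Wseq _ (kmin kap) (kmin kap) (fun y => wk *m y *m w0)
    (fun y => wk *m y *m w0)); first last.
  - by move=> w hww hw'; split; [exact: weylM (weylM hw hww) h0|exact: kk|exact: ff].
  - by move=> w hww hw'; split; [exact: weylM (weylM hw hww) h0|exact: kk|exact: ff].
  apply: eq_bigr => y /asboolP hy; have hyw := kmin_weyl hy.
  rewrite -mulmxA i0 mulmx1 TM -?linM //; exact: (kminM_alen hk).
rewrite -mulr_sumr mulrA (one0_nmin_stab hm hs) -scalerAl -Pm_nmin //.
by congr (_ *: _); rewrite /wk /kap longest_w0 // qw_conj_w0 //; exact: longest_weyl.
Qed.

(** Independence of w: T_(tau_nu) = T_(nu,w) T_(w^-1), and [one0] absorbs the last factor. The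
    common value is then computed at w = w_nu w_0, where (nu, w) is n^nu. *)
Lemma Ev_one0 nu w : dom nu -> kmin nu w ->
  Ev (nu, w) * one0 = (qw w0 / qv (trans nu) * WsumV nu) *: Pm nu.
Proof.
move=> hn hw; have hww := kmin_weyl hw.
have key y : kmin nu y -> Ev (nu, y) * one0 = (qv (trans nu))^-1 *: (one0 * T (trans nu) * one0).
  move=> hy; have hyw := kmin_weyl hy; have hyv := weylV hyw.
  have e : amul (nu, y) (lin (invmx y)) = trans nu.
    by rewrite /amul /= mulmx0 addr0 mulmxV // (weyl_unit hyw).
  have TE : T (trans nu) = T (nu, y) * T (lin (invmx y)).
    by rewrite TM // ?e // (alen_linV B hyw) (alen_trans_kmin hn hy).
  rewrite TE -!mulrA T_one0 // (qwV hyw) -!scalerAr scalerA -(qv_kmin hn hy) /Ev.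
  by rewrite -scalerAl -mulrA invfM -[_ * _ * qw y]mulrA mulVf ?qv_neq0 // mulr1.
rewrite key // -(key _ (kmin_nmin R hn)) -nminE // /Ev -scalerAl one0_nmin_one0 //.
rewrite scalerA; congr (_ *: _); rewrite Wsum_longest // mulrA; congr (_ * _).
apply: (mulfI (qv_neq0 (nmin nu))); rewrite mulrA divff ?qv_neq0 // mul1r.
by rewrite mulrA qv_nmin // mulrAC divff ?qv_neq0 // mul1r.
Qed.

Lemma Pm_Ev la : dom la ->
  Pm la = \sum_(w <- Wseq | `[< kmin la w >])
            (qv (trans la) / qw w0 * qw (w0 *m w)) *: Ev (la, w).
Proof.
move=> hl; apply: eq_bigr => w /asboolP hw; have hww := kmin_weyl hw.
rewrite /Ev scalerA -[LHS]scale1r; congr (_ *: _).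
rewrite -(qv_kmin hl hw) -(qw_w0 hww) invfM.
by apply: mulf_cancel3; exact: qv_neq0.
Qed.

Lemma Pm_one0 la : dom la -> Pm la * one0 = Wsum 0 *: Pm la.
Proof.
move=> hl; apply: (@scalerI _ _ (Wsum la)); first exact: Wsum_neq0.
rewrite scalerAl -one0_nmin_one0 // -[_ * one0 * one0]mulrA one0_sqr -Wsum0 -scalerAr one0_nmin_one0 //.
by rewrite !scalerA mulrC.
Qed.

Lemma PmM la mu : dom la -> dom mu ->
  Pm la * Pm mu = (Wsum 0 / Wsum mu) *: (Pm la * T (nmin mu) * one0).
Proof.
move=> hl hm; apply: (@scalerI _ _ (Wsum mu)); first exact: Wsum_neq0.
rewrite scalerAr -one0_nmin_one0 // !mulrA Pm_one0 // -!scalerAl scalerA.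
by rewrite mulrCA divff ?mulr1 // Wsum_neq0.
Qed.

Lemma PmM_long la mu : dom la -> dom mu ->
  Pm la * Pm mu = (Wsum 0 / qw (longest (stab mu))) *: (Pm la * T (nmin mu) *
    \sum_(u <- Wseq | `[< kmin (- (w0 *m mu)) u >]) T (lin (u *m w0))).
Proof.
move=> hl hm; apply: (@scalerI _ _ (qw (longest (stab mu)))); first exact: qv_neq0.
rewrite scalerAr -one0_nmin_long // !mulrA Pm_one0 // -!scalerAl scalerA.
by rewrite mulrCA divff ?mulr1 // qv_neq0.
Qed.

(** A left descent s_i of y fixes nu: <alpha_i, nu> is >= 0 because nu is dominant, and <= 0 because
    nu' is and alpha_i y is negative. So s_i can be removed from y. *)
Lemma dominant_orbit nu nu' y : dom nu -> dom nu' -> weyl y -> y *m nu' = nu -> nu' = nu.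
Proof.
move=> hn hn'; move: {2}(alen (lin y)) (erefl (alen (lin y))) => N.
elim: N y => [|N IH] y eN hy e.
  by rewrite -e (@weyl_alen0 _ _ B _ hy eN) mul1mx.
have [|i [hy' hl ey]] := weyl_simple_descent hy.
  by apply/eqP => y1; move: eN; rewrite y1 lin1 alen1.
have ni : negr (alpha i *m y).
  by have := alen_refl_lin R i hy; case: ifP => //; lia.
apply: (IH (refl D (alpha i) *m y)) => //; first by lia.
have hay := root_weyl (simple_root i) hy.
have h1 := hn _ (simple_pos i); have h2 := hn' _ (negr_pos hay ni).
rewrite -mulmxA e refl_mul.
have -> : pairing (alpha i) nu = 0.
  by move: h2; rewrite pairingNl pairing_mulmx e; lia.
by rewrite scale0r subr0.
Qed.

Definition phi nu (X : hecke_alg H) : coef := tau (X * T (ainv (nmin nu))).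

Lemma phiZ nu k X : phi nu (k *: X) = k * phi nu X.
Proof. by rewrite /phi -scalerAl tauZ. Qed.

Lemma phi_sum nu I (r : seq I) (P : pred I) (F : I -> hecke_alg H) :
  phi nu (\sum_(i <- r | P i) F i) = \sum_(i <- r | P i) phi nu (F i).
Proof. by rewrite /phi mulr_suml tau_sum. Qed.

(** By [tau_TT] only the y in W with y (nu', w) z = n^nu contribute. Linear parts leave the single
    candidate y0, and translation parts require y0 nu' = nu, that is nu' = nu with y0 in W_nu. *)
Lemma phi_one0TT nu nu' w z : dom nu -> dom nu' -> kmin nu' w -> weyl z ->
  phi nu (one0 * T (nu', w) * T (lin z)) = qv (nmin nu) * qw z *
    ((nu == nu') && `[< exists2 y, stab nu y & y *m w *m z = longest (stab nu) *m w0 >])%:R.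
Proof.
move=> hn hn' hw hz; have hww := kmin_weyl hw; have en := ext_nmin R hn.
have hl := longest_weyl R hn; have h0 := weyl_w0 R B.
have ez := ext_lin hz; have env := extV en.
pose y0 := longest (stab nu) *m w0 *m invmx z *m invmx w.
have hy0 : weyl y0.
  by apply: weylM; [apply: weylM; [exact: weylM|exact: weylV]|exact: weylV].
have ey0 y : y *m w *m z = longest (stab nu) *m w0 <-> y = y0.
  have uz := weyl_unit hz; have uw := weyl_unit hww.
  by split=> [e|->]; rewrite /y0 -?e ?mulmxK ?mulmxKV.
have uzn : alen (amul (lin z) (ainv (nmin nu))) = (alen (lin z) + alen (ainv (nmin nu)))%N.
  by apply: alen_lin_amul => // a pa; exact: kf_ainv_nmin.
rewrite /phi -mulrA TM // one0_TE //; last exact: Cv_kmin.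
rewrite mulr_suml tau_sum.
have step y : y \in Wseq -> tau (T (amul (lin y) (nu', w)) * T (amul (lin z) (ainv (nmin nu)))) =
    qv (nmin nu) * qw z * ((y == y0) && (y0 *m nu' == nu))%:R.
  move=> /mem_Wseq hy; have ey : ext (amul (lin y) (nu', w)) by exact: extM.
  rewrite tau_TT //; last exact: extM.
  rewrite qvM // qvV // mulrC; congr (_ * _); first by rewrite mulrC.
  congr (_%:R); rewrite (_ : (_ == _) = (amul (amul (lin y) (nu', w)) (lin z) == nmin nu)); last first.
    rewrite amulA; apply/eqP/eqP => [e|->]; last by rewrite (amulvV en).
    by apply: (amul_injr env); rewrite e (amulvV en).
  rewrite nminE // /amul /= mulmx0 addr0 add0r; apply: congr1; apply/eqP/andP.
    by move=> -[e1 /ey0 e2]; rewrite -e2 e1 !eqxx.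
  by move=> [/eqP -> /eqP ->]; congr (_, _); apply/ey0.
rewrite big_seq (eq_bigr _ step) -big_seq -mulr_sumr; congr (_ * _).
have my0 : y0 \in Wseq by apply/mem_Wseq.
rewrite (bigD1_seq y0) ?uniq_Wseq //= eqxx big1 ?addr0 => [|y /negPf -> //].
congr (_%:R); apply: congr1; apply/eqP/andP.
  move=> e; have en' := dominant_orbit hn hn' hy0 e.
  split; first by rewrite en'.
  by apply/asboolP; exists y0; [split=> //; rewrite -{1}en'|apply/ey0].
by move=> [/eqP <- /asboolP [y [_ hy] /ey0 <-]].
Qed.

Lemma phi_Pm nu nu' : dom nu -> dom nu' ->
  phi nu (Pm nu') = qv (nmin nu) * (nu == nu')%:R.
Proof.
move=> hn hn'; have hk := kmin_nmin R hn.
rewrite /Pm phi_sum.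
have step w : `[< kmin nu' w >] -> phi nu (one0 * T (nu', w)) =
    qv (nmin nu) * ((nu == nu') && (w == longest (stab nu) *m w0))%:R.
  move=> /asboolP hw; rewrite -[one0 * _]mulr1 -T1 -lin1 phi_one0TT //; last exact: weyl1.
  rewrite lin1 qv1 mulr1; congr (_ * _%:R).
  case: (eqVneq nu nu') hw => //= <- hw; apply: congr1; apply/asboolP/eqP.
    move=> [y hy]; rewrite mulmx1 -[RHS in _ = RHS -> _]mul1mx => e.
    by have [] := kmin_uniq hn hy hw (stab1 D nu) hk e.
  by move=> ->; exists 1%:M; [exact: stab1|rewrite mul1mx mulmx1].
rewrite (eq_bigr _ step) -mulr_sumr; congr (_ * _).
case: (eqVneq nu nu') => [<-|_] /=; last by rewrite big1.
have hin : longest (stab nu) *m w0 \in Wseq by apply/mem_Wseq; exact: kmin_weyl hk.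
rewrite -big_filter (bigD1_seq (longest (stab nu) *m w0)) ?filter_uniq ?uniq_Wseq //=.
  by rewrite eqxx big1 ?addr0 // => w /negPf ->.
by rewrite mem_filter hin andbT; apply/asboolP.
Qed.

(* Pairing with n^nu extracts the coefficient of the alcove n^nu. *)
Lemma phi_Ev nu nu' w (U : 'M[int]_n -> Prop) : dom nu -> dom nu' -> kmin nu' w ->
  phi nu (Ev (nu', w) * \sum_(u <- Wseq | `[< U u >]) T (lin (u *m w0))) =
  (nu == nu')%:R * (qv (nmin nu) * qw w0 / qv (trans nu) * (qw w *
    \sum_(u <- Wseq | `[< U u /\ exists2 x, stab nu x & invmx u = x *m w >]) (qw u)^-1)).
Proof.
move=> hn hn' hw; have hww := kmin_weyl hw; have h0 := weyl_w0 R B.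
have [hs _] := longestP R hn; have hl := longest_weyl R hn.
have li := longest_invol R hn; have i0 := w0_invol R B.
rewrite mulr_sumr phi_sum.
pose Q (u : 'M[int]_n) := exists2 x, stab nu x & invmx u = x *m w.
have step (u : 'M[int]_n) : u \in Wseq -> phi nu (Ev (nu', w) * T (lin (u *m w0))) =
    (nu == nu')%:R * (qv (nmin nu) * qw w0 / qv (trans nu) * (qw w *
      (if `[< Q u >] then (qw u)^-1 else 0))).
  move=> /mem_Wseq hu; have huw := weylM hu h0; have uu := weyl_unit hu.
  rewrite /Ev -scalerAl phiZ phi_one0TT //.
  case: (eqVneq nu nu') hw => [<-|_] hw /=; last by rewrite mulr0 mulr0 mul0r.
  have -> : `[< exists2 y, stab nu y & y *m w *m (u *m w0) = longest (stab nu) *m w0 >] = `[< Q u >].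
    apply/asboolP/asboolP => -[y hy e].
      exists (longest (stab nu) *m y); first exact: stabM.
      have e' : y *m w *m u = longest (stab nu).
        by rewrite -[LHS]mulmx1 -i0 mulmxA -[_ *m u *m w0]mulmxA e -mulmxA i0 mulmx1.
      have : longest (stab nu) *m (y *m w *m u) = 1%:M by rewrite e'.
      move=> e2; rewrite -[RHS](mulmxK uu) -!mulmxA [w *m (u *m _)]mulmxA.
      by rewrite !mulmxA in e2 *; rewrite e2 mul1mx.
    exists (longest (stab nu) *m y); first exact: stabM.
    by rewrite -[_ *m y *m w]mulmxA -e -mulmxA [invmx u *m _]mulmxA mulVmx // mul1mx.
  case: `[< Q u >]; last by rewrite !mulr0 ?mul0r.
  have := qw_w0r hu; have := qv_kmin hn hw.
  have n1 := qv_neq0 (nu, w); have n2 := qv_neq0 (lin w); have n3 := qv_neq0 (lin u).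
  have n4 := qv_neq0 (lin (u *m w0)).
  move=> <- <-; rewrite mulr1 mul1r.
  by apply: (mulf_cancel_phi _ n1 n2 n3 n4).
rewrite big_seq_cond (eq_bigr _ (fun (u : 'M[int]_n) h => step u (proj1 (andP h)))) -big_seq_cond.
rewrite -!mulr_sumr; congr (_ * (_ * (_ * _))).
rewrite -big_mkcondr; apply: eq_bigl => u.
by apply/andP/asboolP => [[/asboolP h1 /asboolP h2]|[h1 h2]]; split=> //; exact/asboolP.
Qed.

Lemma F_coefE mu nu w : dom mu -> dom nu -> weyl w ->
  F_coef R B d w mu nu =
  qw w * \sum_(u <- Wseq | `[< kmin (- (w0 *m mu)) u /\
              exists2 x, stab nu x & invmx u = x *m w >]) (qw u)^-1.
Proof.
move=> hm hn hw; have hk := dominant_w0 R hm.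
rewrite /F_coef q_ofE; congr (_ * _).
(* The weight w_0 mu is in general not dominant, but it has the same stabilizer as the dominant
   weight - w_0 mu. *)
have mr (v : 'M[int]_n) : min_reps R B (w0 *m mu) v <-> weyl v /\ kmin (- (w0 *m mu)) (invmx v).
  by rewrite -(min_repsE R _ hk) /min_reps stabN.
rewrite fsum_weyl; last by move=> v [/mr []].
rewrite (@reindex_Wseq _ (fun u : 'M[int]_n => kmin (- (w0 *m mu)) u /\ exists2 x, stab nu x & invmx u = x *m w)
   _ invmx invmx); first last.
- move=> v hv [/mr [_ h1] [x hx e]]; split; rewrite ?invmxK //; first exact: weylV.
  by split=> //; exists x.
- move=> u hu [h1 [x hx e]]; split; rewrite ?invmxK //; first exact: weylV.
  by split; [apply/mr; rewrite invmxK; split=> //; exact: weylV|exists x].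
rewrite big_seq_cond [RHS]big_seq_cond; apply: eq_bigr => u /andP[/mem_Wseq hu _].
by rewrite q_ofE qwV.
Qed.

Lemma macdonaldE la : dom la -> macdonald H la = (Wsum 0)^-1 *: Pm la.
Proof. by move=> hl; rewrite /macdonald PmE // -poincareE stab0. Qed.

Lemma q_wt_ratio la nu : (q_wt R B d la / q_wt R B d nu) ^+ 2 = qv (trans la) / qv (trans nu).
Proof. by rewrite exprMn exprVn !q_wtE. Qed.

(** The expansion is cut down to the finite support of c, and [phi_Pm] isolates its term at nu; the
    value c nu is therefore determined by the product. *)
Lemma phi_struct (c : 'cV[int]_n -> coef) la mu nu : dom nu -> is_struct_const H la mu c ->
  phi nu (macdonald H la * macdonald H mu) =
  qv (trans la) / qv (trans nu) * c nu * ((Wsum 0)^-1 * qv (nmin nu)).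
Proof.
move=> hn [fin ->].
pose r := enum_fset (fset_set [set nu | dom nu /\ c nu != 0]).
have mr kap : (kap \in r) = `[< dom kap /\ c kap != 0 >].
  by rewrite (_ : (kap \in r) = (kap \in fset_set [set nu | dom nu /\ c nu != 0])) // in_fset_set.
have ur : uniq r by exact: fset_uniq.
rewrite (fsbigE r) //; first last.
- move=> kap hk; rewrite mr => /asboolP h.
  have -> : c kap = 0 by apply: contrapT => /eqP h'; apply: h.
  by rewrite mulr0 scale0r.
- by move=> kap /=; rewrite mr => /asboolP [].
rewrite phi_sum.
have step kap : kap \in r -> phi nu (((q_wt R B d la / q_wt R B d kap) ^+ 2 * c kap) *: macdonald H kap) =
    if kap == nu then qv (trans la) / qv (trans nu) * c nu * ((Wsum 0)^-1 * qv (nmin nu)) else 0.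
  rewrite mr => /asboolP[hk _]; rewrite macdonaldE // !phiZ phi_Pm // q_wt_ratio eq_sym.
  by case: eqP => [->|_]; rewrite ?mulr1 // !mulr0.
have e0 : \sum_(kap <- r | kap \in dom) phi nu (((q_wt R B d la / q_wt R B d kap) ^+ 2 * c kap) *: macdonald H kap) =
  \sum_(kap <- r) phi nu (((q_wt R B d la / q_wt R B d kap) ^+ 2 * c kap) *: macdonald H kap).
  rewrite big_seq_cond [RHS]big_seq_cond; apply: eq_bigl => kap.
  rewrite andbT mr; apply/andP/idP => [[]//|h]; split=> //.
  by apply/mem_set; have /asboolP[] := h.
rewrite e0 big_seq (eq_bigr _ step) -big_seq -big_mkcond /=.
have [hin|hnin] := boolP (nu \in r).
  rewrite -big_filter filter_pred1_uniq ?big_seq1 //.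
have -> : c nu = 0.
  by apply: contrapT => /eqP h; move: hnin; rewrite mr => /asboolP; apply.
rewrite mulr0 mul0r big1_seq //.
Qed.

(** * Structure constants from an expansion into the E_v *)

Section Expansion.
Variables (la mu : 'cV[int]_n) (hl : dom la) (hm : dom mu).
Variable l : seq (coef * affine n).
Hypothesis hkl : forall p, p \in l -> dom p.2.1 /\ kmin p.2.1 p.2.2.
Hypothesis hexp : Pm la * T (nmin mu) =
  (qv (trans la) / qw w0) *: \sum_(p <- l) p.1 *: Ev p.2.

Definition csum nu : coef := WsumV nu / Wsum mu * \sum_(p <- l | p.2.1 == nu) p.1.

(** Multiply the expansion by [one0] on the right: by [Ev_one0] each E_v becomes a multiple of [Pm]
    depending only on its weight, and terms are grouped by weight. *)
Lemma csum_is_struct_const : is_struct_const H la mu csum.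
Proof.
pose r := undup [seq p.2.1 | p <- l].
have c0 nu : nu \notin r -> csum nu = 0.
  move=> hr; rewrite /csum big_seq_cond big1 ?mulr0 // => p /andP[pl /eqP e].
  by move: hr; rewrite mem_undup -e (map_f (fun p : coef * affine n => p.2.1)).
split.
  apply: (@sub_finite_set _ _ [set` r]); last exact: finite_seq.
  move=> nu [_ h] /=; apply: contrapT => /negP /c0 e; move: h; by rewrite e eqxx.
rewrite (fsbigE r) ?undup_uniq //; first last.
- by move=> nu _ /c0 ->; rewrite mulr0 scale0r.
- by move=> nu /=; rewrite mem_undup => /mapP[p /hkl [h _] ->].
have hd nu : nu \in r -> dom nu by rewrite mem_undup => /mapP[p /hkl [h _] ->].
transitivity (\sum_(nu <- r) ((q_wt R B d la / q_wt R B d nu) ^+ 2 * csum nu) *: macdonald H nu);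
  last first.
  rewrite big_seq_cond [RHS]big_seq_cond; apply: eq_bigl => nu.
  by case: (boolP (nu \in r)) => //= /hd h; symmetry; apply/mem_set.
rewrite !macdonaldE // -scalerAl -scalerAr PmM // hexp -scalerAl !scalerA [X in _ *: X = _]mulr_suml.
transitivity (\sum_(nu <- r) \sum_(p <- l | p.2.1 == nu)
   ((qv (trans la) / qv (trans nu)) * (WsumV nu / Wsum mu * p.1)) *: macdonald H nu); last first.
  rewrite !big_seq; apply: eq_bigr => nu _.
  by rewrite /csum q_wt_ratio !mulr_sumr scaler_suml.
rewrite (exchange_big_dep xpredT) //= scaler_sumr !big_seq; apply: eq_bigr => p pl.
have [hd1 hk1] := hkl pl.
rewrite -big_filter; have -> : [seq nu <- r | p.2.1 == nu] = [:: p.2.1].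
  rewrite (eq_filter (a2 := pred1 p.2.1)) => [|nu]; last by rewrite /= eq_sym.
  by rewrite filter_pred1_uniq ?undup_uniq // mem_undup (map_f (fun p : coef * affine n => p.2.1)).
rewrite big_seq1 macdonaldE // -scalerAl.
have -> : p.2 = (p.2.1, p.2.2) by case: p.2.
rewrite Ev_one0 //= !scalerA; congr (_ *: _).
apply: mulf_cancel_struct; rewrite ?qv_neq0 ?Wsum_neq0 //.
Qed.

Lemma struct_const_uniq (c : 'cV[int]_n -> coef) nu : dom nu -> is_struct_const H la mu c ->
  c nu = csum nu.
Proof.
move=> hn hc; have := phi_struct hn hc; rewrite (phi_struct hn csum_is_struct_const).
have n0 : (Wsum 0)^-1 * qv (nmin nu) != 0.
  by apply: mulf_neq0; [rewrite invr_eq0; exact: Wsum_neq0|exact: qv_neq0].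
have n1 : qv (trans la) / qv (trans nu) != 0.
  by apply: mulf_neq0; [exact: qv_neq0|rewrite invr_eq0; exact: qv_neq0].
by move=> /(mulIf n0) /(mulfI n1).
Qed.

(** Existence of [csum] ensures that [xget] does not fall back on the zero family. *)
Lemma struct_constP : is_struct_const H la mu (xget (fun=> 0) [set c | is_struct_const H la mu c]).
Proof.
apply: (@xgetPex _ _ [set c | is_struct_const H la mu c]).
by exists csum; exact: csum_is_struct_const.
Qed.

Lemma struct_const_csum nu : dom nu -> struct_const H la mu nu = csum nu.
Proof. by move=> hn; apply: struct_const_uniq => //; exact: struct_constP. Qed.

(** Apply [phi nu] to the product in which M_mu is written with maximal representatives. [phi_Ev]
    evaluates each term of the expansion, and its inner sum is [F_coef] at the direction of the
    alcove. *)
Lemma struct_const_F nu : dom nu -> struct_const H la mu nu =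
  (qw (longest (stab mu)))^-1 * \sum_(p <- l | p.2.1 == nu) p.1 * F_coef R B d p.2.2 mu nu.
Proof.
move=> hn; have hk := dominant_w0 R hm.
have := phi_struct hn struct_constP; rewrite -/(struct_const H la mu nu).
rewrite !macdonaldE // -scalerAl -scalerAr PmM_long // hexp -!scalerAl !phiZ [X in phi nu X]mulr_suml phi_sum.
set S := \sum_(p <- l) _.
have -> : S = qv (nmin nu) * qw w0 / qv (trans nu) *
    \sum_(p <- l | p.2.1 == nu) p.1 * F_coef R B d p.2.2 mu nu.
  rewrite /S mulr_sumr [RHS]big_mkcond !big_seq; apply: eq_bigr => p pl.
  have [hd1 hk1] := hkl pl.
  rewrite -scalerAl phiZ; have {1}-> : p.2 = (p.2.1, p.2.2) by case: p.2.
  rewrite phi_Ev // F_coefE //; last exact: kmin_weyl hk1.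
  rewrite eq_sym; case: eqP => _; last by rewrite mul0r mulr0.
  by rewrite mul1r mulrCA.
apply: mulf_cancel_F; rewrite ?qv_neq0 ?Wsum_neq0 //.
Qed.

End Expansion.

End HeckeAlgebra.

Lemma between_convex (F : realFieldType) (l u x y t : F) :
  l < x < u -> l < y < u -> 0 <= t -> t <= 1 -> l < x + t * (y - x) < u.
Proof.
move=> /andP[h1 h2] /andP[h3 h4] t0 t1.
have [xy|yx] := leP x y.
  have h : 0 <= (1 - t) * (y - x) by rewrite mulr_ge0; lra.
  have h' : 0 <= t * (y - x) by rewrite mulr_ge0; lra.
  by apply/andP; split; lra.
have h : 0 <= (1 - t) * (x - y) by rewrite mulr_ge0; lra.
have h' : 0 <= t * (x - y) by rewrite mulr_ge0; lra.
by apply/andP; split; lra.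
Qed.

Lemma between_convex_strict (F : realFieldType) (l u x y t : F) :
  l <= x <= u -> l < y < u -> 0 < t -> t <= 1 -> l < x + t * (y - x) < u.
Proof.
move=> /andP[h1 h2] /andP[h3 h4] t0 t1.
have p1 : 0 <= (1 - t) * (x - l) by rewrite mulr_ge0; lra.
have p2 : 0 < t * (y - l) by rewrite mulr_gt0; lra.
have p3 : 0 <= (1 - t) * (u - x) by rewrite mulr_ge0; lra.
have p4 : 0 < t * (u - y) by rewrite mulr_gt0; lra.
by apply/andP; split; lra.
Qed.

(** * Generalized alcoves *)

Section AlcoveTopology.
Variables (R : realType) (n : nat) (D : rootDatum n) (B : rootBase D).
Implicit Types (a b c : 'rV[int]_n) (x y z : 'cV[R]_n) (w : 'M[int]_n).
Implicit Types (v : affine n).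
Local Notation pos := (pos_root B).
Local Notation off := (@off_hyperplanes R n D B).

Lemma pairingR_continuous a : continuous (@pairingR R n a).
Proof.
move=> x P /nbhs_ballP [e /= e0 hP]; apply/nbhs_ballP.
(* [K - 1] is a Lipschitz constant for the sup norm; the extra 1 makes K positive and the final
   bound strict. *)
pose K : R := 1 + \sum_j `|(a 0 j)%:~R|.
have K0 : 0 < K by rewrite ltr_pwDl // sumr_ge0.
exists (e / K) => /=; first by rewrite divr_gt0.
move=> y [_ hxy]; apply: hP; rewrite /ball /= -pairingRBr /pairingR mxE.
apply: (@le_lt_trans _ _ ((K - 1) * (e / K))); last first.
  by rewrite mulrCA gtr_pMr // ltr_pdivrMr // mul1r ltrBlDr ltrDl.
rewrite (le_trans (ler_norm_sum _ _ _)) // /K addrAC subrr add0r mulr_suml ler_sum // => j _.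
rewrite !mxE normrM ler_wpM2l //; apply: ltW.
by have := hxy j 0; rewrite /ball /=.
Qed.

Definition segment x y (t : R) : 'cV[R]_n := x + t *: (y - x).

Lemma segment_continuous x y : continuous (segment x y).
Proof.
move=> t P /nbhs_ballP [e /= e0 hP]; apply/nbhs_ballP.
pose K : R := 1 + \sum_j `|(y - x) j 0|.
have K0 : 0 < K by rewrite ltr_pwDl // sumr_ge0.
exists (e / K) => /=; first by rewrite divr_gt0.
move=> s hts; apply: hP; split=> // i j; rewrite ord1 /ball /= /segment !mxE.
have -> : x i 0 + t * (y i 0 - x i 0) - (x i 0 + s * (y i 0 - x i 0)) =
    (t - s) * (y - x) i 0 by rewrite !mxE; ring.
rewrite normrM; apply: (@le_lt_trans _ _ (`|t - s| * (K - 1))).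
  rewrite ler_wpM2l // /K addrAC subrr add0r (bigD1 i) //= lerDl sumr_ge0 //.
apply: (@le_lt_trans _ _ ((e / K) * (K - 1))).
  rewrite ler_wpM2r ?subr_ge0 //; first by rewrite lerDl sumr_ge0.
  by apply: ltW; move: hts; rewrite /ball /=.
by rewrite -mulrA gtr_pMr // mulrC ltr_pdivrMr // mul1r ltrBlDr ltrDl.
Qed.

Lemma pairingR_segment a x y t :
  pairingR a (segment x y t) = pairingR a x + t * (pairingR a y - pairingR a x).
Proof. by rewrite /segment pairingRDr pairingRZr pairingRBr. Qed.

Variable f : 'rV[int]_n -> int.
Local Notation obox := [set x : 'cV[R]_n | forall a, pos a ->
  (f a)%:~R < pairingR a x < (f a + 1)%:~R].
Local Notation cbox := [set x : 'cV[R]_n | forall a, pos a ->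
  (f a)%:~R <= pairingR a x <= (f a + 1)%:~R].

Lemma obox_off : obox `<=` off.
Proof.
move=> x hx a m pa; rewrite /hyperplane /= => hm.
by have := hx a pa; rewrite hm !ltr_int; lia.
Qed.

(** On a connected set off the hyperplanes, the values of a root form an interval that avoids the
    integers, so it stays between [f a] and [f a + 1]. Conversely the box is convex. *)
Lemma component_obox x : obox x -> connected_component off x = obox.
Proof.
move=> hx; apply/seteqP; split=> y.
  move=> [E [Ex Eoff Ec Ey]] a pa.
  have : is_interval (pairingR a @` E).
    apply/connected_intervalP; apply: connected_continuous_connected => //.
    by apply: continuous_subspaceT => z; exact: pairingR_continuous.
  move=> hI; have hno (k : int) : ~ (pairingR a @` E) k%:~R.
    by move=> [z Ez hz]; exact: (Eoff z Ez a k pa).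
  have ix : (pairingR a @` E) (pairingR a x) by exists x.
  have iy : (pairingR a @` E) (pairingR a y) by exists y.
  have /andP[h1 h2] := hx a pa; apply/andP; split; rewrite ltNge; apply/negP => h.
    by apply: (hno (f a)); apply: (hI _ _ iy ix); rewrite h ltW.
  by apply: (hno (f a + 1)); apply: (hI _ _ ix iy); rewrite h ltW.
move=> hy; exists (segment x y @` `[0, 1]) => //; last first.
  by exists 1; rewrite /= ?in_itv /= ?lexx ?ler01 // /segment scale1r addrC subrK.
split; first by exists 0; rewrite /= ?in_itv /= ?lexx ?ler01 // /segment scale0r addr0.
  move=> z [t ht <-]; move: ht; rewrite /= in_itv /= => /andP[t0 t1].
  apply: obox_off => a pa.
  by rewrite pairingR_segment; apply: between_convex; [exact: hx|exact: hy| |].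
apply: connected_continuous_connected; first exact: segment_connected.
by apply: continuous_subspaceT => z; exact: segment_continuous.
Qed.

(** A point of the closed box is a limit of points of its segment to the interior point x, and these
    are interior. *)
Lemma closure_obox x : obox x -> closure obox = cbox.
Proof.
move=> hx; apply/seteqP; split=> y.
  move=> hy a pa.
  have hno (P : set R) : open P -> P (pairingR a y) -> exists z, obox z /\ P (pairingR a z).
    move=> oP Py; have := hy (pairingR a @^-1` P).
    case; last by move=> z [hz1 hz2]; exists z.
    by apply: pairingR_continuous; exact: open_nbhs_nbhs.
  apply/andP; split; rewrite leNgt; apply/negP => h.
    have [z [hz]] := hno _ (@open_lt _ _) h.
    by have /andP[h1 h2] := hz a pa => /= h3; move: (lt_trans h1 h3); rewrite ltxx.
  have [z [hz]] := hno _ (@open_gt _ _) h.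
  by have /andP[h1 h2] := hz a pa => /= h3; move: (lt_trans h2 h3); rewrite ltxx.
move=> hy P hP.
have : nbhs 0 (segment y x @^-1` P).
  by apply: segment_continuous; rewrite /segment scale0r addr0.
move=> /nbhs_ballP [e /= e0 he].
pose t : R := Num.min (e / 2) (2^-1).
have t0 : 0 < t by rewrite lt_min divr_gt0 //= invr_gt0.
have te : t < e.
  by rewrite gt_min; apply/orP; left; rewrite ltr_pdivrMr // ltr_pMr // ltr1n.
have t1 : t < 1.
  by rewrite gt_min; apply/orP; right; rewrite invf_lt1 // ltr1n.
exists (segment y x t); split; last first.
  by apply: he; rewrite /ball /= sub0r normrN gtr0_norm.
move=> a pa; rewrite pairingR_segment.
by apply: between_convex_strict; [exact: hy|exact: hx| |exact: ltW].
Qed.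

End AlcoveTopology.

Section GeneralizedAlcoves.
Variables (R : realType) (n : nat) (D : rootDatum n) (B : rootBase D).
Implicit Types (a b c : 'rV[int]_n) (x y z : 'cV[R]_n) (w : 'M[int]_n).
Implicit Types (v : affine n) (A : galcove R n).
Local Notation alpha := (simple B).
Local Notation pos := (pos_root B).
Local Notation ext := (ext_weyl D).
Local Notation box := (@box R n D B).
Local Notation off := (@off_hyperplanes R n D B).
Local Notation galc := (@galc R n D B).

(** The reflection permutes the positive roots other than alpha_i and negates alpha_i. Stated
    without subtraction in [nat]. *)
Lemma count_refl_simple (P : pred 'rV[int]_n) i :
  (count (fun a => P (a *m refl D (alpha i))) (pos_roots B) + P (alpha i) =
   count P (pos_roots B) + P (- alpha i))%N.
Proof.
have hi := simple_root i; have mi : alpha i \in pos_roots B by apply/mem_pos_roots; exact: simple_pos.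
pose s := [seq a <- pos_roots B | a != alpha i].
have ms a : a \in s <-> pos a /\ a <> alpha i.
  rewrite mem_filter; split=> [/andP[/eqP h /mem_pos_roots] //|[h /eqP h']].
  by rewrite h'; apply/mem_pos_roots.
have us : uniq s by rewrite filter_uniq ?uniq_pos_roots.
have E (Q : pred 'rV[int]_n) : count Q (pos_roots B) = (Q (alpha i) + count Q s)%N.
  have pe : perm_eq (pos_roots B) (alpha i :: s).
    apply: uniq_perm; first exact: uniq_pos_roots.
      by rewrite /= us andbT; apply/negP => /ms [].
    move=> a; rewrite inE; apply/idP/orP.
      by move=> /mem_pos_roots pa; have [->|/eqP h] := eqVneq a (alpha i); [left|right; apply/ms].
    by move=> [/eqP ->//|/ms [pa _]]; apply/mem_pos_roots.
  by rewrite ((seq.permP pe) Q).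
have rK a : a *m refl D (alpha i) *m refl D (alpha i) = a by rewrite -mulmxA reflK // mulmx1.
have sub a : a \in s -> a *m refl D (alpha i) \in s.
  move=> /ms [pa ai]; apply/ms; split; first exact: pos_refl_simple.
  move=> e; have := pos_refl_simple pa ai; have := rK a; rewrite e mul_refl_self // => ea _.
  by apply: (pos_opp (simple_pos i)); rewrite ea.
have pe : perm_eq [seq a *m refl D (alpha i) | a <- s] s.
  apply: uniq_perm => //; first by rewrite map_inj_uniq //; exact: (can_inj (g := mulmx^~ (refl D (alpha i))) rK).
  move=> a; apply/mapP/idP => [[b bs ->]|as_]; first exact: sub.
  by exists (a *m refl D (alpha i)); rewrite ?rK //; exact: sub.
rewrite !E mul_refl_self //.
have -> : count (fun a => P (a *m refl D (alpha i))) s = count P s.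
  by rewrite -((seq.permP pe) P) count_map.
by rewrite [RHS]addnC addnA addnAC.
Qed.

(** Take w minimizing the number of positive a with [a *m w] negative at x. If a simple root were
    among them, multiplication by its reflection would lower the number by one. *)
Lemma chamber_transitive x : (forall a, a \in roots D -> pairingR a x != 0) ->
  exists2 w, weyl D w & forall a, pos a -> 0 < pairingR (a *m w) x.
Proof.
move=> x0; pose N w := count (fun a => pairingR (a *m w) x < 0) (pos_roots B).
have [w [hw hmin]] := @exists_argmin _ (weyl D) N (ex_intro _ _ (weyl1 D)).
exists w => // a pa.
have simp i : 0 < pairingR (alpha i *m w) x.
  have hi := simple_root i; have hiw := root_weyl hi hw.
  rewrite lt_neqAle eq_sym x0 //= leNgt; apply/negP => hneg.
  have := hmin _ (weylM (weyl_refl hi) hw).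
  have := count_refl_simple (fun a => pairingR (a *m w) x < 0) i.
  have -> : count (fun a => pairingR (a *m refl D (alpha i) *m w) x < 0) (pos_roots B) =
     N (refl D (alpha i) *m w) by apply: eq_count => b /=; rewrite mulmxA.
  rewrite -/(N w) hneg mulNmx pairingRNl oppr_lt0 (lt_gtF hneg) /=; lia.
have [c e [i ci]] := pos_coefE pa.
rewrite e mulmx_suml pairingR_suml (bigD1 i) //= -scalemxAl pairingRZl.
apply: ltr_wpDr; last by rewrite mulr_gt0 ?ltr0z.
by apply: sumr_ge0 => j _; rewrite -scalemxAl pairingRZl mulr_ge0 ?ler0z // ltW.
Qed.

Lemma alcoveE (f : 'rV[int]_n -> int) x :
  (forall a, pos a -> (f a)%:~R < pairingR a x < (f a + 1)%:~R) ->
  closure (connected_component off x) =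
  [set y : 'cV[R]_n | forall a, pos a -> (f a)%:~R <= pairingR a y <= (f a + 1)%:~R].
Proof. by move=> hx; rewrite (component_obox hx) (closure_obox hx). Qed.

Lemma galcE v : ext v -> galc v = (box v, v.1).
Proof. by move=> hv; rewrite /Defs.galc image_alcove // mulmx0 addr0. Qed.

Lemma galc_generalized v : ext v -> generalized_alcove B (galc v).
Proof.
move=> hv; have hb := actV_base_point R B hv.
have hbp a : pos a -> (kf B v a)%:~R < pairingR a (actV v (base_point R B)) < (kf B v a + 1)%:~R.
  by move=> pa; apply: hb; exact: pos_rootW pa.
rewrite galcE //; split=> /=.
  exists (actV v (base_point R B)); first exact: (obox_off hbp).
  by rewrite (alcoveE hbp).
by move=> a pa; rewrite pairingR_embed !ler_int /kf; case: negr => /=; lia.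
Qed.

(** The floors of the roots at an interior point x describe the alcove. Because the vertex mu
    belongs to it, each floor is <a, mu> or <a, mu> - 1 according to the sign of a at x - mu, and
    that is [kf] for the w moving x - mu into C. *)
Lemma generalized_alcoveP A : generalized_alcove B A -> exists2 v, ext v & A = galc v.
Proof.
case: A => P mu [] /= [x xoff ->] hmu.
pose f a : int := Num.floor (pairingR a x).
have hf a : pos a -> (f a)%:~R < pairingR a x < (f a + 1)%:~R.
  move=> pa; have /andP[h1 h2] := floor_itv (pairingR a x); rewrite h2 andbT.
  rewrite lt_neqAle h1 andbT; apply/eqP => e; apply: (xoff a (f a) pa).
  by rewrite /hyperplane /= e.
rewrite (alcoveE hf) in hmu *.
pose x' := x - embed R mu.
have ex a : pairingR a x' = pairingR a x - (pairing a mu)%:~R.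
  by rewrite pairingRBr pairingR_embed.
have x'0 a : a \in roots D -> pairingR a x' != 0.
  move=> ha; rewrite ex subr_eq0; apply/eqP => e.
  have [pa|pa] := pos_or_neg B ha; first exact: (xoff a (pairing a mu) pa).
  by apply: (xoff _ (- pairing a mu) pa); rewrite /hyperplane /= pairingRNl e intrN.
have [w hw hp] := chamber_transitive x'0.
have hwi := weylV hw.
exists (mu, invmx w) => //; rewrite galcE //; congr (_, _).
have fE a : pos a -> f a = kf B (mu, invmx w) a.
  move=> pa; have ha := pos_rootW pa; have haw := root_weyl ha hwi.
  have ea : a *m invmx w *m w = a by rewrite mulmxKV // (weyl_unit hw).
  have /andP[h1 h2] := hf a pa; have := hmu a pa.
  rewrite pairingR_embed !ler_int => /andP[h3 h4].
  rewrite /kf /=; have [pb|pb] := pos_or_neg B haw.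
    rewrite pos_negr //=; have := hp _ pb; rewrite ea ex subr_gt0 => h5.
    by have := lt_trans h5 h2; rewrite ltr_int; lia.
  have -> : negr B (a *m invmx w) = true.
    by apply: contrapT => /negP/negPf/posN => /(_ haw) /pos_opp.
  have := hp _ pb; rewrite mulNmx ea pairingRNl ex oppr_gt0 subr_lt0 => h5 /=.
  by have := lt_trans h1 h5; rewrite ltr_int; lia.
by apply/seteqP; split=> y hy a pa; have := hy a pa; rewrite fE.
Qed.

Lemma galc_inj u v : ext u -> ext v -> galc u = galc v -> u = v.
Proof.
move=> hu hv; rewrite !galcE // => -[e1 e2]; apply: (@kf_inj _ _ B) => //.
exact: (box_inj hu hv e1).
Qed.

Lemma delta_galc v : ext v -> delta B (galc v) = v.2.
Proof.
move=> hv; have [hd e] : [set w | weyl D w /\ galc v = galc (amul (trans (wt (galc v))) (lin w))]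
    (delta B (galc v)).
  apply: xgetPex; exists v.2; split=> //.
  have -> : wt (galc v) = v.1 by rewrite galcE.
  by rewrite amul_trans_lin; case: (v).
have : v = amul (trans (wt (galc v))) (lin (delta B (galc v))).
  by apply: galc_inj => //; rewrite amul_trans_lin.
by rewrite amul_trans_lin => /(congr1 snd) /= <-.
Qed.

Lemma wt_galc v : ext v -> wt (galc v) = v.1.
Proof. by move=> hv; rewrite galcE. Qed.

Lemma ract_galc v u : ext v -> ract B (galc v) u = galc (amul v u).
Proof.
by move=> hv; rewrite /ract wt_galc // delta_galc // amul_trans_lin; case: (v).
Qed.

Lemma galc_chamber v : ext v -> (galc v).1 `<=` chamber B <-> forall a, pos a -> 0 <= kf B v a.
Proof.
move=> hv; rewrite galcE //; split=> [h a pa|h z hz a pa]; last first.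
  by have /andP[h1 _] := hz a pa; apply: le_trans h1; rewrite ler0z; exact: h.
have hb : box v (actV v (base_point R B)) by apply: actV_box => //; exact: base_point_in.
have h0 := h _ hb a pa; have /andP[_ h2] := actV_base_point R B hv (pos_rootW pa).
by have := le_lt_trans h0 h2; rewrite ltr0z; lia.
Qed.

Lemma separatingE v s a m b k : ext v -> wall R B v s a m ->
  separating B (galc v) s b k <-> b = a /\ k = m.
Proof.
move=> hv hw; have hvs := wall_ext hv hw; have [pa _ _ _ [z [h1 h2 on]]] := hw.
rewrite /separating ract_galc // !galcE //=; split.
  by move=> [pb [y [y1 y2] ony]]; exact: (wall_uniq hv hw y1 y2 pb ony).
by move=> [-> ->]; split=> //; exists z.
Qed.

Lemma precedesE v s a m : ext v -> wall R B v s a m ->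
  precedes B (galc v) s <-> kf B v a = m - 1.
Proof.
move=> hv hw; have [pa _ hk _ _] := hw.
have hb : box v (actV v (base_point R B)) by apply: actV_box => //; exact: base_point_in.
have /andP[b1 b2] := actV_base_point R B hv (pos_rootW pa).
split.
  move=> [b [k [/(separatingE _ _ hv hw) [-> ->]]]]; rewrite galcE // => h.
  by have := lt_le_trans b1 (h _ hb); rewrite ltr_int; case: hk => -[-> _]; lia.
move=> e; exists a, m; split; first exact/(separatingE _ _ hv hw).
by rewrite galcE // => y /(_ a pa) /andP[_]; rewrite e addrNK.
Qed.

End GeneralizedAlcoves.

(** * Galleries *)

Section Galleries.
Variables (R : realType) (n : nat) (D : rootDatum n) (B : rootBase D).
Variables (d : affine n -> nat) (d_inv : conj_invariant R B d).
Variable H : heckeAlgebra R B d.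
Implicit Types (a b c : 'rV[int]_n) (x y z w : 'M[int]_n) (kap la mu nu : 'cV[int]_n).
Implicit Types (u v s g : affine n) (t : seq (affine n)).
Implicit Types (A : galcove R n) (sg : seq (galcove R n)) (vs : seq (affine n)).
Local Notation ext := (ext_weyl D).
Local Notation sgen := (sgen R B).
Local Notation Omega := (Omega R B).
Local Notation galc := (@galc R n D B).
Local Notation ract := (@ract R n D B).
Local Notation gallery := (@gallery R n D B).
Local Notation pos_folded := (@pos_folded R n D B).
Local Notation Cv := (@Cv n D B).
Local Notation T := (hecke_T H).
Local Notation qv := (qv R B d).

Definition letter s : Prop := sgen s \/ Omega s.

Definition gstep s A A' : Prop :=
  (Omega s -> A' = ract A s) /\ (sgen s -> A' = A \/ A' = ract A s).

Lemma gallery_cons s t A A' sg :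
  gallery (s :: t) (A :: A' :: sg) <->
  [/\ letter s, generalized_alcove B A, gstep s A A' & gallery t (A' :: sg)].
Proof.
split.
  move=> [sz h1 h2 h3]; split; [exact: (h1 0%N)|exact: (h2 0%N)|exact: (h3 0%N)|].
  split; first by case: sz => /= ->.
  - by move=> i hi; exact: (h1 i.+1).
  - by move=> i hi; exact: (h2 i.+1).
  - by move=> i hi; exact: (h3 i.+1).
move=> [h1 h2 h3 [sz k1 k2 k3]]; split; first by move: sz => /= ->.
- by case=> [|i] hi //; exact: k1.
- by case=> [|i] hi //; exact: k2.
- by case=> [|i] hi //; exact: k3.
Qed.

Lemma gallery_nil sg : gallery [::] sg <-> exists2 A, sg = [:: A] & generalized_alcove B A.
Proof.
split.
  case: sg => [|A [|A' sg]] [sz _ h _] //; exists A => //; exact: (h 0%N).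
by move=> [A -> hA]; split=> // -[].
Qed.

Lemma gallery_size t sg : gallery t sg -> size sg = (size t).+1.
Proof. by case. Qed.

Definition allowed t sg : Prop :=
  [/\ gallery t sg, pos_folded t sg & forall A, A \in sg -> A.1 `<=` chamber B].

Lemma pos_folded_cons s t A A' sg :
  pos_folded (s :: t) (A :: A' :: sg) <->
  (sgen s -> A' = A -> ~ precedes B A s) /\ pos_folded t (A' :: sg).
Proof.
split.
  move=> h; split=> [hs e|s' i hi [e1 e2 e3]].
    by apply: (h s 0%N) => //; split.
  by apply: (h s' i.+1) => //; split.
move=> [h1 h2] s' [|i] hi [e1 e2 e3]; first by rewrite -e1 in e2 *; exact: h1.
by apply: h2 => //; split.
Qed.

Lemma allowed_cons s t A A' sg :
  allowed (s :: t) (A :: A' :: sg) <->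
  [/\ letter s, generalized_alcove B A, A.1 `<=` chamber B,
      gstep s A A' /\ (sgen s -> A' = A -> ~ precedes B A s) & allowed t (A' :: sg)].
Proof.
split.
  move=> [/gallery_cons [h1 h2 h3 h4] /pos_folded_cons [h5 h6] h7]; split=> //.
    by apply: h7; rewrite mem_head.
  by split=> // A0 h0; apply: h7; rewrite inE h0 orbT.
move=> [h1 h2 h3 [h4 h5] [h6 h7 h8]]; split.
- exact/gallery_cons.
- exact/pos_folded_cons.
- by move=> A0; rewrite inE => /orP[/eqP -> //|]; exact: h8.
Qed.

Lemma allowed_nil sg : allowed [::] sg <->
  exists2 A, sg = [:: A] & generalized_alcove B A /\ A.1 `<=` chamber B.
Proof.
split=> [[/gallery_nil [A -> hA] _ h]|[A -> [hA hc]]].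
  by exists A => //; split=> //; apply: h; rewrite mem_head.
split; first by apply/gallery_nil; exists A.
  by move=> s i.
by move=> A'; rewrite inE => /eqP ->.
Qed.

Lemma allowed_start t A sg : allowed t (A :: sg) ->
  exists v, [/\ ext v, Cv v & A = galc v].
Proof.
move=> [hg _ hc]; have hA : generalized_alcove B A by case: hg => _ _ /(_ 0%N isT).
have [v hv e] := generalized_alcoveP hA; exists v; split=> //.
by apply/(galc_chamber R) => //; rewrite -e; apply: hc; rewrite mem_head.
Qed.

(* The lifts to the affine group of the positively folded galleries of type
   [t] in the chamber that start at the alcove of [v]. *)
Fixpoint gals t v : seq (seq (affine n)) :=
  if t is s :: t' then
    if `[< Omega s >] then [seq v :: vs | vs <- gals t' (amul v s)]
    else (if `[< Cv (amul v s) >] then [seq v :: vs | vs <- gals t' (amul v s)] else [::])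
      ++ (if `[< precedes B (galc v) s >] then [::] else [seq v :: vs | vs <- gals t' v])
  else [:: [:: v]].

Definition letters t : Prop := forall s, s \in t -> letter s.

Lemma letters_cons s t : letters (s :: t) <-> letter s /\ letters t.
Proof.
split=> [h|[h1 h2] s']; last by rewrite inE => /orP[/eqP ->|/h2].
by split=> [|s' h']; apply: h; rewrite inE ?eqxx ?h' ?orbT.
Qed.

Lemma letter_ext s : letter s -> ext s.
Proof. by move=> [/sgen_ext|/Omega_ext]. Qed.

Lemma gals_cons t v vs : letters t -> ext v -> Cv v -> vs \in gals t v ->
  [/\ exists vs', vs = v :: vs', (forall u, u \in vs -> ext u) &
      forall u, u \in vs -> Cv u].
Proof.
elim: t v vs => [|s t IH] v vs /=.
  move=> _ hv hc; rewrite inE => /eqP ->; split; first by exists [::].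
    by move=> u; rewrite inE => /eqP ->.
  by move=> u; rewrite inE => /eqP ->.
move=> /letters_cons [hs ht] hv hc.
have aux v' : ext v' -> Cv v' -> vs \in [seq v :: vs' | vs' <- gals t v'] ->
    [/\ exists vs', vs = v :: vs', (forall u, u \in vs -> ext u) &
      forall u, u \in vs -> Cv u].
  move=> hv' hc' /mapP[vs' /(IH v' vs' ht hv' hc') [_ h1 h2] ->]; split; first by exists vs'.
    by move=> u; rewrite inE => /orP[/eqP ->|/h1].
  by move=> u; rewrite inE => /orP[/eqP ->|/h2].
have hvs : ext (amul v s) by apply: extM => //; exact: letter_ext.
case: ifPn => [/asboolP hO|_]; first by apply: aux => //; exact: (Cv_Omega hv hc hO).
rewrite mem_cat => /orP[].
  by case: ifPn => // /asboolP hC; exact: aux.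
by case: ifPn => // _; exact: aux.
Qed.

Lemma uniq_gals t v : letters t -> ext v -> Cv v -> uniq (gals t v).
Proof.
have ci u : injective (cons u) by move=> vs vs' [].
elim: t v => [//|s t IH] v /letters_cons [hs ht] hv hc /=.
have hvs : ext (amul v s) by apply: extM => //; exact: letter_ext.
case: ifPn => [/asboolP hO|/asboolP hO].
  by rewrite map_inj_uniq //; apply: IH => //; exact: (Cv_Omega hv hc hO).
have hsg : sgen s by case: hs.
rewrite cat_uniq; apply/and3P; split.
- by case: ifPn => // /asboolP hC; rewrite map_inj_uniq //; exact: IH.
- apply/hasPn => vs; case: ifPn => // _ /mapP[vs' h' ->].
  case: ifPn => // /asboolP hC; apply/negP => /mapP[vs'' h'' [e]].
  have [[r1 e1] _ _] := gals_cons ht hv hc h'.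
  have [[r2 e2] _ _] := gals_cons ht hvs hC h''.
  move: e; rewrite e1 e2 => -[e _].
  have := alen_step hv hsg; rewrite -e; lia.
- by case: ifPn => // _; rewrite map_inj_uniq //; exact: IH.
Qed.

Lemma sgen_neq v s : ext v -> sgen s -> galc (amul v s) <> galc v.
Proof.
move=> hv hs e; have hvs := extM hv (sgen_ext hs).
by have := alen_step hv hs; rewrite (galc_inj hvs hv e); lia.
Qed.

Lemma gals_allowed t v vs : letters t -> ext v -> Cv v -> vs \in gals t v ->
  allowed t (map galc vs).
Proof.
elim: t v vs => [|s t IH] v vs /=.
  move=> _ hv hc; rewrite inE => /eqP -> /=; apply/allowed_nil.
  by exists (galc v) => //; split; [exact: galc_generalized|exact/galc_chamber].
move=> /letters_cons [hs ht] hv hc.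
have hvs : ext (amul v s) by apply: extM => //; exact: letter_ext.
have aux v' : ext v' -> Cv v' -> gstep s (galc v) (galc v') ->
   (sgen s -> galc v' = galc v -> ~ precedes B (galc v) s) ->
   vs \in [seq v :: vs' | vs' <- gals t v'] -> allowed (s :: t) (map galc vs).
  move=> hv' hc' h1 h2 /mapP[vs' hvs' ->].
  have := IH v' vs' ht hv' hc' hvs'; have [[r ->] _ _] := gals_cons ht hv' hc' hvs'.
  move=> /= hal; apply/allowed_cons; split=> //; first exact: galc_generalized.
  exact/galc_chamber.
case: ifPn => [/asboolP hO|/asboolP hO].
  have hns : ~ sgen s by move=> /sgen_Omega.
  apply: aux => //; first exact: (Cv_Omega hv hc hO).
  by split=> // _; rewrite ract_galc.
have hsg : sgen s by case: hs.
rewrite mem_cat => /orP[].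
  case: ifPn => // /asboolP hC; apply: aux => //; last by move=> _ /(sgen_neq hv hsg).
  by split=> // _; right; rewrite ract_galc.
case: ifPn => // /asboolP hp; apply: aux => //.
by split=> // _; left.
Qed.

Lemma allowed_gals t v sg : letters t -> ext v -> Cv v -> allowed t (galc v :: sg) ->
  exists2 vs, vs \in gals t v & galc v :: sg = map galc vs.
Proof.
elim: t v sg => [|s t IH] v sg /=.
  move=> _ hv hc /allowed_nil [A [_ ->] _]; exists [:: v] => //; exact: mem_head.
move=> /letters_cons [hs ht] hv hc.
case: sg => [|A' sg]; first by move=> [/gallery_size].
move=> /allowed_cons [_ _ _ [[h1 h2] h3] hal].
have hvs : ext (amul v s) by apply: extM => //; exact: letter_ext.
have aux v' : ext v' -> Cv v' -> A' = galc v' ->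
  exists2 vs, vs \in [seq v :: vs' | vs' <- gals t v'] & galc v :: A' :: sg = map galc vs.
  move=> hv' hc' e; move: hal; rewrite e => /(IH v' sg ht hv' hc') [vs hvs' e'].
  by exists (v :: vs); [exact: map_f|rewrite /= e'].
have aC v' : ext v' -> A' = galc v' -> Cv v'.
  move=> hv' e; apply/(galc_chamber R) => //; rewrite -e.
  by case: hal => _ _; apply; rewrite mem_head.
case: ifPn => [/asboolP hO|/asboolP hO].
  by apply: aux => //; [exact: (Cv_Omega hv hc hO)|rewrite h1 // ract_galc].
have hsg : sgen s by case: hs.
case: (h2 hsg) => e.
  have hp := h3 hsg e; have [vs h e'] := aux v hv hc e.
  by exists vs => //; rewrite mem_cat (asboolF hp) h orbT.
rewrite ract_galc // in e; have hC := aC _ hvs e.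
have [vs h e'] := aux _ hvs hC e.
by exists vs => //; rewrite mem_cat (asboolT hC) h.
Qed.

Lemma finite_sgen : finite_set sgen.
Proof.
apply: (@sub_finite_set _ _ [set` [seq arefl D a m | a <- roots D, m <- [:: 0; 1]]]);
  last exact: finite_seq.
move=> s [a [m [pa [z hz [h1 _]] ->]]].
have : arefl D a m \in [seq arefl D a m | a <- roots D, m <- [:: 0; 1]]; last by [].
apply/allpairsP; exists (a, m) => /=; split=> //; first exact: pos_rootW pa.
have := hz a pa; rewrite [pairingR a z]h1 -[1]/(1%:~R) ler0z ler_int !inE; lia.
Qed.

Definition Sgens : seq (affine n) := enum_fset (fset_set sgen).

Lemma mem_Sgens s : (s \in Sgens) <-> sgen s.
Proof.
have -> : (s \in Sgens) = (s \in fset_set sgen) by [].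
by rewrite (in_fset_set finite_sgen); split=> [/set_mem|/mem_set].
Qed.

Definition pos_dir1 s0 t A sg s : bool := `[< pos_direction B (s0 :: t) (A :: sg) s 0 >].
Definition wall1b s0 t A sg s : bool := `[< wall_fold B (s0 :: t) (A :: sg) s 0 >].
Definition other1 s0 t A sg s : bool := `[< other_fold B (s0 :: t) (A :: sg) s 0 >].

Lemma count_iota_cons (P Q : pred nat) k : (forall i, P i.+1 = Q i) ->
  count P (iota 0 k.+1) = (P 0%N + count Q (iota 0 k))%N.
Proof.
move=> PQ; rewrite /= -[1%N]addn0 iotaDl count_map; congr (_ + _)%N.
by apply: eq_count => i; exact: PQ.
Qed.

(** The share of the first step in the factor of C_sigma for s; it makes C_sigma multiplicative
    along a gallery ([C_gal_cons]). *)
Definition local_weight s0 t A sg s : coef :=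
  q_gen d s ^+ (pos_dir1 s0 t A sg s + wall1b s0 t A sg s)
  * (q_gen d s - 1) ^+ other1 s0 t A sg s.

Lemma wall_foldS s0 t A sg s i :
  wall_fold B (s0 :: t) (A :: sg) s i.+1 = wall_fold B t sg s i.
Proof. by rewrite /wall_fold /fold_at /alc /typ. Qed.

Lemma other_foldS s0 t A sg s i :
  other_fold B (s0 :: t) (A :: sg) s i.+1 = other_fold B t sg s i.
Proof. by rewrite /other_fold /fold_at /alc /typ. Qed.

Lemma C_gal_cons s0 t A sg : C_gal B d (s0 :: t) (A :: sg) =
  (\prod_(s <- Sgens) local_weight s0 t A sg s) * C_gal B d t sg.
Proof.
rewrite /C_gal !(fsbig_finite _ _ finite_sgen) /= -big_split /=; apply: eq_bigr => s _.
have hm : stat_m B (s0 :: t) (A :: sg) s = (pos_dir1 s0 t A sg s + stat_m B t sg s)%N.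
  exact: (@count_iota_cons (fun i => `[< pos_direction B (s0 :: t) (A :: sg) s i >])).
have hp : stat_p B (s0 :: t) (A :: sg) s = (wall1b s0 t A sg s + stat_p B t sg s)%N.
  apply: (@count_iota_cons (fun i => `[< wall_fold B (s0 :: t) (A :: sg) s i >])) => i.
  by rewrite wall_foldS.
have hr : stat_r B (s0 :: t) (A :: sg) s = (other1 s0 t A sg s + stat_r B t sg s)%N.
  apply: (@count_iota_cons (fun i => `[< other_fold B (s0 :: t) (A :: sg) s i >])) => i.
  by rewrite other_foldS.
rewrite hm hp hr /local_weight addnACA exprD [(_ - 1) ^+ (_ + _)]exprD.
by rewrite mulrACA.
Qed.

Lemma C_gal_nil sg : C_gal B d [::] sg = 1.
Proof.
rewrite /C_gal (fsbig_finite _ _ finite_sgen) /= big1 // => s _.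
by rewrite /stat_m /stat_p /stat_r /= !expr0 mulr1.
Qed.

Lemma local_weight1 s0 t A sg : ~ sgen s0 -> \prod_(s <- Sgens) local_weight s0 t A sg s = 1.
Proof.
move=> h0; rewrite big_seq big1 // => s /mem_Sgens hs.
have ne : s0 <> s by move=> e; rewrite e in h0.
rewrite /local_weight /pos_dir1 /wall1b /other1 !asboolF ?expr0 ?mulr1 //.
- by move=> [[]].
- by move=> [[]].
- by move=> [].
Qed.

Lemma local_weight_sgen s0 t A sg : sgen s0 ->
  \prod_(s <- Sgens) local_weight s0 t A sg s = local_weight s0 t A sg s0.
Proof.
move=> h0; rewrite (bigD1_seq s0) ?fset_uniq //=; last exact/mem_Sgens.
rewrite big1_seq ?mulr1 // => s /andP[/eqP ne _].
have ne' : s0 <> s by move=> e; rewrite e in ne.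
rewrite /local_weight /pos_dir1 /wall1b /other1 !asboolF ?expr0 ?mulr1 //.
- by move=> [[]].
- by move=> [[]].
- by move=> [].
Qed.

Lemma local_weight_cross v s t sg : ext v -> sgen s ->
  local_weight s t (galc v) (galc (amul v s) :: sg) s =
  if `[< precedes B (galc v) s >] then qv s else 1.
Proof.
move=> hv hs; have ne := sgen_neq hv hs.
rewrite /local_weight /wall1b /other1 /pos_dir1.
rewrite (asboolF (P := wall_fold _ _ _ _ _)); last by move=> [[_ _ /ne]].
rewrite (asboolF (P := other_fold _ _ _ _ _)); last by move=> [[_ _ /ne]].
rewrite addn0 expr0 mulr1 (q_genE d_inv hs).
have -> : `[< pos_direction B (s :: t) [:: galc v, galc (amul v s) & sg] s 0 >] =
  `[< precedes B (galc v) s >].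
  apply: asbool_equiv_eq; split=> [[] //|h]; split=> //.
  by rewrite /= ract_galc.
by case: asboolP => _; rewrite ?expr1 ?expr0.
Qed.

Lemma local_weight_fold v s t sg a m : ext v -> sgen s -> wall R B v s a m ->
  ~ precedes B (galc v) s ->
  local_weight s t (galc v) (galc v :: sg) s =
  if `[< exists j, a = simple B j /\ m = 0 >] then qv s else qv s - 1.
Proof.
move=> hv hs hw hp.
rewrite /local_weight /wall1b /other1 /pos_dir1.
rewrite (asboolF (P := pos_direction _ _ _ _ _)); last by move=> [].
have hf : fold_at B (s :: t) [:: galc v, galc v & sg] s 0 by [].
have e : (exists j, separating B (galc v) s (simple B j) 0) <->
    exists j, a = simple B j /\ m = 0.
  by split=> -[j h]; exists j; [have [-> ->] := (separatingE _ _ hv hw).1 h|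
    apply/(separatingE _ _ hv hw); case: h => -> ->].
rewrite add0n (q_genE d_inv hs).
case: (asboolP (exists j, a = simple B j /\ m = 0)) => h.
  rewrite (asboolT (P := wall_fold _ _ _ _ _)); last by split=> //; exact/e.
  by rewrite (asboolF (P := other_fold _ _ _ _ _)) ?expr1 ?mulr1 // => -[_]; apply; exact/e.
rewrite (asboolF (P := wall_fold _ _ _ _ _)); last by move=> [_ /e].
by rewrite (asboolT (P := other_fold _ _ _ _ _)) ?expr0 ?mul1r //; split=> // /e.
Qed.

Definition wprodT t : hecke_alg H := foldr (fun s X => T s * X) 1 t.

(* Right multiplication by T_s realises one gallery step. *)
Lemma Ev_gals t v : letters t -> ext v -> Cv v ->
  Ev H v * wprodT t =
  \sum_(vs <- gals t v) C_gal B d t (map galc vs) *: Ev H (last v vs).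
Proof.
elim: t v => [|s t IH] v /=.
  by move=> _ hv hc; rewrite mulr1 big_seq1 C_gal_nil scale1r.
move=> /letters_cons [hs ht] hv hc; rewrite mulrA.
have hvs : ext (amul v s) by apply: extM => //; exact: letter_ext.
have cons_sum v' (k : coef) : ext v' -> Cv v' ->
   (forall vs, vs \in gals t v' ->
      \prod_(s' <- Sgens) local_weight s t (galc v) (map galc vs) s' = k) ->
   \sum_(vs <- [seq v :: vs | vs <- gals t v']) C_gal B d (s :: t) (map galc vs) *: Ev H (last v vs) =
   k *: (Ev H v' * wprodT t).
  move=> hv' hc' hk; rewrite big_map IH // scaler_sumr !big_seq; apply: eq_bigr => vs hin.
  rewrite [map galc (v :: vs)]/= C_gal_cons hk // scalerA.
  by have [[r ->] _ _] := gals_cons ht hv' hc' hin.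
case: ifPn => [/asboolP hO|/asboolP hO].
  rewrite (cons_sum _ 1 hvs (Cv_Omega hv hc hO)) ?scale1r; last first.
    by move=> vs _; rewrite local_weight1 // => /sgen_Omega.
  by rewrite Ev_Omega.
have hsg : sgen s by case: hs.
have [a [m hw]] := sgen_wall hv hsg; have m0 := Cv_wall_ge0 hc hw.
have hp := precedesE hv hw.
have cross : Cv (amul v s) -> forall vs, vs \in gals t (amul v s) ->
    \prod_(s' <- Sgens) local_weight s t (galc v) (map galc vs) s' =
    if `[< precedes B (galc v) s >] then qv s else 1.
  move=> hC vs hin; rewrite local_weight_sgen //.
  by have [[r ->] _ _] := gals_cons ht hvs hC hin; rewrite /= local_weight_cross.
have fold_w : ~ precedes B (galc v) s -> forall vs, vs \in gals t v ->
    \prod_(s' <- Sgens) local_weight s t (galc v) (map galc vs) s' =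
    if `[< exists j, a = simple B j /\ m = 0 >] then qv s else qv s - 1.
  move=> hnp vs hin; rewrite local_weight_sgen //.
  by have [[r ->] _ _] := gals_cons ht hv hc hin; rewrite /= (local_weight_fold _ _ hv hsg hw hnp).
(* For m = 0 the face lies on a wall of C: crossing it leaves C, and only the fold, of weight q_s,
   remains. *)
rewrite big_cat /=; have [em|mn] := eqVneq m 0.
  rewrite em in hw hp fold_w *; have [k0 [i ei] _] := one0_wall0 d_inv H hv hc hsg hw.
  have hnp : ~ precedes B (galc v) s by move=> /hp; rewrite k0; lia.
  have hnC : ~ Cv (amul v s).
    have [pa _ hk _ _] := hw; move=> /(_ a pa); case: hk => -[h1 h2]; rewrite ?h2 //.
    by move: h1; rewrite k0.
  rewrite (asboolF hnC) (asboolF hnp) big_nil add0r (cons_sum _ (qv s)) //; last first.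
    by move=> vs hin; rewrite fold_w // asboolT //; exists i.
  by rewrite (Ev_wall d_inv H hv hc hsg hw) -scalerAl.
have mp : 0 < m by lia.
(* For m > 0 both sides lie in C. A positive crossing excludes the fold; otherwise both the
   crossing, of weight 1, and the fold, of weight q_s - 1, occur. *)
have hC := Cv_wall hc hw mp; rewrite (asboolT hC).
case: asboolP => hpr.
  rewrite big_nil addr0 (cons_sum _ (qv s)) //; last first.
    by move=> vs hin; rewrite cross // asboolT.
  by rewrite (Ev_up d_inv H hv hc hsg hw (hp.1 hpr)) -scalerAl.
rewrite (cons_sum _ 1 hvs hC) ?scale1r; last by move=> vs hin; rewrite cross // asboolF.
rewrite (cons_sum _ (qv s - 1)) //; last first.
  by move=> vs hin; rewrite fold_w // asboolF // => -[j [_ e]]; move: mn; rewrite e eqxx.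
rewrite (Ev_down d_inv H hv hc hsg hw mp) ?mulrDl -?scalerAl //.
have [_ _ hk _ _] := hw; case: hk => -[h1 h2] //.
by case: hpr; apply/hp.
Qed.

Local Notation dom := (dominant B).
Local Notation nmin := (nmin R B).
Local Notation alen := (alen B).

Lemma letters_ext t : letters t -> ext (wprod t).
Proof.
elim: t => [_|s t IH /letters_cons[/letter_ext hs /IH]]; first exact: ext1.
exact: extM.
Qed.

(** Folded steps do not move the alcove; t' keeps the letters of the other steps. *)
Lemma gallery_word t v sg : ext v -> gallery t (galc v :: sg) ->
  exists t', [/\ letters t', subseq t' t & last (galc v) sg = galc (amul v (wprod t'))].
Proof.
elim: t v sg => [|s t IH] v sg hv.
  by move=> /gallery_nil [A [_ ->] _]; exists [::]; rewrite /= amulv1.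
case: sg => [/gallery_size //|A sg] /gallery_cons [hs _ [h1 h2] hg].
have hvs := extM hv (letter_ext hs).
have cross : A = galc (amul v s) -> exists t', [/\ letters t', subseq t' (s :: t) &
    last (galc v) (A :: sg) = galc (amul v (wprod t'))].
  move=> e; rewrite e in hg *; have [t' [k1 k2 k3]] := IH _ _ hvs hg.
  exists (s :: t'); split; first exact/letters_cons.
    by rewrite /= eqxx.
  by rewrite /= k3 amulA.
case: hs => [hs|hs]; last by apply: cross; rewrite h1 // ract_galc.
case: (h2 hs) => [e|]; last by rewrite ract_galc.
rewrite e in hg *; have [t' [k1 k2 k3]] := IH _ _ hv hg.
by exists t'; split=> //; exact: subseq_trans k2 (subseq_cons _ _).
Qed.

Lemma word_gallery t v : letters t -> ext v ->
  exists2 sg, gallery t (galc v :: sg) & last (galc v) sg = galc (amul v (wprod t)).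
Proof.
elim: t v => [|s t IH] v.
  move=> _ hv; exists [::]; rewrite /= ?amulv1 //.
  by apply/gallery_nil; exists (galc v) => //; exact: galc_generalized.
move=> /letters_cons [hs ht] hv; have hvs := extM hv (letter_ext hs).
have [sg h1 h2] := IH _ ht hvs; exists (galc (amul v s) :: sg).
  apply/gallery_cons; split=> //; first exact: galc_generalized.
  by split=> _; [|right]; rewrite ract_galc.
by rewrite /= h2 amulA.
Qed.

(** A fold would allow a shorter gallery with the same ends, namely the unfolded gallery of the
    remaining letters; so t is itself a shortest word for n^mu in the letters S^a and Omega. *)
Lemma tmu_word mu t : dom mu -> is_tmu R B mu t ->
  [/\ letters t, wprod t = nmin mu &
      forall t', letters t' -> wprod t' = nmin mu -> (size t <= size t')%N].
Proof.
move=> hm [sigma [[hg hmin] hf hl]].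
case: sigma hg hmin hf hl => [/gallery_size //|A sg] hg hmin /= hf hl.
rewrite /first_alc /last_alc /= in hf hl hmin; rewrite hf in hg hmin hl.
have e1 := ext1 D; have en := ext_nmin R hm.
have hmin' t' : letters t' -> wprod t' = nmin mu -> (size t <= size t')%N.
  move=> ht' e; have [sg' h1 h2] := word_gallery ht' e1.
  by apply: (hmin _ _ h1) => //=; rewrite h2 amul1v e.
have [t' [h1 h2]] := gallery_word e1 hg; rewrite amul1v hl => h3.
have e := galc_inj en (letters_ext h1) h3.
have le := hmin' _ h1 (esym e).
have /eqP tt : t' == t by rewrite -(size_subseq_leqif h2).2 eqn_leq le (size_subseq h2).
by rewrite -tt; split=> // t'' k1 k2; rewrite tt; exact: hmin'.
Qed.

Lemma alen_Omegal g v : Omega g -> ext v -> alen (amul g v) = alen v.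
Proof.
move=> hg hv; have eg := Omega_ext hg.
by rewrite -(alenV _ (extM eg hv)) (ainvM eg hv) (alen_Omega (extV hv) (OmegaV hg)) alenV.
Qed.

Definition nsgen t : nat := count (fun s => `[< sgen s >]) t.

(** Letters of Omega cost no length, so T is multiplicative along the word as soon as each letter of
    S^a adds one. *)
Lemma wprodT_nsgen t : letters t -> (alen (wprod t) <= nsgen t)%N /\
  (alen (wprod t) = nsgen t -> wprodT t = T (wprod t)).
Proof.
elim: t => [|s t IH] /=; first by rewrite alen1 T1.
move=> /letters_cons [hs ht]; have [h1 h2] := IH ht; have hw := letters_ext ht.
case: hs => [hs|hs].
  rewrite /nsgen /= (asboolT hs) -/(nsgen t) add1n.
  case: (alen_stepl hw hs) => e; split; try lia.
  by rewrite e => -[/h2 ->]; rewrite T_upl.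
have ns : ~ sgen s by move=> /sgen_Omega.
rewrite /nsgen /= (asboolF ns) -/(nsgen t) add0n alen_Omegal //; split=> // /h2 ->.
have [es l0] := (OmegaE R B s).1 hs.
by rewrite TM // l0 alen_Omegal.
Qed.

Lemma wprodT_tmu mu t : dom mu -> is_tmu R B mu t ->
  letters t /\ wprodT t = T (nmin mu).
Proof.
move=> hm /(tmu_word hm) [ht e hmin]; split=> //; rewrite -e.
have [h1 h2] := wprodT_nsgen ht; apply: h2; apply/eqP; rewrite eqn_leq h1 /=.
have sl t' : sword R B t' -> letters t' by move=> h s /h; left.
(* Without letters of Omega, t competes with a reduced word in S^a alone. With one, it competes with
   a reduced word followed by one letter of Omega, and the extra 1 is made up for by the letter g of
   t outside S^a. *)
have [/allP al|/allPn [g gt /asboolP ng]] := boolP (all (fun s => `[< sgen s >]) t).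
  have st : sword R B t by move=> s /al /asboolP.
  have [t' [k1 k2 <- _]] := sword_reduce st.
  by apply: leq_trans (count_size _ _) _; apply: hmin; [exact: sl|rewrite k2].
have hw := letters_ext ht; have [t' /is_exprE [k1 [g' k2 k3]] k4] := expr_alen R B hw.
have : (size t <= size (rcons t' g'))%N.
  apply: hmin; last by rewrite -cats1 wprod_cat /= amulv1 -k3.
  by move=> s; rewrite mem_rcons inE => /orP[/eqP ->|/k1]; [right|left].
rewrite size_rcons k4 => hs.
have : (nsgen t < size t)%N.
  rewrite ltn_neqAle count_size andbT -all_count.
  by apply/allPn; exists g => //; apply/asboolP.
by move=> hlt; rewrite -ltnS (leq_trans hlt).
Qed.

End Galleries.

(** * Galleries as an expansion, and the two formulas *)

Section GallerySums.
Variables (R : realType) (n : nat) (D : rootDatum n) (B : rootBase D).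
Variables (d : affine n -> nat) (d_inv : conj_invariant R B d).
Variable H : heckeAlgebra R B d.
Variables (la mu : 'cV[int]_n) (t : seq (affine n)).
Hypotheses (hl : dominant B la) (hm : dominant B mu) (htmu : is_tmu R B mu t).
Implicit Types (nu : 'cV[int]_n) (v : affine n) (vs : seq (affine n)) (w : 'M[int]_n).
Local Notation ext := (ext_weyl D).
Local Notation galc := (@galc R n D B).
Local Notation kmin := (kmin B).
Local Notation qw w := (qv R B d (lin w)).
Local Notation w0 := (w0 R B).
Local Notation T := (hecke_T H).

Let ht : letters R B t := (wprodT_tmu H hm htmu).1.

(** Lifted galleries with their initial direction, which is minimal in its coset of W_la because the
    first alcove la + A_w must lie in C. *)
Definition start_gals : seq ('M[int]_n * seq (affine n)) :=
  [seq (w, vs) | w <- [seq w <- Wseq D | `[< kmin la w >]], vs <- gals R B t (la, w)].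

Lemma gal_wt_map v vs : ext (last v vs) -> gal_wt B (map galc (v :: vs)) = (last v vs).1.
Proof. by move=> h; rewrite -(wt_galc R B h) -last_map. Qed.

Lemma gal_ending_map v vs : ext (last v vs) ->
  gal_ending B (map galc (v :: vs)) = (last v vs).2.
Proof. by move=> h; rewrite -(delta_galc R B h) -last_map. Qed.

Lemma kmin_start w : kmin la w -> ext (la, w) /\ Cv B (la, w).
Proof.
move=> hw; have hww := kmin_weyl hw; split=> //.
exact/(trans_kmin hl hww).
Qed.

Lemma mem_start_gals w vs : (w, vs) \in start_gals ->
  [/\ kmin la w, vs \in gals R B t (la, w), exists r, vs = (la, w) :: r,
      forall u, u \in vs -> ext u & forall u, u \in vs -> Cv B u].
Proof.
move=> /allpairsPdep [w' [vs' [hw hvs [-> ->]]]].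
move: hw; rewrite mem_filter => /andP[/asboolP hw _].
have [h1 h2] := kmin_start hw.
by have [k1 k2 k3] := gals_cons ht h1 h2 hvs; split.
Qed.

Lemma uniq_start_gals : uniq start_gals.
Proof.
apply: allpairs_uniq_dep; first by rewrite filter_uniq // uniq_Wseq.
  move=> w; rewrite mem_filter => /andP[/asboolP hw _].
  by have [h1 h2] := kmin_start hw; exact: uniq_gals.
by move=> [w vs] [w' vs'] _ _ /= [-> ->].
Qed.

Lemma last_start_gals w vs v : (w, vs) \in start_gals -> last v vs \in vs.
Proof. by move=> /mem_start_gals [_ _ [r ->] _ _] /=; exact: mem_last. Qed.

Definition expansion : seq (coef * affine n) :=
  [seq (qw (w0 *m p.1) * C_gal B d t (map galc p.2), last (la, p.1) p.2) | p <- start_gals].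

Lemma expansion_kmin p : p \in expansion -> dominant B p.2.1 /\ kmin p.2.1 p.2.2.
Proof.
move=> /mapP[[w vs] hin ->] /=.
have hla := last_start_gals (la, w) hin.
have [_ _ _ /(_ _ hla) he /(_ _ hla) hc] := mem_start_gals hin.
have hd : dominant B (last (la, w) vs).1 by exact: (dominant_kf he hc).
by split=> //; apply/(trans_kmin hd he) => a pa; have := hc a pa; case: (last _ _).
Qed.

Lemma expansionE : Pm H la * T (nmin R B mu) =
  (qv R B d (trans la) / qw w0) *: \sum_(p <- expansion) p.1 *: Ev H p.2.
Proof.
rewrite Pm_Ev // -(wprodT_tmu H hm htmu).2 mulr_suml big_map scaler_sumr.
rewrite /start_gals big_allpairs_dep /= big_filter; apply: eq_bigr => w /asboolP hw.
have [h1 h2] := kmin_start hw.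
rewrite -scalerAl Ev_gals // scaler_sumr; apply: eq_bigr => vs _.
by rewrite !scalerA mulrA.
Qed.

Definition index_gals nu := [seq map galc p.2 | p <- start_gals & (last (la, p.1) p.2).1 == nu].

(** A generalized alcove determines its lift by [galc_inj], so distinct lifts give distinct
    galleries. *)
Lemma uniq_index_gals nu : uniq (index_gals nu).
Proof.
rewrite map_inj_in_uniq; first by rewrite filter_uniq // uniq_start_gals.
move=> [w vs] [w' vs']; rewrite !mem_filter /= => /andP[_ h1] /andP[_ h2] e.
have [_ _ [r e1] k1 _] := mem_start_gals h1; have [_ _ [r' e2] k2 _] := mem_start_gals h2.
suff e' : vs = vs' by move: e1; rewrite e' e2 => -[-> _].
elim: (vs) (vs') k1 k2 e => [|v us IH] [|v' us'] //= k1 k2 e.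
have e3 : galc v = galc v' := congr1 (head (galc v)) e.
have e4 : map galc us = map galc us' := congr1 behead e.
have -> : v = v' by apply: (galc_inj _ _ e3); [apply: k1|apply: k2]; exact: mem_head.
rewrite (IH us') //.
  by move=> u hu; apply: k1; rewrite inE hu orbT.
by move=> u hu; apply: k2; rewrite inE hu orbT.
Qed.

Lemma mem_index_gals nu sg : sg \in index_gals nu <-> Gamma R B t la nu sg.
Proof.
split.
  move=> /mapP[[w vs]]; rewrite mem_filter /= => /andP[/eqP e hin] ->.
  have [hw hvs [r er] k1 _] := mem_start_gals hin.
  have [h1 h2] := kmin_start hw.
  have [g1 g2 g3] := gals_allowed ht h1 h2 hvs; split=> //.
    by rewrite er; exact: (wt_galc R B h1).
  by rewrite er gal_wt_map; [rewrite -e er|apply: k1; rewrite er mem_last].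
case: sg => [|A sg] [h1 h2 h3 h4 h5]; first by case: h1.
have [v [hv hc ev]] := @allowed_start _ _ _ B t A sg (And3 h1 h2 h5).
have [vs hvs e] : exists2 vs, vs \in gals R B t v & galc v :: sg = map galc vs.
  apply: (allowed_gals ht hv hc); rewrite -ev; exact: (And3 h1 h2 h5).
have ev1 : v.1 = la by rewrite -h3 ev; exact/esym/(wt_galc R B hv).
have hw : kmin la v.2.
  by apply/(trans_kmin hl hv) => a pa; rewrite -ev1; have := hc a pa; case: (v).
have hin : (v.2, vs) \in start_gals.
  apply/allpairsPdep; exists v.2, vs; split=> //.
    rewrite mem_filter; apply/andP; split; [exact/asboolP|exact/mem_Wseq].
  by rewrite -ev1; move: hvs; case: (v).
apply/mapP; exists (v.2, vs); last by rewrite ev e.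
rewrite mem_filter hin andbT /=.
have [_ _ [r er] k1 _] := mem_start_gals hin.
by move: h4; rewrite ev e er gal_wt_map => [->//|]; apply: k1; rewrite er mem_last.
Qed.

(** F = 1 gives C_{la t}(nu), and F = F_{mu nu} gives the sum of the second formula. *)
Lemma sum_Gamma nu (F : 'M[int]_n -> coef) :
  \sum_(sg \in Gamma R B t la nu)
     q_of R B d (lin (w0 *m gal_initial B sg)) * C_gal B d t sg * F (gal_ending B sg) =
  \sum_(p <- expansion | p.2.1 == nu) p.1 * F p.2.2.
Proof.
have -> : Gamma R B t la nu = [set` index_gals nu].
  by apply/seteqP; split=> sg /mem_index_gals.
rewrite -fsbig_seq ?uniq_index_gals //.
rewrite big_map big_filter [RHS]big_map.
rewrite big_seq_cond [RHS]big_seq_cond; apply: eq_bigr => -[w vs] /= /andP[hin _].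
have [_ _ [r er] k1 _] := mem_start_gals hin.
have hi : gal_initial B (map galc ((la, w) :: r)) = w.
  by apply: (delta_galc R B (v := (la, w))); apply: k1; rewrite er mem_head.
rewrite er hi gal_ending_map ?q_ofE //.
by apply: k1; rewrite er mem_last.
Qed.

Lemma C_sumE nu : C_sum R B d t la nu = \sum_(p <- expansion | p.2.1 == nu) p.1.
Proof.
have := sum_Gamma nu (fun=> 1); under [RHS]eq_bigr do rewrite mulr1.
by move=> <-; rewrite /C_sum; apply: eq_fsbigr => sg _; rewrite mulr1.
Qed.

Lemma struct_const_C_sum nu : dominant B nu ->
  struct_const H la mu nu =
    poincareV R B d (stab D nu) / poincare R B d (stab D mu) * C_sum R B d t la nu.
Proof.
move=> hn; rewrite poincareE poincareVE C_sumE.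
exact: (struct_const_csum d_inv hl hm expansion_kmin expansionE hn).
Qed.

Lemma struct_const_sum_F nu : dominant B nu ->
  struct_const H la mu nu =
    (q_of R B d (lin (longest R B (stab D mu))))^-1
    * \sum_(sg \in Gamma R B t la nu)
        q_of R B d (lin (w0 *m gal_initial B sg)) * C_gal B d t sg
        * F_coef R B d (gal_ending B sg) mu nu.
Proof.
move=> hn; rewrite (sum_Gamma nu (fun w => F_coef R B d w mu nu)) q_ofE.
exact: (struct_const_F d_inv hl hm expansion_kmin expansionE hn).
Qed.

End GallerySums.

Theorem theorem4p10 (R : realType) (n : nat) (D : rootDatum n)
    (B : rootBase D) (d : affine n -> nat) (d_inv : conj_invariant R B d)
    (H : heckeAlgebra R B d) (la mu nu : 'cV[int]_n)
    (la_dom : dominant B la) (mu_dom : dominant B mu)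
    (nu_dom : dominant B nu) :
  (forall t : seq (affine n), is_tmu R B mu t ->
     struct_const H la mu nu =
       poincareV R B d (stab D nu) / poincare R B d (stab D mu)
       * C_sum R B d t la nu
     /\
     struct_const H la mu nu =
       (q_of R B d (lin (longest R B (stab D mu))))^-1
       * \sum_(sigma \in Gamma R B t la nu)
           q_of R B d (lin (w0 R B *m gal_initial B sigma))
           * C_gal B d t sigma
           * F_coef R B d (gal_ending B sigma) mu nu)
  /\
  (forall t t' : seq (affine n), is_tmu R B mu t -> is_tmu R B mu t' ->
     C_sum R B d t la nu = C_sum R B d t' la nu).
Proof.
split=> [t ht|t t' ht ht'].
  split; first exact: (struct_const_C_sum d_inv).
  exact: (struct_const_sum_F d_inv).
(* The structure constant does not involve t, so the first formula determines [C_sum] once its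
   prefactor is known to be nonzero. *)
have k0 : poincareV R B d (stab D nu) / poincare R B d (stab D mu) != 0.
  rewrite poincareE poincareVE; apply: mulf_neq0; first exact: WsumV_neq0.
  by rewrite invr_eq0; exact: Wsum_neq0.
apply: (mulfI k0).
rewrite -(struct_const_C_sum d_inv H la_dom mu_dom ht nu_dom).
exact: (struct_const_C_sum d_inv H la_dom mu_dom ht' nu_dom).
Qed.
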